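(* Let $\theta\in\mathbb R$. The embeddings of $\mathcal P(\mathbb T^2_\theta)$ in $\mathcal O(\mathbb T^2_\theta)$, $\mathcal S^\omega(\mathbb T^2_\theta)$ and $\mathcal S(\mathbb T^2_\theta)$ are isocohomological.
   Context: Let $\ell(m,n)=|m|+|n|$ on $\mathbb Z^2$ and, for $w\colon\mathbb Z^2\to\mathbb R_{>0}$, let $\ell_1(\mathbb Z^2,w)$ be the weighted $\ell_1$-space. As bornological vector spaces, the algebras of polynomial, holomorphic, real analytic, and smooth functions on the noncommutative torus are the following spaces of formal series $\sum a_{mn}U^mV^n$: $\mathcal P(\mathbb T^2_\theta)$: $(a_{mn})\in\mathbb C[\mathbb Z^2]$ with the fine bornology (bounded = contained and bounded in a finite dimensional subspace); $\mathcal O(\mathbb T^2_\theta)$: $(a_{mn})\in\bigcap_{\alpha>1}\ell_1(\mathbb Z^2,\alpha^\ell)$; $\mathcal S^\omega(\mathbb T^2_\theta)$: $(a_{mn})\in\bigcup_{\alpha>1}\ell_1(\mathbb Z^2,\alpha^\ell)$; $\mathcal S(\mathbb T^2_\theta)$: $(a_{mn})\in\bigcap_{k\in\mathbb N}\ell_1(\mathbb Z^2,(\ell+1)^k)$. A subset of an intersection is bounded if it is norm bounded in each of the spaces; a subset of the union is bounded if it is contained and norm bounded in one of the spaces. The multiplication is determined by $UV=\exp(2\pi\mathrm i\theta)VU$ with $U,V$ invertible. All bornological vector spaces are complete and convex (every bounded subset is contained in a bounded absolutely convex $T$ whose span is a Banach space with closed unit ball $T$). $\hat\otimes$ is the complete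 bornological tensor product (universal for bounded bilinear maps), and for a unital bornological algebra $A$, $M\hat\otimes_A N$ is the quotient of $M\hat\otimes N$ by the closure of the span of the elements $ma\otimes n-m\otimes an$. A conflation of bornological (bi)modules is an extension with a bounded linear section; projective objects are defined relative to conflations. A resolution is an augmented chain complex in nonnegative degrees with a bounded linear (not necessarily module) contracting homotopy. A bounded unital homomorphism $A\to B$ of unital bornological algebras is isocohomological if for a (equivalently, any) resolution $P_\bullet\to A$ by projective bornological $A$-bimodules, the complex $B\hat\otimes_A P_\bullet\hat\otimes_A B$ with its canonical augmentation to $B$ is a resolution of $B$. *)

(* Defs.v *)
From HB Require Import structures.
From mathcomp Require Import all_boot all_order all_algebra.
From mathcomp Require Import complex.
From mathcomp Require Import all_classical all_reals all_analysis.
From mathcomp Require Import zify.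

Set Implicit Arguments.
Unset Strict Implicit.
Unset Printing Implicit Defensive.

Import Order.TTheory GRing.Theory Num.Theory.
Import numFieldNormedType.Exports.
Import Normc.

Local Open Scope classical_set_scope.
Local Open Scope ring_scope.

(* The records [bornSpace], [bornAlg] and [bornBimod] carry only the data; the
   axioms are the predicates [complete_bornology], [bornological_algebra] and
   [bornological_bimodule]. *)
Record bornSpace (R : realType) := BornSpace {
  born_sort :> lmodType R[i];
  bornology : set (set born_sort) }.

Section BornologicalSpaces.
Variable R : realType.
Local Notation C := R[i].
Implicit Types V W X Q : bornSpace R.

Definition lspan (V : lmodType C) (S : set V) : set V :=
  [set x | exists (n : nat) (c : 'I_n -> C) (v : 'I_n -> V),
     (forall i, S (v i)) /\ x = \sum_i c i *: v i].

Definition absolutely_convex (V : lmodType C) (T : set V) : Prop :=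
  forall (a b : C) (x y : V), T x -> T y -> normc a + normc b <= 1 ->
    T (a *: x + b *: y).

Definition norm_on (V : lmodType C) (E : set V) (N : V -> R) : Prop :=
  [/\ forall x, E x -> N x = 0 -> x = 0,
      forall x y, E x -> E y -> N (x + y) <= N x + N y
    & forall (c : C) x, E x -> N (c *: x) = normc c * N x].

Definition complete_on (V : lmodType C) (E : set V) (N : V -> R) : Prop :=
  forall u : nat -> V, (forall n, E (u n)) ->
    (forall e : R, 0 < e -> exists n0, forall m n,
       (n0 <= m)%N -> (n0 <= n)%N -> N (u m - u n) < e) ->
    exists2 l, E l & (fun n => N (u n - l)) @ \oo --> (0 : R).

Definition complete_disk (V : lmodType C) (T : set V) : Prop :=
  absolutely_convex T /\
  exists N : V -> R, [/\ norm_on (lspan T) N, complete_on (lspan T) N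
    & T = [set x | lspan T x /\ N x <= 1]].

Definition complete_bornology V : Prop :=
  [/\ [/\ forall x : V, bornology [set x],
          forall S T : set V, bornology T -> S `<=` T -> bornology S
        & forall S T : set V, bornology S -> bornology T ->
            bornology (S `|` T)],
      [/\ forall S T : set V, bornology S -> bornology T ->
            bornology [set x + y | x in S & y in T]
        & forall (r : R) (S : set V), bornology S ->
            bornology [set c *: x | c in [set c : C | normc c <= r] & x in S]]
    & forall S : set V, bornology S ->
        exists T : set V, [/\ S `<=` T, bornology T & complete_disk T]].

Definition bounded_map V W (f : V -> W) : Prop :=
  forall S : set V, bornology S -> bornology (f @` S).

Definition bounded_bilinear V W X (b : V -> W -> X) : Prop :=
  [/\ forall v, linear (b v), forall w, linear (b^~ w)
    & forall (S : set V) (T : set W), bornology S -> bornology T ->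
        bornology [set b v w | v in S & w in T]].

Definition born_cvg V (u : nat -> V) (x : V) : Prop :=
  exists (T : set V) (e : nat -> R), [/\ bornology T, e @ \oo --> (0 : R)
    & forall n, exists2 t, T t & u n - x = (e n)%:C%C *: t].

Definition born_closed V (S : set V) : Prop :=
  forall (u : nat -> V) x, (forall n, S (u n)) -> born_cvg u x -> S x.

Definition born_closure V (S : set V) : set V :=
  [set x | forall F : set V, born_closed F -> S `<=` F -> F x].

(* [q] exhibits [Q] as the quotient [V / W] with the quotient bornology. *)
Definition is_quotient V (W : set V) Q (q : {linear V -> Q}) : Prop :=
  [/\ forall y, exists x, q x = y, forall x, q x = 0 <-> W x
    & forall S : set Q, bornology S <-> exists2 S', bornology S' & S = q @` S'].

(* The complete bornological tensor product is determined up to isomorphism by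
   its universal property; [is_ctensor tau] says that [tau : V -> W -> T] is
   such a universal bounded bilinear map. *)
Definition is_ctensor V W (T : bornSpace R) (tau : V -> W -> T) : Prop :=
  [/\ complete_bornology T, bounded_bilinear tau
    & forall X, complete_bornology X ->
      forall b : V -> W -> X, bounded_bilinear b ->
      exists f : {linear T -> X},
        [/\ bounded_map f, forall v w, f (tau v w) = b v w
          & forall g : {linear T -> X}, bounded_map g ->
              (forall v w, g (tau v w) = b v w) -> g =1 f]].

Definition fine_bornology (V : lmodType C) : set (set V) :=
  [set S | exists (n : nat) (v : 'I_n -> V) (M : R), forall x, S x ->
     exists2 c : 'I_n -> C, forall i, normc (c i) <= M & x = \sum_i c i *: v i].

End BornologicalSpaces.

Record bornAlg (R : realType) := BornAlg {
  alg_space :> bornSpace R;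
  amul : alg_space -> alg_space -> alg_space;
  aone : alg_space }.

Record bornBimod (R : realType) (A B : bornAlg R) := BornBimod {
  bimod_space :> bornSpace R;
  lact : A -> bimod_space -> bimod_space;
  ract : bimod_space -> B -> bimod_space }.

Section AlgebrasAndModules.
Variable R : realType.
Implicit Types A B : bornAlg R.

Definition bornological_algebra A : Prop :=
  [/\ complete_bornology A, bounded_bilinear (@amul R A),
      associative (@amul R A)
    & left_id (aone A) (@amul R A) /\ right_id (aone A) (@amul R A)].

Definition bornological_hom A B (f : A -> B) : Prop :=
  [/\ linear f, bounded_map f, {morph f : a b / amul a b}
    & f (aone A) = aone B].

Definition bornological_bimodule A B (M : bornBimod A B) : Prop :=
  [/\ complete_bornology M,
      [/\ bounded_bilinear (@lact R A B M),
          forall m : M, lact (aone A) m = m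
        & forall a a' (m : M), lact (amul a a') m = lact a (lact a' m)],
      [/\ bounded_bilinear (@ract R A B M),
          forall m : M, ract m (aone B) = m
        & forall (m : M) b b', ract m (amul b b') = ract (ract m b) b']
    & forall a (m : M) b, ract (lact a m) b = lact a (ract m b)].

Definition bimodule_hom A B (M N : bornBimod A B) (f : {linear M -> N}) : Prop :=
  [/\ bounded_map f, forall a m, f (lact a m) = lact a (f m)
    & forall m b, f (ract m b) = ract (f m) b].

Definition conflation A B (K E Q : bornBimod A B)
    (i : {linear K -> E}) (p : {linear E -> Q}) : Prop :=
  [/\ [/\ bornological_bimodule K, bornological_bimodule E
        & bornological_bimodule Q],
      bimodule_hom i /\ bimodule_hom p,
      [/\ injective i, forall x, p x = 0 <-> range i x
        & forall S : set K, bornology (i @` S) -> bornology S]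
    & exists2 s : {linear Q -> E}, bounded_map s & cancel s p].

Definition projective A B (P : bornBimod A B) : Prop :=
  forall (K E Q : bornBimod A B) (i : {linear K -> E}) (p : {linear E -> Q}),
    conflation i p ->
    forall g : {linear P -> Q}, bimodule_hom g ->
    exists2 h : {linear P -> E}, bimodule_hom h & forall x, p (h x) = g x.

Definition resolution A B (P : nat -> bornBimod A B) (M : bornBimod A B)
    (d : forall n, {linear P n.+1 -> P n}) (eps : {linear P 0 -> M}) : Prop :=
  [/\ bornological_bimodule M /\ (forall n, bornological_bimodule (P n)),
      bimodule_hom eps /\ (forall n, bimodule_hom (d n)),
      (forall x, eps (d 0 x) = 0) /\ (forall n x, d n (d n.+1 x) = 0)
    & exists (sM : {linear M -> P 0}) (s : forall n, {linear P n -> P n.+1}),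
        [/\ bounded_map sM /\ (forall n, bounded_map (s n)),
            forall m, eps (sM m) = m,
            forall x, d 0 (s 0 x) + sM (eps x) = x
          & forall n x, d n.+1 (s n.+1 x) + s n (d n x) = x]].

(* [M (x)_A N] with its [B]-[D]-bimodule structure: the quotient of the complete
   tensor product [M (x) N] by the closure of the span of the elements
   [ma (x) n - m (x) an]. *)
Definition is_tensor B A D (M : bornBimod B A) (N : bornBimod A D)
    (T : bornBimod B D) (tau : M -> N -> T) : Prop :=
  [/\ exists (X : bornSpace R) (tau0 : M -> N -> X) (q : {linear X -> T}),
        [/\ is_ctensor tau0,
            is_quotient (born_closure (lspan
              [set x | exists m a n,
                 x = tau0 (ract m a) n - tau0 m (lact a n)])) q
          & forall m n, q (tau0 m n) = tau m n],
      bornological_bimodule T,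
      forall b m n, lact b (tau m n) = tau (lact b m) n
    & forall m n d, ract (tau m n) d = tau m (ract n d)].

Definition alg_bimod A : bornBimod A A := BornBimod (@amul R A) (@amul R A).

Definition left_bimod A B (f : A -> B) : bornBimod B A :=
  @BornBimod R B A B (@amul R B) (fun b a => amul b (f a)).

Definition right_bimod A B (f : A -> B) : bornBimod A B :=
  @BornBimod R A B B (fun a b => amul (f a) b) (@amul R B).

(* [L n] and [Q n] are [B (x)_A P n] and [(B (x)_A P n) (x)_A B]; the boundary
   [D] and augmentation [E] are the induced ones, which are determined by their
   values on elementary tensors. *)
Definition isocohomological A B (f : A -> B) : Prop :=
  [/\ bornological_algebra A, bornological_algebra B, bornological_hom f
    & exists (P : nat -> bornBimod A A) (d : forall n, {linear P n.+1 -> P n})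
             (eps : {linear P 0 -> alg_bimod A}),
      [/\ resolution d eps, forall n, projective (P n)
        & exists (L : nat -> bornBimod B A) (Q : nat -> bornBimod B B)
            (tau : forall n, left_bimod f -> P n -> L n)
            (sigma : forall n, L n -> right_bimod f -> Q n)
            (D : forall n, {linear Q n.+1 -> Q n})
            (E : {linear Q 0 -> alg_bimod B}),
          [/\ forall n, is_tensor (@tau n) /\ is_tensor (@sigma n),
              forall n (b : B) x (b' : B),
                D n (sigma n.+1 (tau n.+1 b x) b') = sigma n (tau n b (d n x)) b',
              forall (b : B) x (b' : B),
                E (sigma 0 (tau 0 b x) b') = amul (amul b (f (eps x))) b'
            & resolution D E]]].

End AlgebrasAndModules.

Section Subspaces.
Variables (K : pzRingType) (V : lmodType K).

Record subspace := Subspace {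
  subspace_set :> set V;
  subspace0 : subspace_set 0;
  subspaceP : forall (c : K) x y,
    subspace_set x -> subspace_set y -> subspace_set (c *: x + y) }.

Record subspace_of (E : subspace) := SubspaceOf {
  subspace_val : V;
  subspace_valP : subspace_val \in (E : set V) }.

Variable E : subspace.

HB.instance Definition _ := [isSub for @subspace_val E].
HB.instance Definition _ := [Choice of subspace_of E by <:].

Lemma subspace_closed : GRing.subsemimod_closed (mem (E : set V)).
Proof.
have E0 := subspace0 E; have EP := @subspaceP E.
split; first split.
- exact: mem_set.
- move=> x y /set_mem Ex /set_mem Ey; apply: mem_set.
  by rewrite -[x]scale1r; apply: EP.
- move=> c x /set_mem Ex; apply: mem_set.
  by rewrite -[_ *: _]addr0; apply: EP.
Qed.

HB.instance Definition _ :=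
  GRing.SubChoice_isSubLmodule.Build K V (mem (E : set V)) (subspace_of E)
    subspace_closed.

End Subspaces.

Definition Z2 : zmodType := (int * int)%type.

Definition ell (x : Z2) : nat := (`|x.1| + `|x.2|)%N.

Section Torus.
Variable R : realType.
Local Notation C := R[i].
Local Notation coefs := (Z2 -> C).
Implicit Types (a b : coefs) (w : Z2 -> R).

Definition wnorm w a : \bar R := \esum_(x in [set: Z2]) (normc (a x) * w x)%:E.

Definition exp_weight (alpha : R) : Z2 -> R := fun x => alpha ^+ ell x.
Definition pol_weight (k : nat) : Z2 -> R := fun x => (ell x).+1%:R ^+ k.

Definition poly_set : set coefs := [set a | finite_set [set x | a x != 0]].
Definition hol_set : set coefs :=
  [set a | forall alpha : R, 1 < alpha -> (wnorm (exp_weight alpha) a < +oo)%E].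
Definition ana_set : set coefs :=
  [set a | exists2 alpha : R, 1 < alpha & (wnorm (exp_weight alpha) a < +oo)%E].
Definition smooth_set : set coefs :=
  [set a | forall k, (wnorm (pol_weight k) a < +oo)%E].

(* Sums over [Z2] of absolutely summable families, as differences of sums of
   nonnegative families. *)
Definition rsum (f : Z2 -> R) : R :=
  fine (\esum_(x in [set: Z2]) (Num.max (f x) 0)%:E)
  - fine (\esum_(x in [set: Z2]) (Num.max (- f x) 0)%:E).

Definition csum (f : Z2 -> C) : C :=
  Complex (rsum (fun x => complex.Re (f x))) (rsum (fun x => complex.Im (f x))).

Definition lambda (theta : R) : C :=
  Complex (cos (2 * pi * theta)) (sin (2 * pi * theta)).

(* The product of the formal series [sum a_mn U^m V^n] and [sum b_mn U^m V^n]: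
   [U V = lambda V U] gives
   [U^p V^q U^r V^s = lambda^(- q r) U^(p + r) V^(q + s)]. *)
Definition tconv (theta : R) a b : coefs := fun x =>
  csum (fun y => a y * b (x - y) * lambda theta ^ (- (y.2 * (x - y).1))).

Definition delta (z : Z2) : coefs := fun x => (x == z)%:R.

Lemma normc_ge0 (z : C) : 0 <= normc z.
Proof. by case: z => x y /=; rewrite sqrtr_ge0. Qed.

Lemma normc_Re (z : C) : `|complex.Re z| <= normc z.
Proof.
case: z => x y /=; rewrite -sqrtr_sqr ler_wsqrtr// lerDl sqr_ge0//.
Qed.

Lemma normc_Im (z : C) : `|complex.Im z| <= normc z.
Proof.
case: z => x y /=; rewrite -sqrtr_sqr ler_wsqrtr// lerDr sqr_ge0//.
Qed.

Lemma normc_le (r s : R) : normc (Complex r s) <= `|r| + `|s|.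
Proof.
have rs0 : 0 <= `|r| + `|s| by rewrite addr_ge0.
rewrite /= -(ger0_norm rs0) -(sqrtr_sqr (`|r| + `|s|)) ler_wsqrtr//.
rewrite [leRHS]sqrrD -[`|r| ^+ 2]normrX -[`|s| ^+ 2]normrX !(ger0_norm (sqr_ge0 _)).
by rewrite addrAC lerDl mulrn_wge0// mulr_ge0.
Qed.

Lemma normcX (z : C) n : normc (z ^+ n) = normc z ^+ n.
Proof.
elim: n => [|n IH]; first by rewrite !expr0 normc1.
by rewrite !exprS normcM IH.
Qed.

Lemma normc_lambda theta (k : int) : normc (lambda theta ^ k) = 1.
Proof.
have h : normc (lambda theta) = 1 by rewrite /= cos2Dsin2 sqrtr1.
by case: k => n; rewrite ?NegzE -?exprnP -?exprnN ?normcV normcX h expr1n ?invr1.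
Qed.


Lemma esumZ_le (c : R) (f : Z2 -> R) : 0 <= c -> (forall x, 0 <= f x) ->
  (\esum_(x in [set: Z2]) (c * f x)%:E
     <= c%:E * \esum_(x in [set: Z2]) (f x)%:E)%E.
Proof.
move=> c0 f0; apply: ge_ereal_sup => _ [X [finX _]] <-.
have -> : (\sum_(x \in X) (c * f x)%:E = c%:E * \sum_(x \in X) (f x)%:E)%E.
  by rewrite ge0_mule_fsumr// => x; rewrite lee_fin.
rewrite lee_wpmul2l ?lee_fin//; apply: esum_ge; exists X => //.
Qed.

Lemma esumZ (c : R) (f : Z2 -> R) : 0 <= c -> (forall x, 0 <= f x) ->
  (\esum_(x in [set: Z2]) (c * f x)%:E
     = c%:E * \esum_(x in [set: Z2]) (f x)%:E)%E.
Proof.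
move=> c0 f0; apply/eqP; rewrite eq_le esumZ_le//=.
have [->|cN0] := eqVneq c 0.
  by rewrite mul0e; apply: esum_ge0 => x _; rewrite mul0r.
have c_gt0 : 0 < c by rewrite lt_neqAle eq_sym cN0.
have := @esumZ_le c^-1 (fun x => c * f x).
rewrite invr_ge0 c0 => /(_ isT (fun x => mulr_ge0 c0 (f0 x))).
under eq_esum do rewrite mulKf//.
by rewrite lee_pdivlMl.
Qed.

Lemma wnorm_lin w (c : C) a b : (forall x, 0 <= w x) ->
  (wnorm w (c *: a + b)%R <= (normc c)%:E * wnorm w a + wnorm w b)%E.
Proof.
move=> w0; apply: (@le_trans _ _
  (\esum_(x in [set: Z2]) ((normc c * (normc (a x) * w x))%:E + (normc (b x) * w x)%:E))%E).
  apply: le_esum => x _; rewrite -EFinD lee_fin mulrA -mulrDl ler_wpM2r//.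
  by rewrite -normcM le_normcD.
rewrite esumD; last 2 first.
- by move=> x _; rewrite lee_fin !mulr_ge0// normc_ge0.
- by move=> x _; rewrite lee_fin !mulr_ge0// normc_ge0.
rewrite leeD2r//; apply: esumZ_le; first exact: normc_ge0.
by move=> x; rewrite mulr_ge0// normc_ge0.
Qed.

Lemma wnorm_ge0 w a : (forall x, 0 <= w x) -> (0 <= wnorm w a)%E.
Proof. by move=> w0; apply: esum_ge0 => x _; rewrite lee_fin mulr_ge0// normc_ge0. Qed.

Lemma mul_lty (x y : \bar R) : (0 <= x)%E -> (0 <= y)%E ->
  (x < +oo)%E -> (y < +oo)%E -> (x * y < +oo)%E.
Proof. by case: x y => [x| |] [y| |]//= _ _ _ _; rewrite -EFinM ltry. Qed.

Lemma wnorm_lin_lty w (c : C) a b : (forall x, 0 <= w x) ->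
  (wnorm w a < +oo -> wnorm w b < +oo -> wnorm w (c *: a + b)%R < +oo)%E.
Proof.
move=> w0 ha hb; apply: le_lt_trans (wnorm_lin c a b w0) _.
apply: lte_add_pinfty => //; apply: mul_lty => //; last by rewrite ltry.
  by rewrite lee_fin normc_ge0.
exact: wnorm_ge0.
Qed.

Lemma wnorm_fin w a : (forall x, 0 <= w x) -> poly_set a -> (wnorm w a < +oo)%E.
Proof.
move=> w0 fa; rewrite /wnorm.
have -> : (\esum_(x in [set: Z2]) (normc (a x) * w x)%:E =
   \esum_(x in [set x | a x != 0%R]) (normc (a x) * w x)%:E)%E.
  rewrite [RHS]esum_mkcond; apply: eq_esum => x _.
  case: ifPn => //; rewrite notin_setE /= => /negP; rewrite negbK => /eqP ->.
  by rewrite normc0 mul0r.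
rewrite esum_fset//; last first.
  by move=> x _; rewrite lee_fin mulr_ge0// normc_ge0.
by rewrite fsbig_finite//= sumEFin ltry.
Qed.

Lemma wnorm_mono w w' a : (forall x, w x <= w' x) -> (wnorm w a <= wnorm w' a)%E.
Proof.
by move=> h; apply: le_esum => x _; rewrite lee_fin ler_wpM2l// normc_ge0.
Qed.

Lemma exp_weight_ge0 (alpha : R) x : 1 < alpha -> 0 <= exp_weight alpha x.
Proof. by move=> h; rewrite exprn_ge0// ltW// (lt_trans ltr01). Qed.

Lemma pol_weight_ge0 k x : 0 <= pol_weight k x.
Proof. by rewrite exprn_ge0. Qed.

Lemma ell_tri (x y : Z2) : (ell x <= ell y + ell (x - y)%R)%N.
Proof. by case: x y => [x1 x2] [y1 y2]; rewrite /ell /=; lia. Qed.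

Lemma exp_weight_sub (alpha : R) x y : 1 < alpha ->
  exp_weight alpha x <= exp_weight alpha y * exp_weight alpha (x - y).
Proof. by move=> h; rewrite -exprD ler_weXn2l ?ell_tri// ltW. Qed.

Lemma pol_weight_sub k x y : pol_weight k x <= pol_weight k y * pol_weight k (x - y).
Proof.
rewrite -exprMn lerXn2r ?nnegrE ?mulr_ge0// -natrM ler_nat.
have := ell_tri x y; nia.
Qed.

Lemma rsum_le (f g : Z2 -> R) : (forall x, `|f x| <= g x) ->
  (`|rsum f|%:E <= \esum_(x in [set: Z2]) (g x)%:E)%E.
Proof.
move=> fg; have g0 x : 0 <= g x by apply: le_trans (fg x).
have pos h : (forall x, `|h x| <= g x) ->
    (0 <= \esum_(x in [set: Z2]) (Num.max (h x) 0)%:E <= \esum_(x in [set: Z2]) (g x)%:E)%E.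
  move=> hg; apply/andP; split; first by apply: esum_ge0 => x _; rewrite lee_fin le_max lexx orbT.
  by apply: le_esum => x _; rewrite lee_fin ge_max g0 andbT (le_trans _ (hg x))// ler_norm.
have /andP[p0 pg] := pos f fg.
have /andP[n0 ng] : (0 <= \esum_(x in [set: Z2]) (Num.max (- f x) 0)%:E <= \esum_(x in [set: Z2]) (g x)%:E)%E.
  by apply: (pos (fun x => - f x)) => x; rewrite normrN.
move: p0 pg n0 ng; rewrite /rsum.
case: (\esum_(x in [set: Z2]) (g x)%:E)%E => [G| |]; last 2 first.
- by move=> *; rewrite leey.
- by move=> p0 /(le_trans p0).
case: (\esum_(x in _) _)%E => [p| |]//=.
case: (\esum_(x in _) _)%E => [n| |]//=.
rewrite !lee_fin => p0 pG n0 nG; rewrite ler_norml; apply/andP; split.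
  by rewrite lerBrDl (le_trans _ p0)// subr_le0.
by rewrite lerBlDl (le_trans pG)// lerDr.
Qed.

Lemma csum_le (f : Z2 -> C) :
  ((normc (csum f))%:E <= 2%:E * \esum_(x in [set: Z2]) (normc (f x))%:E)%E.
Proof.
have h1 := @rsum_le (fun x => complex.Re (f x)) (fun x => normc (f x)) (fun x => normc_Re (f x)).
have h2 := @rsum_le (fun x => complex.Im (f x)) (fun x => normc (f x)) (fun x => normc_Im (f x)).
rewrite (_ : 2%:E = 1 + 1)%E// ge0_muleDl// mul1e.
have h := leeD h1 h2; apply: le_trans h; rewrite -EFinD lee_fin /csum /=.
exact: normc_le.
Qed.

Lemma wnorm_tconv theta w a b : (forall x, 0 <= w x) ->
  (forall x y, w x <= w y * w (x - y)) ->
  (wnorm w a < +oo -> wnorm w b < +oo -> wnorm w (tconv theta a b) < +oo)%E.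
Proof.
move=> w0 wM ha hb.
have p0 u x : 0 <= normc (u x : C) * w x by rewrite mulr_ge0// normc_ge0.
suff : (wnorm w (tconv theta a b) <= 2%:E * (wnorm w a * wnorm w b))%E.
  move/le_lt_trans; apply; rewrite mul_lty ?ltry ?lee_fin ?mule_ge0 ?wnorm_ge0//.
  by rewrite mul_lty ?wnorm_ge0.
pose A y := normc (a y) * w y; pose B y := normc (b y) * w y.
have A0 y : 0 <= A y := p0 a y.
have B0 y : 0 <= B y := p0 b y.
have [S hS S0] : exists2 S : R, wnorm w b = S%:E & 0 <= S.
  move: hb (wnorm_ge0 b w0); case: (wnorm w b) => [S| |]//= _ S0.
  by exists S.
have swap : (\esum_(x in [set: Z2]) \esum_(y in [set: Z2]) (A y * B (x - y))%:E
    = wnorm w a * wnorm w b)%E.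
  rewrite esum_esum; last by move=> x y _ _; rewrite lee_fin mulr_ge0.
  rewrite (@reindex_esum _ _ _ [set: Z2 * Z2] _ (fun p => (p.2, p.1))); last first.
    split=> [[x y] _|[x y] [x' y'] _ _ [-> ->]|[x y] _]//=.
    by exists (y, x).
  have -> : [set: Z2 * Z2] = [set: Z2] `*`` (fun=> [set: Z2]).
    by apply/seteqP; split=> p.
  rewrite -(@esum_esum _ _ _ _ _ (fun y x => (A y * B (x - y))%:E)); last first.
    by move=> x y _ _; rewrite lee_fin mulr_ge0.
  have e y : (\esum_(x in [set: Z2]) (A y * B (x - y))%:E = (S * A y)%:E)%E.
    rewrite (esumZ (f := fun x => B (x - y)))// [(S * A y)%R]mulrC [RHS]EFinM; congr (_ * _)%E.
    rewrite -hS /wnorm [RHS](@reindex_esum _ _ _ [set: Z2] [set: Z2] (fun x => x - y))//.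
    split=> [//|x x' _ _ /addIr//|x _].
    by exists (x + y) => //=; rewrite addrK.
  under eq_esum do rewrite e.
  by rewrite esumZ// hS muleC.
rewrite -swap.
have q0 x y : 0 <= normc (a y) * normc (b (x - y)) by rewrite mulr_ge0// normc_ge0.
apply: (@le_trans _ _ (\esum_(x in [set: Z2]) (2%:E * \esum_(y in [set: Z2]) (A y * B (x - y))%:E))%E).
  apply: le_esum => x _; rewrite EFinM muleC.
  apply: (@le_trans _ _ ((w x)%:E * (2%:E * \esum_(y in [set: Z2]) (normc (a y) * normc (b (x - y)))%:E))%E).
    rewrite lee_wpmul2l ?lee_fin//; apply: le_trans (csum_le _) _.
    rewrite lee_wpmul2l ?lee_fin//; apply: le_esum => y _.
    by rewrite !normcM normc_lambda mulr1.
  rewrite muleCA lee_wpmul2l ?lee_fin// -esumZ//.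
  apply: le_esum => y _; rewrite lee_fin /A /B [leRHS]mulrACA mulrC.
  by rewrite ler_wpM2l.
pose F x := (\esum_(y in [set: Z2]) (A y * B (x - y))%:E)%E.
have F0 x : (0 <= F x)%E by apply: esum_ge0 => y _; rewrite lee_fin mulr_ge0.
rewrite (_ : 2%:E = 1 + 1)%E//.
under eq_esum do rewrite ge0_muleDl// mul1e.
by rewrite esumD ?ge0_muleDl ?mul1e// => x _; apply: F0.
Qed.

Lemma csum0 (f : Z2 -> C) : (forall x, f x = 0) -> csum f = 0.
Proof.
move=> f0; have r0 (g : Z2 -> R) : (forall x, g x = 0) -> rsum g = 0.
  move=> g0; rewrite /rsum !esum1 ?subrr// => x _; rewrite g0 ?oppr0 maxxx//.
by rewrite /csum !r0// => x; rewrite f0.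
Qed.

Lemma csum1 (f : Z2 -> C) z : (forall x, x != z -> f x = 0) -> csum f = f z.
Proof.
move=> h.
have e (k : Z2 -> R) : (forall x, x != z -> k x = 0) -> (forall x, 0 <= k x) ->
    (\esum_(x in [set: Z2]) (k x)%:E = (k z)%:E)%E.
  move=> hk k0; transitivity (\esum_(x in [set z]) (k x)%:E)%E; last first.
    by rewrite esum_set1 ?lee_fin.
  rewrite [RHS]esum_mkcond; apply: eq_esum => x _.
  by case: ifPn => //; rewrite notin_setE /= => /eqP xz; rewrite hk.
have r (g : Z2 -> R) : (forall x, x != z -> g x = 0) -> rsum g = g z.
  move=> hg; rewrite /rsum.
  rewrite (e (fun x => Num.max (g x) 0)) ?(e (fun x => Num.max (- g x) 0)) /=.
  - case: (lerP 0 (g z)) => gz; first by rewrite max_r ?subr0 // oppr_le0.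
    by rewrite max_l ?opprK ?add0r // oppr_ge0 ltW.
  - by move=> x /hg ->; rewrite oppr0 maxxx.
  - by move=> x; rewrite le_max lexx orbT.
  - by move=> x /hg ->; rewrite maxxx.
  - by move=> x; rewrite le_max lexx orbT.
by rewrite /csum !r => [|x /h ->|x /h ->]//; case: (f z).
Qed.

Lemma tconv_delta theta (y z : Z2) : tconv theta (delta y) (delta z)
  = lambda theta ^ (- (y.2 * z.1)) *: delta (y + z).
Proof.
apply/funext => x; rewrite /tconv (@csum1 _ y).
  rewrite /delta eqxx mul1r !fctE /=.
  have -> : (x - y == z) = (x == y + z) by rewrite subr_eq addrC.
  case: (eqVneq x (y + z)) => [->|_]; last by rewrite mul0r scaler0.
  by rewrite mul1r [y + z]addrC addrK; exact: (esym (mulr1 _)).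
by move=> u uy; rewrite /delta (negbTE uy) !mul0r.
Qed.

Lemma torus_relation theta : tconv theta (delta (1, 0)) (delta (0, 1))
  = lambda theta *: tconv theta (delta (0, 1)) (delta (1, 0)).
Proof.
rewrite !tconv_delta scalerA /= mul0r oppr0 expr0z scale1r mul1r.
have -> : lambda theta * lambda theta ^ (-1) = 1.
  rewrite exprN1 divff //; apply/eqP => e; have := normc_lambda theta 1.
  by rewrite expr1z e normc0 => /eqP; rewrite eq_sym oner_eq0.
by rewrite scale1r.
Qed.

Lemma poly_tconv theta a b : poly_set a -> poly_set b -> poly_set (tconv theta a b).
Proof.
rewrite /poly_set /= => fa fb.
apply: (@sub_finite_set _ _ [set x + y | x in [set x | a x != 0] & y in [set y | b y != 0]]).
  move=> x /= nz; apply: contrapT => h; move/eqP: nz; apply; apply: csum0 => y.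
  have [->|ay] := eqVneq (a y) 0; first by rewrite !mul0r.
  have [->|bxy] := eqVneq (b (x - y)) 0; first by rewrite mulr0 mul0r.
  by exfalso; apply: h; exists y => //; exists (x - y) => //=; rewrite addrC subrK.
exact: finite_image2.
Qed.

Lemma poly_delta z : poly_set (delta z).
Proof.
apply: (@sub_finite_set _ _ [set z]) => // x h; apply: contrapT => xz.
by move/eqP: h; apply; rewrite /delta (_ : (x == z) = false)//; apply/eqP.
Qed.

Lemma poly_hol a : poly_set a -> hol_set a.
Proof. by move=> pa al h; apply: wnorm_fin => // x; apply: exp_weight_ge0. Qed.

Lemma poly_ana a : poly_set a -> ana_set a.
Proof. by move=> pa; exists 2; [rewrite ltr1n|apply: poly_hol => //; rewrite ltr1n]. Qed.

Lemma poly_smooth a : poly_set a -> smooth_set a.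
Proof. by move=> pa k; apply: wnorm_fin => // x; apply: pol_weight_ge0. Qed.

Lemma poly_set0 : poly_set 0.
Proof. by apply: (@sub_finite_set _ _ set0) => // x /eqP. Qed.

Lemma poly_lin (c : C) a b : poly_set a -> poly_set b -> poly_set (c *: a + b).
Proof.
move=> fa fb; apply: (@sub_finite_set _ _ ([set x | a x != 0] `|` [set x | b x != 0])).
  move=> x /= nz; have [ax|ax] := eqVneq (a x) 0; last by left.
  by right; apply: contra_neq nz => bx; rewrite !fctE ax bx scaler0 addr0.
by rewrite finite_setU.
Qed.

Lemma hol_lin (c : C) a b : hol_set a -> hol_set b -> hol_set (c *: a + b).
Proof.
move=> ha hb al h; apply: wnorm_lin_lty; [|exact: ha|exact: hb].
by move=> x; apply: exp_weight_ge0.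
Qed.

Lemma smooth_lin (c : C) a b : smooth_set a -> smooth_set b -> smooth_set (c *: a + b).
Proof.
move=> ha hb k; apply: wnorm_lin_lty; [|exact: ha|exact: hb].
by move=> x; apply: pol_weight_ge0.
Qed.

Lemma ana_common a b : ana_set a -> ana_set b -> exists2 alpha : R, 1 < alpha &
  (wnorm (exp_weight alpha) a < +oo)%E /\ (wnorm (exp_weight alpha) b < +oo)%E.
Proof.
move=> [al hal ha] [be hbe hb]; exists (Num.min al be); first by rewrite lt_min hal.
have m1 : 1 < Num.min al be by rewrite lt_min hal.
have m0 : 0 <= Num.min al be by rewrite ltW// (lt_trans ltr01).
by split; [apply: le_lt_trans ha|apply: le_lt_trans hb]; apply: wnorm_mono => x;
  rewrite /exp_weight lerXn2r ?nnegrE ?ge_min ?lexx ?orbT// ltW// (lt_trans ltr01).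
Qed.

Lemma ana_lin (c : C) a b : ana_set a -> ana_set b -> ana_set (c *: a + b).
Proof.
move=> ha hb; have [al h [ha' hb']] := ana_common ha hb; exists al => //.
by apply: wnorm_lin_lty => // x; apply: exp_weight_ge0.
Qed.

Lemma hol_tconv theta a b : hol_set a -> hol_set b -> hol_set (tconv theta a b).
Proof.
move=> ha hb al h; apply: wnorm_tconv; [| |exact: ha|exact: hb].
  by move=> x; apply: exp_weight_ge0.
by move=> x y; apply: exp_weight_sub.
Qed.

Lemma ana_tconv theta a b : ana_set a -> ana_set b -> ana_set (tconv theta a b).
Proof.
move=> ha hb; have [al h [ha' hb']] := ana_common ha hb; exists al => //.
apply: wnorm_tconv => //; first by move=> x; apply: exp_weight_ge0.
by move=> x y; apply: exp_weight_sub.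
Qed.

Lemma smooth_tconv theta a b :
  smooth_set a -> smooth_set b -> smooth_set (tconv theta a b).
Proof.
move=> ha hb k; apply: wnorm_tconv; [| |exact: ha|exact: hb].
  by move=> x; apply: pol_weight_ge0.
by move=> x y; apply: pol_weight_sub.
Qed.

Definition poly_sub := Subspace poly_set0 poly_lin.
Definition hol_sub := Subspace (poly_hol poly_set0) hol_lin.
Definition ana_sub := Subspace (poly_ana poly_set0) ana_lin.
Definition smooth_sub := Subspace (poly_smooth poly_set0) smooth_lin.

Definition poly_space := BornSpace (fine_bornology (V := subspace_of poly_sub)).

Definition norm_bounded (E : subspace coefs) w (S : set (subspace_of E)) : Prop :=
  exists M : R, forall u, S u -> (wnorm w (\val u) <= M%:E)%E.

Definition hol_space := @BornSpace R (subspace_of hol_sub)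
  [set S | forall alpha : R, 1 < alpha -> norm_bounded (exp_weight alpha) S].

Definition ana_space := @BornSpace R (subspace_of ana_sub)
  [set S | exists2 alpha : R, 1 < alpha & norm_bounded (exp_weight alpha) S].

Definition smooth_space := @BornSpace R (subspace_of smooth_sub)
  [set S | forall k : nat, norm_bounded (pol_weight k) S].

Definition sub_elt (E : subspace coefs) a (Ea : subspace_set E a) :
  subspace_of E := SubspaceOf (mem_set Ea).

Definition sub_map (E F : subspace coefs) (f : coefs -> coefs)
    (Ef : forall a, subspace_set E a -> subspace_set F (f a))
    (u : subspace_of E) : subspace_of F :=
  sub_elt (Ef _ (set_mem (subspace_valP u))).

Definition sub_mul (E : subspace coefs) (m : coefs -> coefs -> coefs)
    (Em : forall a b, subspace_set E a -> subspace_set E b ->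
       subspace_set E (m a b)) (u v : subspace_of E) : subspace_of E :=
  sub_elt (Em _ _ (set_mem (subspace_valP u)) (set_mem (subspace_valP v))).

Definition torus_poly (theta : R) : bornAlg R :=
  @BornAlg R poly_space (@sub_mul poly_sub _ (@poly_tconv theta))
    (@sub_elt poly_sub _ (poly_delta 0)).

Definition torus_hol (theta : R) : bornAlg R :=
  @BornAlg R hol_space (@sub_mul hol_sub _ (@hol_tconv theta))
    (@sub_elt hol_sub _ (poly_hol (poly_delta 0))).

Definition torus_ana (theta : R) : bornAlg R :=
  @BornAlg R ana_space (@sub_mul ana_sub _ (@ana_tconv theta))
    (@sub_elt ana_sub _ (poly_ana (poly_delta 0))).

Definition torus_smooth (theta : R) : bornAlg R :=
  @BornAlg R smooth_space (@sub_mul smooth_sub _ (@smooth_tconv theta))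
    (@sub_elt smooth_sub _ (poly_smooth (poly_delta 0))).

Definition poly_to_hol (theta : R) : torus_poly theta -> torus_hol theta :=
  @sub_map poly_sub hol_sub id poly_hol.
Definition poly_to_ana (theta : R) : torus_poly theta -> torus_ana theta :=
  @sub_map poly_sub ana_sub id poly_ana.
Definition poly_to_smooth (theta : R) : torus_poly theta -> torus_smooth theta :=
  @sub_map poly_sub smooth_sub id poly_smooth.

End Torus.

(* Main.v *)
(* Let A be the algebra of Laurent polynomials and B one of its completions.
   All spaces involved are weighted l1-spaces of sequences or unions of such:
   bounded linear maps out of them are prescribed freely on unit vectors,
   subject to a bound, and complete tensor products are obtained by taking
   products of index sets and weights.

   The bimodule A has a Koszul resolution by free bimodules of rank 1, 2, 1.
   After rescaling the basis by the cocycle, its part of total degree t is the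
   cellular chain complex of the plane tiled by unit squares, whatever t is.
   Base change to B replaces A (x) A by B (x) B, that is, it only changes the
   space of coefficients.  Combing the plane, first horizontally and then
   vertically, contracts the complex.  The combing path from 0 to x is geodesic,
   so that the weights at its points z satisfy
   w(z) w(t - z) <= w(z) w(x - z) w(t - x) with l(z) + l(x - z) = l(x), and it
   has l(x) edges.  Hence the contraction is bounded on B as soon as weights
   satisfy (1 + l(x)) w(z) w(x - z) <= C w'(x) for a suitable weight w' of the
   family, which holds for the exponential and for the polynomial weights. *)
From HB Require Import structures.
Require Import Defs.
From mathcomp Require Import all_boot all_order all_algebra.
From mathcomp Require Import complex.
From mathcomp Require Import all_classical all_reals all_analysis.
From mathcomp Require Import zify ring lra.

Set Implicit Arguments.
Unset Strict Implicit.
Unset Printing Implicit Defensive.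

Import Order.TTheory GRing.Theory Num.Theory.
Import numFieldNormedType.Exports.
Import Normc.

Local Open Scope classical_set_scope.
Local Open Scope ring_scope.

(** The holomorphic and smooth algebras are intersections of weighted l1-spaces, whereas maps and
    tensor products are easiest to control on unions of Banach disks. Every space is therefore
    described by a cone [Phi] of inverse weights. For an intersection this needs one weight that
    absorbs countably many bounds at once ([common_weight]). The fine bornology on A fits the same
    pattern with finitely supported functions; this finiteness makes free A-bimodules of finite rank
    projective, because every map prescribed on the basis is then bounded. The contracting homotopy
    is not a bimodule map, so base change does not carry it from A to B. It is constructed instead
    for every twisted algebra, and the complex obtained by base change is recognised as the Koszul
    complex of B itself. The quotient in a balanced tensor product involves a closure that is hard
    to describe. It is identified through a bounded linear section given on basis vectors, which
    differs from the identity by explicit relations. *)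

Section Bornologies.
Variable R : realType.
Local Notation C := R[i].
Implicit Types V W Y : bornSpace R.

Lemma cvg0P (e : nat -> R) : (e @ \oo --> (0 : R)) <->
  forall eps : R, 0 < eps -> exists n0, forall n, (n0 <= n)%N -> `|e n| < eps.
Proof.
split=> [/cvgrPdist_lt h eps e0|h].
  have [n0 _ hn] := h eps e0; exists n0 => n nn.
  by have := hn n nn; rewrite /= sub0r normrN.
apply/cvgrPdist_lt => eps e0; have [n0 hn] := h eps e0.
by exists n0 => // n nn /=; rewrite sub0r normrN; apply: hn.
Qed.

Lemma normcR (r : R) : normc (r%:C)%C = `|r|.
Proof. by rewrite /= expr0n addr0 sqrtr_sqr. Qed.

(** Maps occur below as bare functions, often partial applications of bilinear ones; bundling them
    on demand gives access to the theory of linear maps. *)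
Lemma linear_exists (K : pzRingType) (V W : lmodType K) (f : V -> W) :
  linear f -> exists F : {linear V -> W}, F =1 f.
Proof.
move=> lf.
pose m := GRing.isLinear.Build K V W *:%R f lf.
by exists (HB.pack_for {linear V -> W} f m).
Qed.

Lemma linear_scale (K : pzRingType) (V W : lmodType K) (f : V -> W) :
  linear f -> forall c v, f (c *: v) = c *: f v.
Proof. by move=> /linear_exists[F Ff] c v; rewrite -!Ff linearZ. Qed.

Section Span.
Variables (V : lmodType C) (S : set V).

Lemma lspan0 : lspan S 0.
Proof.
by exists 0%N, (fun=> 0), (fun=> 0); split=> [[]//|]; rewrite big_ord0.
Qed.

Lemma lspan_lin c x y : lspan S x -> lspan S y -> lspan S (c *: x + y).
Proof.
move=> [n [a [v [Sv ->]]]] [m [b [w [Sw ->]]]]; exists (n + m)%N.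
exists (fun i => match fintype.split i with inl j => c * a j | inr j => b j end).
exists (fun i => match fintype.split i with inl j => v j | inr j => w j end).
split=> [i|]; first by case: (fintype.split i).
rewrite big_split_ord /= scaler_sumr; congr (_ + _); apply: eq_bigr => j _.
  by rewrite -[lshift _ _]/(unsplit (inl j)) unsplitK scalerA.
by rewrite -[rshift _ _]/(unsplit (inr j)) unsplitK.
Qed.

Lemma lspan_id x : S x -> lspan S x.
Proof.
by move=> Sx; exists 1%N, (fun=> 1), (fun=> x); rewrite big_ord1 scale1r.
Qed.

Lemma lspanZ c x : lspan S x -> lspan S (c *: x).
Proof. by move=> Sx; rewrite -[_ *: _]addr0; apply: lspan_lin => //; apply: lspan0. Qed.

Lemma lspanD x y : lspan S x -> lspan S y -> lspan S (x + y).
Proof. by move=> Sx Sy; rewrite -[x]scale1r; apply: lspan_lin. Qed.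

Lemma lspanB x y : lspan S x -> lspan S y -> lspan S (x - y).
Proof. by move=> Sx Sy; rewrite -scaleN1r addrC; apply: lspan_lin. Qed.

Lemma lspan_sum (I : Type) (s : seq I) (F : I -> V) :
  (forall i, lspan S (F i)) -> lspan S (\sum_(i <- s) F i).
Proof.
by move=> h; elim/big_ind: _ => //; [apply: lspan0|apply: lspanD].
Qed.

End Span.

Section NormOn.
Variables (V : lmodType C) (T : set V) (N : V -> R).
Hypothesis NN : norm_on (lspan T) N.

Lemma norm_on0 : N 0 = 0.
Proof.
have [_ _ h] := NN; have := h 0 0 (@lspan0 _ T).
by rewrite scale0r normc0 mul0r.
Qed.

Lemma norm_onN x : lspan T x -> N (- x) = N x.
Proof.
have [_ _ h] := NN; move=> Tx; rewrite -scaleN1r h//.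
by rewrite normcN normc1 mul1r.
Qed.

(** Nonnegativity comes from the triangle inequality: 0 = N (x - x) <= 2 N x. *)
Lemma norm_on_ge0 x : lspan T x -> 0 <= N x.
Proof.
move=> Tx; have [_ h _] := NN; have TNx : lspan T (- x) by rewrite -scaleN1r; apply: lspanZ.
have := h x (- x) Tx TNx; rewrite subrr norm_on0 norm_onN//; lra.
Qed.

Lemma norm_on_sum (I : Type) (s : seq I) (F : I -> V) (b : I -> R) :
  (forall i, lspan T (F i)) -> (forall i, N (F i) <= b i) ->
  N (\sum_(i <- s) F i) <= \sum_(i <- s) b i.
Proof.
move=> TF hb; elim: s => [|i s IH]; first by rewrite !big_nil norm_on0.
rewrite !big_cons; have [_ h _] := NN.
apply: le_trans (h _ _ _ _) _ => //; first exact: lspan_sum.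
by apply: lerD.
Qed.

End NormOn.

Section Complete.
Variable V : bornSpace R.
Hypothesis cV : complete_bornology V.

Lemma born1 (x : V) : bornology [set x].
Proof. by have [[h _ _] _ _] := cV. Qed.

Lemma born_sub (S T : set V) : bornology T -> S `<=` T -> bornology S.
Proof. by have [[_ h _] _ _] := cV; apply: h. Qed.

Lemma bornU (S T : set V) : bornology S -> bornology T -> bornology (S `|` T).
Proof. by have [[_ _ h] _ _] := cV; apply: h. Qed.

Lemma bornD (S T : set V) : bornology S -> bornology T ->
  bornology [set x + y | x in S & y in T].
Proof. by have [_ [h _] _] := cV; apply: h. Qed.

Lemma bornZ (r : R) (S : set V) : bornology S ->
  bornology [set c *: x | c in [set c : C | normc c <= r] & x in S].
Proof. by have [_ [_ h] _] := cV; apply: h. Qed.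

Lemma born_disk (S : set V) : bornology S -> exists (T : set V) (N : V -> R),
  [/\ S `<=` T, bornology T, absolutely_convex T &
   [/\ norm_on (lspan T) N, complete_on (lspan T) N &
    T = [set x | lspan T x /\ N x <= 1]]].
Proof.
have [_ _ h] := cV; move=> /h[T [ST bT [aT [N hN]]]].
by exists T, N.
Qed.

(** A complete disk containing both witnessing sets carries a genuine norm, in which x - y has norm
    at most |e n| + |e' n| for every n. *)
Lemma born_cvg_unique (u : nat -> V) x y : born_cvg u x -> born_cvg u y -> x = y.
Proof.
move=> [T [e [bT e0 ue]]] [T' [e' [bT' e'0 ue']]].
have [D [N [TD bD _ [hN _ DE]]]] := born_disk (bornU bT bT').
have Dt t : (T `|` T') t -> lspan D t /\ N t <= 1 by move/TD; rewrite {1}DE.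
have sxy : lspan D (x - y).
  have [t Tt et] := ue 0%N; have [t' Tt' et'] := ue' 0%N.
  have -> : x - y = (e' 0%N)%:C%C *: t' - (e 0%N)%:C%C *: t.
    by rewrite -et -et' opprB [RHS]addrC addrA subrK.
  by apply: lspanB; apply: lspanZ; [have [] := Dt t' (or_intror Tt')|have [] := Dt t (or_introl Tt)].
have [hN0 hND hNZ] := hN.
suff : N (x - y) = 0 by move/hN0 => /(_ sxy)/eqP; rewrite subr_eq0 => /eqP.
apply/eqP; rewrite eq_le (norm_on_ge0 hN)// andbT.
apply/ler_addgt0Pl => eps eps0; rewrite addr0.
have eps2 : 0 < eps / 2 by rewrite divr_gt0.
have [n1 h1] := (cvg0P e).1 e0 _ eps2; have [n2 h2] := (cvg0P e').1 e'0 _ eps2.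
pose n := maxn n1 n2.
have {}h1 := h1 n (leq_maxl _ _); have {}h2 := h2 n (leq_maxr _ _).
have [t Tt et] := ue n; have [t' Tt' et'] := ue' n.
have [st nt] := Dt t (or_introl Tt); have [st' nt'] := Dt t' (or_intror Tt').
have -> : x - y = (e' n)%:C%C *: t' + (- (e n)%:C%C) *: t.
  by rewrite scaleNr -et -et' opprB [RHS]addrC addrA subrK.
apply: (le_trans (hND _ _ _ _)); try exact: lspanZ.
rewrite !hNZ// normcN !normcR.
have := norm_on_ge0 hN st; have := norm_on_ge0 hN st'.
have := normr_ge0 (e n); have := normr_ge0 (e' n).
nra.
Qed.

Lemma born_cvg_lin (c : C) (u v : nat -> V) x y : born_cvg u x -> born_cvg v y ->
  born_cvg (fun n => c *: u n + v n) (c *: x + y).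
Proof.
move=> [T [e [bT e0 ue]]] [T' [e' [bT' e'0 ue']]].
have bcT := bornZ (normc c) bT.
have [D [N [TD bD aD _]]] := born_disk (bornU bcT bT').
exists D, (fun n => `|e n| + `|e' n|); split=> //.
  apply/cvg0P => eps eps0; have eps2 : 0 < eps / 2 by rewrite divr_gt0.
  have [n1 h1] := (cvg0P e).1 e0 _ eps2; have [n2 h2] := (cvg0P e').1 e'0 _ eps2.
  exists (maxn n1 n2) => n; rewrite geq_max => /andP[nn1 nn2].
  rewrite ger0_norm ?addr_ge0//; have := h1 n nn1; have := h2 n nn2; lra.
move=> n; have [t Tt et] := ue n; have [t' Tt' et'] := ue' n.
pose s : R := `|e n| + `|e' n|; rewrite -/s.
have Dct : D (c *: t) by apply: TD; left; exists c => //=; exists t.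
have Dt' : D t' by apply: TD; right.
have eq0 : c *: u n + v n - (c *: x + y) = (e n)%:C%C *: (c *: t) + (e' n)%:C%C *: t'.
  rewrite opprD addrACA -scalerBr et et'.
  by rewrite !scalerA [c * _]mulrC.
(* Division by the scale [s] is impossible when it vanishes; then both errors vanish as well and any
   element of the disk will do. *)
have [s0|s0] := eqVneq s 0.
  have /andP[/eqP en0 /eqP en'0] : (e n == 0) && (e' n == 0).
    by rewrite -(normr_eq0 (e n)) -(normr_eq0 (e' n)) -paddr_eq0// -/s s0.
  by exists t' => //; rewrite eq0 en0 en'0 s0 !scale0r add0r.
have sp : 0 < s by rewrite lt_neqAle eq_sym s0 /s addr_ge0.
exists ((e n / s)%:C%C *: (c *: t) + (e' n / s)%:C%C *: t').
  apply: aD => //; rewrite !normcR !normrM -mulrDl normfV (gtr0_norm sp).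
  by rewrite divff.
by rewrite eq0 scalerDr !scalerA -!rmorphM /= [s * _]mulrC divfK// [s * _]mulrC divfK.
Qed.

End Complete.

Lemma born_cvg_map V W (f : V -> W) (u : nat -> V) x : linear f -> bounded_map f ->
  born_cvg u x -> born_cvg (fun n => f (u n)) (f x).
Proof.
move=> /linear_exists[F Ff] bf [T [e [bT e0 ue]]]; exists (f @` T), e; split=> //.
  exact: bf.
move=> n; have [t Tt et] := ue n; exists (f t); first by exists t.
by rewrite -!Ff -linearB et linearZ.
Qed.

Definition blin V W (f : V -> W) := linear f /\ bounded_map f.

Lemma blin_id V : blin (@id V).
Proof. by split=> // S bS; rewrite image_id. Qed.

Lemma blin_lin V W (f : {linear V -> W}) : bounded_map f -> blin f.
Proof. by split=> //; exact: linearP. Qed.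

Lemma blin_comp V W Y (f : W -> Y) (g : V -> W) : blin f -> blin g ->
  blin (fun v => f (g v)).
Proof.
move=> [lf bf] [lg bg]; split=> [c x y|S bS]; first by rewrite lg lf.
by have := bf _ (bg S bS); rewrite image_comp.
Qed.

Lemma blin_l V V' W Y (b : V -> W -> Y) (g : V' -> V) w :
  complete_bornology W -> complete_bornology Y -> bounded_bilinear b -> blin g ->
  blin (fun v => b (g v) w).
Proof.
move=> cW cY [_ lb bb] [lg bg]; split=> [c x y|S bS]; first by rewrite lg lb.
apply: (born_sub cY (bb _ _ (bg S bS) (born1 cW w))) => _ [v Sv <-].
by exists (g v); [exists v|exists w].
Qed.

Lemma blin_r V W' W Y (b : V -> W -> Y) (g : W' -> W) v :
  complete_bornology V -> complete_bornology Y -> bounded_bilinear b -> blin g ->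
  blin (fun w => b v (g w)).
Proof.
move=> cW cY [lb _ bb] [lg bg]; split=> [c x y|S bS]; first by rewrite lg lb.
apply: (born_sub cY (bb _ _ (born1 cW v) (bg S bS))) => _ [w Sw <-].
by exists v => //; exists (g w) => //; exists w.
Qed.

Lemma bilinear_blin V W Y (b : V -> W -> Y) v :
  complete_bornology V -> complete_bornology Y -> bounded_bilinear b -> blin (b v).
Proof. by move=> cV cY bb; apply: (blin_r v cV cY bb (blin_id W)). Qed.

Lemma blinD V W (f g : V -> W) : complete_bornology W -> blin f -> blin g ->
  blin (fun v => f v + g v).
Proof.
move=> cW [lf bf] [lg bg]; split=> [c x y|S bS].
  by rewrite lf lg scalerDr addrACA.
apply: (born_sub cW (bornD cW (bf S bS) (bg S bS))) => _ [v Sv <-].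
by exists (f v); [exists v|exists (g v) => //; exists v].
Qed.

Lemma blinB V W (f g : V -> W) : complete_bornology W -> blin f -> blin g ->
  blin (fun v => f v - g v).
Proof.
move=> cW lf [lg bg]; apply: blinD => //; split=> [c x y|S bS].
  by rewrite lg opprD scalerN.
apply: (born_sub cW (bornZ cW 1 (bg S bS))) => _ [v Sv <-].
have n1 : normc (-1 : C) <= 1 by rewrite normcN normc1.
exists (-1) => //; by exists (g v); [exists v|rewrite scaleN1r].
Qed.

Lemma blin0 V W : complete_bornology W -> blin (fun _ : V => 0 : W).
Proof.
move=> cW; split=> [c x y|S bS]; first by rewrite scaler0 addr0.
by apply: (born_sub cW (born1 cW 0)) => _ [v Sv <-].
Qed.

End Bornologies.

(** * Unconditional sums over a countable index set *)

Section UnconditionalSums.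
Variables (R : realType) (X : countType).
Implicit Types (h : X -> R) (s : seq X).

(** Duplicate-free sequences play the role of finite subsets of [X]. *)
Definition sums_le h (M : R) := forall s, uniq s -> \sum_(x <- s) h x <= M.

Definition usup h := sup [set \sum_(x <- s) h x | s in [set s : seq X | uniq s]].

(** An exhaustion of [X] by finite sets, through the codes below [n]; it turns unconditional sums
    into limits of sequences, as bornological convergence requires. *)
Definition initial n : seq X := pmap (@pickle_inv X) (iota 0 n).

Lemma en_uniq n : uniq (initial n).
Proof. exact: pmap_uniq (@pickle_invK X) _ (iota_uniq 0 n). Qed.

Lemma mem_en n x : (x \in initial n) = (pickle x < n)%N.
Proof.
rewrite mem_pmap; apply/mapP/idP => [[k]|xn].
  rewrite mem_iota add0n => /andP[_ kn] e.
  by have := @pickle_invK X k; rewrite -e /= => ->.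
by exists (pickle x); rewrite ?mem_iota ?pickleK_inv.
Qed.

Lemma en_cat n m : exists s, [/\ initial (n + m) = initial n ++ s, uniq s & all (fun x => x \notin initial n) s].
Proof.
exists (pmap (@pickle_inv X) (iota n m)).
rewrite /initial iotaD pmap_cat add0n; split=> //.
  exact: pmap_uniq (@pickle_invK X) _ (iota_uniq n m).
have := en_uniq (n + m); rewrite /initial iotaD pmap_cat cat_uniq add0n => /and3P[_ h _].
by rewrite all_predC.
Qed.

Lemma en_sub s : exists n0, forall n, (n0 <= n)%N -> {subset s <= initial n}.
Proof.
exists (\max_(x <- s) (pickle x).+1) => n hn x xs; rewrite mem_en.
by apply: leq_trans hn; exact: (@leq_bigmax_seq _ s xpredT (fun x => (pickle x).+1) x).
Qed.

Section Nonneg.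
Variable h : X -> R.
Hypothesis h0 : forall x, 0 <= h x.

Lemma sum_subset s s' : uniq s -> uniq s' -> {subset s <= s'} ->
  \sum_(x <- s) h x <= \sum_(x <- s') h x.
Proof.
move=> us us' ss; rewrite [leRHS](bigID (mem s)) /=.
rewrite -[X in _ <= X + _]big_filter.
rewrite (perm_big s (r1 := [seq i <- s' | i \in s])) /=; last first.
  apply: uniq_perm => //; first exact: filter_uniq.
  by move=> x; rewrite mem_filter; case: (boolP (x \in s)) => // /ss ->.
by rewrite lerDl sumr_ge0.
Qed.

Variable M : R.
Hypothesis hM : sums_le h M.

Let hub : has_sup [set \sum_(x <- s) h x | s in [set s : seq X | uniq s]].
Proof.
split; first by exists (\sum_(x <- [::]) h x); exists [::].
by exists M => _ [s us <-]; apply: hM.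
Qed.

Lemma usup_ub : sums_le h (usup h).
Proof. by move=> s us; apply: ub_le_sup; [case: hub|exists s]. Qed.

Lemma usup_le : usup h <= M.
Proof.
by apply: ge_sup; [case: hub|move=> _ [s us <-]; apply: hM].
Qed.

Lemma usup_ge0 : 0 <= usup h.
Proof. by have := usup_ub (s := [::]) isT; rewrite big_nil. Qed.

Lemma usup_tail n s : uniq s -> all (fun x => x \notin initial n) s ->
  \sum_(x <- s) h x <= usup h - \sum_(x <- initial n) h x.
Proof.
move=> us /allP sn; rewrite lerBrDl -big_cat; apply: usup_ub.
rewrite cat_uniq en_uniq us andbT /=; apply/hasPn => x /sn; apply.
Qed.

Lemma usup_en (eps : R) : 0 < eps -> exists n0, forall n, (n0 <= n)%N ->
  usup h - \sum_(x <- initial n) h x < eps.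
Proof.
move=> e0; have [_ [s us <-]] := sup_adherent e0 hub; rewrite -/(usup h) => hs.
have [n0 hn] := en_sub s; exists n0 => n /hn sn.
have := sum_subset us (en_uniq n) sn; lra.
Qed.

Lemma usup_en_cvg : (fun n => usup h - \sum_(x <- initial n) h x) @ \oo --> (0 : R).
Proof.
apply/cvg0P => eps /usup_en[n0 hn]; exists n0 => n /hn.
by rewrite ger0_norm// subr_ge0; apply: usup_ub; apply: en_uniq.
Qed.

End Nonneg.

End UnconditionalSums.
Arguments initial X n : clear implicits.

(** * Unit balls of weighted l1-spaces, and the spaces they generate *)

Section Disks.
Variables (R : realType) (X : countType).
Local Notation C := R[i].
Implicit Types (phi psi : X -> R) (a b : X -> C).

(* [nle phi M a] says that [a] has norm at most [M] in the weighted l1-space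
   with weight [1 / phi], which is infinite where [phi] vanishes: [x / 0 = 0]
   makes the support condition necessary. *)
Definition nle phi (M : R) a := (forall x, phi x = 0 -> a x = 0) /\
  sums_le (fun x => normc (a x) / phi x) M.

Lemma nle_le phi M M' a : M <= M' -> nle phi M a -> nle phi M' a.
Proof. by move=> MM [h h']; split=> // s us; apply: le_trans (h' s us) MM. Qed.

Lemma nle_lin phi M M' (c : C) a b d : (forall x, 0 <= phi x) ->
  nle phi M a -> nle phi M' b -> (forall x, d x = c * a x + b x) ->
  nle phi (normc c * M + M') d.
Proof.
move=> p0 [a0 ha] [b0 hb] dE; split=> [x px|s us].
  by rewrite dE a0// b0// mulr0 addr0.
apply: (@le_trans _ _ (\sum_(x <- s) (normc c * (normc (a x) / phi x) + normc (b x) / phi x))).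
  apply: ler_sum => x _; rewrite mulrA -mulrDl ler_wpM2r ?invr_ge0//.
  by rewrite dE -normcM le_normcD.
rewrite big_split -mulr_sumr /=; apply: lerD; last exact: hb.
by rewrite ler_wpM2l ?normc_ge0 ?ha.
Qed.

Lemma nle0 phi M : 0 <= M -> nle phi M (fun=> 0).
Proof. by move=> M0; split=> // s _; rewrite big1// => x _; rewrite normc0 mul0r. Qed.

Lemma nleD phi M M' a b d : (forall x, 0 <= phi x) ->
  nle phi M a -> nle phi M' b -> (forall x, d x = a x + b x) ->
  nle phi (M + M') d.
Proof.
move=> p0 ha hb dE; rewrite -[M]mul1r -(normc1 R); apply: nle_lin p0 ha hb _.
by move=> x; rewrite mul1r dE.
Qed.

Lemma nleZ phi M (c : C) a d : (forall x, 0 <= phi x) ->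
  nle phi M a -> (forall x, d x = c * a x) -> nle phi (normc c * M) d.
Proof.
move=> p0 ha dE; rewrite -[_ * _]addr0; apply: (nle_lin p0 ha (nle0 phi (lexx 0))).
by move=> x; rewrite addr0 dE.
Qed.

Lemma nle_mono phi psi M a : (forall x, 0 <= phi x <= psi x) ->
  nle phi M a -> nle psi M a.
Proof.
move=> pp [a0 ha]; split=> [x px|s us].
  by apply: a0; have := pp x; rewrite px; lra.
apply: le_trans (ler_sum _ _) (ha s us) => x _.
have [/a0 ->|px] := eqVneq (phi x) 0; first by rewrite normc0 !mul0r.
have /andP[p0 p1] := pp x; have {}p0 : 0 < phi x by rewrite lt_neqAle eq_sym px.
by rewrite ler_wpM2l ?normc_ge0// lef_pV2 ?posrE// (lt_le_trans p0).
Qed.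

(** Constants move between the norm and the weight. Cones being stable under scaling, every bound
    can thus be normalised to 1. *)
Lemma nle_rescale phi (r : R) M a : 0 < r ->
  nle phi (r * M) a <-> nle (fun x => r * phi x) M a.
Proof.
move=> r0; have rN0 : r != 0 by rewrite gt_eqF.
have e x : normc (a x) / (r * phi x) = r^-1 * (normc (a x) / phi x).
  by rewrite invfM mulrCA mulrA.
split=> -[a0 ha]; split=> [x|s us].
- by move/eqP; rewrite mulf_eq0 (negPf rN0) => /eqP/a0.
- by under eq_bigr do rewrite e; rewrite -mulr_sumr ler_pdivrMl// ha.
- by move=> px; apply: a0; rewrite px mulr0.
- by have := ha s us; under eq_bigr do rewrite e; rewrite -mulr_sumr ler_pdivrMl.
Qed.

Lemma nle1 phi M (c : C) y : (forall x, 0 <= phi x) -> 0 <= M ->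
  normc c <= M * phi y -> nle phi M (fun x => c * (x == y)%:R).
Proof.
move=> p0 M0 cM; split=> [x px|s us].
  case: eqVneq => [xy|_]; last by rewrite mulr0.
  move: cM; rewrite -xy px mulr0 => cM.
  have /eq0_normc -> : normc c = 0; last by rewrite mul0r.
  by apply/eqP; rewrite eq_le cM normc_ge0.
have t0 x : x != y -> normc (c * (x == y)%:R) / phi x = 0.
  by move=> /negPf ->; rewrite mulr0 normc0 mul0r.
have [ys|ys] := boolP (y \in s); last first.
  rewrite big_seq big1// => x xs; apply: t0; apply: contraNneq ys => <- //.
rewrite (bigD1_seq y)//= big1 ?addr0 => [|x /t0//].
rewrite eqxx mulr1; have [py|py] := eqVneq (phi y) 0.
  by rewrite py invr0 mulr0.
by rewrite ler_pdivrMr// lt_neqAle eq_sym py p0.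
Qed.

Lemma nle_coord phi M a x : (forall x, 0 <= phi x) -> nle phi M a ->
  normc (a x) <= M * phi x.
Proof.
move=> p0 [a0 ha]; have [px|px] := eqVneq (phi x) 0.
  by rewrite a0// normc0 px mulr0.
have := ha [:: x] isT; rewrite big_seq1 ler_pdivrMr//.
by rewrite lt_neqAle eq_sym px p0.
Qed.

(** The closure properties mirror the axioms of a bornology: [coneD] serves unions and sums of
    bounded sets, [coneZ] bounded sets of scalars, and [cone_delta] puts the unit vectors into the
    space. *)
Record cone (Phi : set (X -> R)) : Prop := Cone {
  cone0 : Phi (fun=> 0);
  cone_ge0 : forall phi, Phi phi -> forall x, 0 <= phi x;
  coneD : forall phi psi, Phi phi -> Phi psi -> Phi (fun x => phi x + psi x);
  coneZ : forall (r : R) phi, 0 <= r -> Phi phi -> Phi (fun x => r * phi x);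
  cone_solid : forall phi psi, Phi phi -> (forall x, 0 <= psi x <= phi x) -> Phi psi;
  cone_delta : forall x, Phi (fun y => (y == x)%:R) }.

(* [V], with coordinates [co], is the union over [phi] in [Phi] of the spaces
   l1(1 / phi), bounded sets being those contained and bounded in one of them.
   Weights are written as [1 / phi] so that the fine bornology, where they are
   infinite off a finite set, is covered. *)
Record seqspace (Phi : set (X -> R)) (V : bornSpace R) (co : V -> X -> C) : Prop :=
  Seqspace {
  ss_cone : cone Phi;
  co_linear : forall c u v x, co (c *: u + v) x = c * co u x + co v x;
  co_inj : injective co;
  co_disk : forall u, exists2 phi, Phi phi & nle phi 1 (co u);
  co_surj : forall phi a, Phi phi -> nle phi 1 a -> exists u, co u = a;
  co_born : forall S, bornology S <->
    exists2 phi, Phi phi & forall u, S u -> nle phi 1 (co u) }.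

(** Chosen by its coordinates, so that it depends on [co] alone; in a [seqspace] the default 0 is
    never taken, by [co_be]. *)
Definition unit_vec (V : bornSpace R) (co : V -> X -> C) (x : X) : V :=
  xget 0 [set u | co u = fun y => (y == x)%:R].

End Disks.

(** Real and imaginary parts are bounded by [normc], and [normc] by their sum, so completeness is
    inherited from [R]. *)
Lemma C_complete (R : realType) (z : nat -> R[i]) :
  (forall e : R, 0 < e -> exists n0, forall m n, (n0 <= m)%N -> (n0 <= n)%N ->
     normc (z m - z n) < e) ->
  exists l, forall e : R, 0 < e -> exists n0, forall n, (n0 <= n)%N -> normc (z n - l) < e.
Proof.
move=> hz.
have re (p : R[i] -> R) : (forall x y, p (x - y) = p x - p y) ->
    (forall x, `|p x| <= normc x) ->
    exists l, forall e : R, 0 < e -> exists n0, forall n, (n0 <= n)%N -> `|p (z n) - l| < e.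
  move=> pB pn; have : cvgn (fun n => p (z n)).
    apply/cauchy_cvgP/cauchy_exP => e /= e0; have [n0 hn] := hz e e0.
    exists (p (z n0)); exists n0 => // n /= nn; rewrite /ball /= -pB.
    by apply: le_lt_trans (pn _) (hn _ _ _ _).
  move=> /cvg_ex[l /cvgrPdist_lt hl]; exists l => e e0.
  have [n0 _ hn] := hl e e0; exists n0 => n nn.
  by have := hn n nn; rewrite /= distrC.
have [r hr] := re (@complex.Re R) (fun x y => raddfB _ x y) (@normc_Re R).
have [i hi] := re (@complex.Im R) (fun x y => raddfB _ x y) (@normc_Im R).
exists (Complex r i) => e e0; have e2 : 0 < e / 2 by rewrite divr_gt0.
have [n1 h1] := hr _ e2; have [n2 h2] := hi _ e2.
exists (maxn n1 n2) => n; rewrite geq_max => /andP[nn1 nn2].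
have := h1 n nn1; have := h2 n nn2.
have -> : z n - Complex r i = Complex (complex.Re (z n) - r) (complex.Im (z n) - i).
  by case: (z n).
have := normc_le (complex.Re (z n) - r) (complex.Im (z n) - i); lra.
Qed.

(** * Sequence spaces *)

Section SequenceSpaces.
Variables (R : realType) (X : countType) (Phi : set (X -> R)).
Local Notation C := R[i].
Variables (V : bornSpace R) (co : V -> X -> C).
Hypothesis HV : seqspace Phi co.

Let cP := ss_cone HV.

Lemma coD u v x : co (u + v) x = co u x + co v x.
Proof. by have := co_linear HV 1 u v x; rewrite scale1r mul1r. Qed.

Lemma co0 x : co 0 x = 0.
Proof. by apply: (addIr (co 0 x)); rewrite -coD !add0r. Qed.

Lemma coZ c u x : co (c *: u) x = c * co u x.
Proof. by rewrite -[c *: u]addr0 (co_linear HV) co0 addr0. Qed.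

Lemma coB u v x : co (u - v) x = co u x - co v x.
Proof. by rewrite -scaleN1r addrC (co_linear HV) mulN1r addrC. Qed.

Lemma co_sum (I : Type) (s : seq I) (F : I -> V) x :
  co (\sum_(i <- s) F i) x = \sum_(i <- s) co (F i) x.
Proof.
elim: s => [|i s IH]; first by rewrite !big_nil co0.
by rewrite !big_cons coD IH.
Qed.

Lemma co_be x : co (unit_vec co x) = fun y => (y == x)%:R.
Proof.
suff h : exists u, [set u | co u = fun y => (y == x)%:R] u by exact: (xgetPex 0 h).
apply: (co_surj HV (cone_delta cP x)).
have -> : (fun y => (y == x)%:R : C) = fun y => 1 * (y == x)%:R.
  by apply/funext => y; rewrite mul1r.
by apply: nle1 => //; rewrite normc1 eqxx mulr1.
Qed.

Lemma co_sum_be (s : seq X) (a : X -> C) x : uniq s ->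
  co (\sum_(y <- s) a y *: unit_vec co y) x = if x \in s then a x else 0.
Proof.
move=> us; rewrite co_sum; under eq_bigr do rewrite coZ co_be.
case: ifPn => xs.
  rewrite (bigD1_seq x)//= eqxx mulr1 big1 ?addr0// => y.
  by rewrite eq_sym => /negPf ->; rewrite mulr0.
rewrite big_seq big1// => y ys; case: eqVneq => [e|_]; last by rewrite mulr0.
by rewrite e ys in xs.
Qed.

Lemma nle_be phi M (c : C) y : Phi phi -> 0 <= M -> normc c <= M * phi y ->
  nle phi M (co (c *: unit_vec co y)).
Proof.
move=> Pphi M0 cM; rewrite (_ : co _ = fun x => c * (x == y)%:R).
  exact: nle1 (cone_ge0 cP Pphi) M0 cM.
by apply/funext => x; rewrite coZ co_be.
Qed.

Lemma co_surjM phi M a : Phi phi -> nle phi M a -> exists u, co u = a.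
Proof.
move=> Pphi ha; have p0 := cone_ge0 cP Pphi.
(* [M] may be zero or negative, while rescaling needs a positive factor. *)
have M1 : 0 < `|M| + 1 by rewrite ltr_wpDl.
apply: (co_surj HV (phi := fun x => (`|M| + 1) * phi x)).
  by apply: (coneZ cP) => //; apply: ltW.
apply/nle_rescale => //; apply: nle_le ha; have := ler_norm M; lra.
Qed.

Section OneDisk.
Variable phi : X -> R.
Hypothesis Pphi : Phi phi.
Let p0 := cone_ge0 cP Pphi.

Let D := [set u | nle phi 1 (co u)].
Let E := [set u | exists M, nle phi M (co u)].
Let nrm u x := normc (co u x) / phi x.
Let N u := usup (nrm u).

Let nrm0 u x : 0 <= nrm u x.
Proof. by rewrite divr_ge0 ?normc_ge0. Qed.

Let E_lin c u v : E u -> E v -> E (c *: u + v).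
Proof.
move=> [M hu] [M' hv]; exists (normc c * M + M'); apply: nle_lin hu hv _ => //.
exact: co_linear HV _ _ _.
Qed.

Let spanE : lspan D = E.
Proof.
apply/seteqP; split=> [u [n [c [v [Dv ->]]]]|u [M hu]].
  have E0 : E 0 by exists 0; rewrite (_ : co 0 = fun=> 0); [exact: nle0|apply/funext/co0].
  apply: (big_ind E) => //.
  - by move=> x y Ex Ey; rewrite -[x]scale1r; apply: E_lin.
  - by move=> i _; rewrite -[_ *: _]addr0; apply: E_lin => //; exists 1; apply: Dv.
pose r := `|M| + 1; have r0 : 0 < r by rewrite ltr_wpDl.
have -> : u = (r%:C)%C *: ((r^-1)%:C%C *: u).
  by rewrite scalerA -rmorphM /= divff ?gt_eqF// scale1r.
apply: lspanZ; apply: lspan_id; rewrite /D /=.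
have h := nleZ (d := co ((r^-1)%:C%C *: u)) p0 hu (coZ _ u).
apply: nle_le h; rewrite normcR gtr0_norm ?invr_gt0// ler_pdivrMl// mulr1.
rewrite /r; have := ler_norm M; lra.
Qed.

Let E_nle u : E u -> nle phi (N u) (co u).
Proof. by move=> [M [u0 hu]]; split=> //; apply: usup_ub hu. Qed.

Let N_le u M : nle phi M (co u) -> N u <= M.
Proof. by move=> [_]; apply: usup_le. Qed.

Let N_ge0 u : E u -> 0 <= N u.
Proof. by move=> [M [_ hu]]; apply: usup_ge0 hu. Qed.

Let NZle c u : E u -> N (c *: u) <= normc c * N u.
Proof. by move=> Eu; apply: N_le; apply: nleZ (E_nle Eu) _ => // x; rewrite coZ. Qed.

Let N_norm : norm_on (lspan D) N.
Proof.
rewrite spanE; split=> [u Eu Nu|u v Eu Ev|c u Eu].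
- apply: (co_inj HV); apply/funext => x; rewrite co0; apply: eq0_normc.
  apply/eqP; rewrite eq_le normc_ge0 andbT.
  by have := nle_coord x p0 (E_nle Eu); rewrite Nu mul0r.
- by apply: N_le; apply: nleD (E_nle Eu) (E_nle Ev) _ => // x; rewrite coD.
- apply/eqP; rewrite eq_le NZle//=; have [->|c0] := eqVneq c 0.
    rewrite normc0 mul0r scale0r N_ge0//.
    by rewrite -spanE; apply: lspan0.
  have nc : 0 < normc c.
    by rewrite lt_neqAle normc_ge0 andbT eq_sym; apply: contra_neq c0 => /eq0_normc.
  have Ecu : E (c *: u) by rewrite -spanE; apply: lspanZ; rewrite spanE.
  have := NZle (c^-1) Ecu; rewrite scalerA mulVf// scale1r normcV.
  by rewrite ler_pdivlMl.
Qed.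

(** The usual argument for l1: limits are taken in each coordinate, convergence is controlled on
    finite sets of coordinates, and the estimate is then made uniform in these sets. *)
Let N_complete : complete_on (lspan D) N.
Proof.
rewrite spanE => u Eu hu.
have EB m n : E (u m - u n) by rewrite -spanE; apply: lspanB; rewrite spanE.
have nB m n := E_nle (EB m n).
have /choice[l hl] : forall x, exists lx : C, forall e : R, 0 < e ->
    exists n0, forall n, (n0 <= n)%N -> normc (co (u n) x - lx) < e.
  move=> x; apply: C_complete => e e0.
  have q0 : 0 < phi x + 1 by rewrite ltr_wpDl.
  have [n0 hn] := hu (e / (phi x + 1)) (divr_gt0 e0 q0).
  exists n0 => m n mm nn; rewrite -coB; apply: le_lt_trans (nle_coord x p0 (nB m n)) _.
  have := hn m n mm nn; rewrite ltr_pdivlMr// => /(le_lt_trans _); apply.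
  by rewrite ler_wpM2l ?N_ge0// lerDl.
have small (s : seq X) (e : R) : 0 < e -> exists n0, forall n, (n0 <= n)%N ->
    \sum_(x <- s) normc (co (u n) x - l x) / phi x <= e.
  elim: s e => [|x s IH] e e0; first by exists 0%N => n _; rewrite big_nil ltW.
  have e2 : 0 < e / 2 by rewrite divr_gt0.
  have [n1 h1] := IH _ e2.
  have q0 : 0 < phi x + 1 by rewrite ltr_wpDl.
  have [n2 h2] : exists n0, forall n, (n0 <= n)%N -> normc (co (u n) x - l x) / phi x <= e / 2.
    have [px|px] := eqVneq (phi x) 0.
      by exists 0%N => n _; rewrite px invr0 mulr0 ltW.
    have {}px : 0 < phi x by rewrite lt_neqAle eq_sym px p0.
    have [n2 h2] := hl x (e / 2 * phi x) (mulr_gt0 e2 px).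
    by exists n2 => n /h2 /ltW; rewrite ler_pdivrMr.
  exists (maxn n1 n2) => n; rewrite geq_max => /andP[nn1 nn2].
  by rewrite big_cons; have := h1 n nn1; have := h2 n nn2; lra.
have supp x : phi x = 0 -> l x = 0.
  move=> px; apply: eq0_normc; apply/eqP; rewrite eq_le normc_ge0 andbT.
  apply/ler_addgt0Pl => e e0; rewrite addr0; have [n0 /(_ n0 (leqnn _))] := hl x e e0.
  have [M [h0 _]] := Eu n0; rewrite h0// sub0r normcN; exact: ltW.
(* The threshold does not depend on the finite set [s], since the auxiliary index [m] is chosen
   after [s]. *)
have unif (e : R) : 0 < e -> exists n0, forall n, (n0 <= n)%N ->
    nle phi e (fun x => co (u n) x - l x).
  move=> e0; have e2 : 0 < e / 2 by rewrite divr_gt0.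
  have [n0 hn] := hu _ e2; exists n0 => n nn; split=> [x px|s us].
    by have [M [h0 _]] := Eu n; rewrite h0// supp// subrr.
  have [n1 hn1] := small s _ e2; pose m := maxn n0 n1.
  have [_ hm] := nB n m.
  apply: (@le_trans _ _ (\sum_(x <- s) (normc (co (u n - u m) x) / phi x + normc (co (u m) x - l x) / phi x))).
    apply: ler_sum => x _; rewrite -mulrDl ler_wpM2r ?invr_ge0// coB.
    by apply: le_trans (le_normcD _ _); rewrite addrA subrK.
  rewrite big_split /=; have := hm s us; have := hn1 m (leq_maxr _ _).
  have := hn n m nn (leq_maxl _ _); lra.
have [n1 h1] := unif 1 ltr01; have [M hM] := Eu n1.
have [v vE] : exists v, co v = l.
  apply: (co_surjM (M := M + normc (-1 : C) * 1) Pphi).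
  apply: (nleD (a := co (u n1)) (b := fun x => - (co (u n1) x - l x)) p0 hM _ _).
    by apply: (nleZ p0 (h1 n1 (leqnn _))) => x; rewrite mulN1r.
  by move=> x; rewrite opprB addrC subrK.
have nuv e n : nle phi e (fun x => co (u n) x - l x) -> nle phi e (co (u n - v)).
  by rewrite -vE; congr nle; apply/funext => x; rewrite coB.
exists v.
  rewrite -spanE (_ : v = u n1 - (u n1 - v)); last by rewrite opprB addrC subrK.
  by apply: lspanB; rewrite spanE//; exists 1; apply: nuv; apply: h1.
apply/cvg0P => e e0; have e2 : 0 < e / 2 by rewrite divr_gt0.
have [n0 hn] := unif _ e2; exists n0 => n /hn/nuv h; rewrite ger0_norm.
  by have := N_le h; lra.
by apply: N_ge0; exists (e / 2).
Qed.

Lemma disk_complete : complete_disk D.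
Proof.
split.
  move=> a b x y Dx Dy ab; apply: (@nle_le _ _ _ (normc a * 1 + normc b * 1)).
    by rewrite !mulr1.
  apply: (nle_lin (c := a) (a := co x) (b := co (b *: y)) p0 Dx).
    by apply: (nleZ p0 Dy) => z; rewrite coZ.
  exact: co_linear HV _ _ _.
exists N; split=> //; apply/seteqP; split=> [u Du|u [Eu Nu]] /=.
  by split; [apply: lspan_id|apply: N_le].
by apply: (nle_le Nu); apply: E_nle; rewrite -spanE.
Qed.

End OneDisk.

Lemma seqspace_complete : complete_bornology V.
Proof.
split; [split|split|].
- move=> u; apply/(co_born HV); have [phi Pphi hu] := co_disk HV u.
  by exists phi => // _ ->.
- move=> S T /(co_born HV)[phi Pphi hT] ST; apply/(co_born HV).
  by exists phi => // u /ST/hT.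
- move=> S T /(co_born HV)[phi Pphi hS] /(co_born HV)[psi Ppsi hT]; apply/(co_born HV).
  have p0 := cone_ge0 cP Pphi; have q0 := cone_ge0 cP Ppsi.
  exists (fun x => phi x + psi x); first exact: (coneD cP).
  by move=> u [/hS|/hT]; apply: nle_mono => x; rewrite ?p0 ?q0 ?lerDl ?lerDr ?p0 ?q0.
- move=> S T /(co_born HV)[phi Pphi hS] /(co_born HV)[psi Ppsi hT]; apply/(co_born HV).
  have p0 := cone_ge0 cP Pphi; have q0 := cone_ge0 cP Ppsi.
  have Ppq := coneD cP Pphi Ppsi.
  exists (fun x => 2 * (phi x + psi x)); first exact: (coneZ cP).
  move=> _ [u Su [v Tv <-]]; apply/nle_rescale => //; rewrite mulr1 -[2]/(1 + 1).
  apply: (nleD (a := co u) (b := co v)) => [x|||x].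
  + by rewrite addr_ge0.
  + by apply: nle_mono (hS u Su) => x; rewrite p0 lerDl q0.
  + by apply: nle_mono (hT v Tv) => x; rewrite q0 lerDr p0.
  + exact: coD.
- move=> r S /(co_born HV)[phi Pphi hS]; apply/(co_born HV).
  have p0 := cone_ge0 cP Pphi; have r1 : 0 < `|r| + 1 by rewrite ltr_wpDl.
  exists (fun x => (`|r| + 1) * phi x); first by apply: (coneZ cP) => //; apply: ltW.
  move=> _ [c cr [u Su <-]]; apply/nle_rescale => //.
  apply: (@nle_le _ _ _ (normc c * 1)).
    by rewrite !mulr1 (le_trans cr)// (le_trans (ler_norm r))// lerDl.
  by apply: (nleZ p0 (hS u Su)) => x; rewrite coZ.
- move=> S /(co_born HV)[phi Pphi hS]; exists [set u | nle phi 1 (co u)]; split=> //.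
    by apply/(co_born HV); exists phi.
  exact: disk_complete.
Qed.

(** If [u] lies in the disk of [phi], the remainder after finitely many coordinates has norm at most
    the tail of the series for the norm of [u]; these tails serve as the null sequence. *)
Lemma be_cvg (u : V) : born_cvg (fun n => \sum_(x <- initial X n) co u x *: unit_vec co x) u.
Proof.
have [phi Pphi [u0 hu]] := co_disk HV u; have p0 := cone_ge0 cP Pphi.
pose h x := normc (co u x) / phi x.
have h0 x : 0 <= h x by rewrite divr_ge0 ?normc_ge0.
exists [set v | nle phi 1 (co v)], (fun n => usup h - \sum_(x <- initial X n) h x); split.
- by apply/(co_born HV); exists phi.
- exact: usup_en_cvg hu.
move=> n; set v := _ - u; set e := _ - _.
have cv x : co v x = if x \in initial X n then 0 else - co u x.
  by rewrite coB co_sum_be ?en_uniq//; case: ifP; rewrite ?subrr ?sub0r.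
have ev : nle phi e (co v).
  split=> [x px|s us]; first by rewrite cv u0// oppr0 if_same.
  have := usup_tail hu (filter_uniq (fun x => x \notin initial X n) us) (filter_all _ _).
  rewrite -/e; apply: le_trans.
  rewrite big_filter [leRHS]big_mkcond; apply: ler_sum => x _; rewrite cv.
  by case: (x \in initial X n); rewrite ?normc0 ?mul0r ?normcN//; exact: lexx.
have e0 : 0 <= e by rewrite subr_ge0; apply: usup_ub hu _ (en_uniq _ _).
(* A vanishing tail forces the remainder itself to be 0. *)
have [ez|ez] := eqVneq e 0.
  exists 0; first by rewrite /= (_ : co 0 = fun=> 0); [exact: nle0|apply/funext/co0].
  rewrite scaler0; apply: (co_inj HV); apply/funext => x; rewrite co0.
  apply: eq0_normc; apply/eqP; rewrite eq_le normc_ge0 andbT.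
  by have := nle_coord x p0 ev; rewrite ez mul0r.
exists ((e^-1)%:C%C *: v).
  have := nleZ (d := co ((e^-1)%:C%C *: v)) p0 ev (coZ _ v).
  by rewrite normcR ger0_norm ?invr_ge0// mulVf.
by rewrite scalerA -rmorphM /= divff// scale1r.
Qed.

(** Bounded linear maps preserve the convergence of [be_cvg], and limits are unique. Through this
    lemma identities between maps are checked on basis vectors only. *)
Lemma blin_eq (Y : bornSpace R) (f g : V -> Y) : complete_bornology Y ->
  blin f -> blin g -> (forall x, f (unit_vec co x) = g (unit_vec co x)) -> f =1 g.
Proof.
move=> cY [lf bf] [lg bg] fg u.
have cf := born_cvg_map lf bf (be_cvg u); have cg := born_cvg_map lg bg (be_cvg u).
apply: (born_cvg_unique cY cf).
have -> // : (fun n => f (\sum_(x <- initial X n) co u x *: unit_vec co x)) =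
             (fun n => g (\sum_(x <- initial X n) co u x *: unit_vec co x)).
apply/funext => n; have [F Ff] := linear_exists lf; have [G Gg] := linear_exists lg.
rewrite -Ff -Gg !linear_sum; apply: eq_bigr => x _.
by rewrite !linearZ /= Ff Gg fg.
Qed.

(** For fixed [phi] the vectors [phi x *: g x] lie in one complete disk [T]. For [u] in the disk of
    [phi] the series of the [co u x *: g x] converges absolutely in the Banach space spanned by [T],
    with sum in [T], which also gives boundedness. *)
Lemma lext_exists (Y : bornSpace R) (g : X -> Y) : complete_bornology Y ->
  (forall phi, Phi phi -> bornology (range (fun x => (phi x)%:C%C *: g x))) ->
  exists f : {linear V -> Y}, bounded_map f /\ forall x, f (unit_vec co x) = g x.
Proof.
move=> cY hg; pose S u n := \sum_(x <- initial X n) co u x *: g x.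
have key phi : Phi phi -> exists2 T : set Y, bornology T &
    forall u, nle phi 1 (co u) -> exists2 y, T y & born_cvg (S u) y.
  move=> Pphi; have p0 := cone_ge0 cP Pphi.
  have [T [N [gT bT _ [hN cN TE]]]] := born_disk cY (hg phi Pphi).
  exists T => // u [u0 hu].
  pose h x := normc (co u x) / phi x.
  have h0 x : 0 <= h x by rewrite divr_ge0 ?normc_ge0.
  have [hN0 hND hNZ] := hN.
  have gx x : lspan T ((phi x)%:C%C *: g x) /\ N ((phi x)%:C%C *: g x) <= 1.
    have /gT : range (fun x => (phi x)%:C%C *: g x) ((phi x)%:C%C *: g x) by exists x.
    by rewrite {1}TE.
  (* Where [phi] vanishes so does the coordinate of [u]; elsewhere the term is a multiple of
     [phi x *: g x] with factor of modulus [h x]. *)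
  have term x : lspan T (co u x *: g x) /\ N (co u x *: g x) <= h x.
    have [px|px] := eqVneq (phi x) 0.
      rewrite u0// scale0r; split; first exact: lspan0.
      by rewrite (norm_on0 hN).
    have [gs gn] := gx x.
    have -> : co u x *: g x = (co u x / (phi x)%:C%C) *: ((phi x)%:C%C *: g x).
      by rewrite scalerA divfK//; apply: contra_neq px => -[].
    split; first exact: lspanZ.
    rewrite hNZ// normcM normcV normcR (ger0_norm (p0 x)).
    by rewrite ler_piMr// divr_ge0 ?normc_ge0.
  have sumT s : lspan T (\sum_(x <- s) co u x *: g x).
    by apply: lspan_sum => x; have [] := term x.
  have sumN s : N (\sum_(x <- s) co u x *: g x) <= \sum_(x <- s) h x.
    by apply: (norm_on_sum hN) => x; have [] := term x.
  have diff n m : (n <= m)%N -> N (S u m - S u n) <= usup h - \sum_(x <- initial X n) h x.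
    move=> /subnK; rewrite addnC => <-; have [s [es us sn]] := en_cat X n (m - n).
    rewrite /S es big_cat /= addrAC subrr add0r.
    by apply: le_trans (sumN s) (usup_tail hu us sn).
  have ST n : lspan T (S u n) by apply: sumT.
  have [||l Tl Nl] := cN (S u); first exact: ST.
    move=> e e0; have e2 : 0 < e / 2 by rewrite divr_gt0.
    have [n0 hn] := usup_en h0 hu e2; exists n0 => m n mm nn.
    have {}hn := hn n0 (leqnn _); have dm := diff _ _ mm; have dn := diff _ _ nn.
    have -> : S u m - S u n = (S u m - S u n0) + - (S u n - S u n0).
      by rewrite opprB addrA subrK.
    have sB k : lspan T (S u k - S u n0) by apply: lspanB.
    have sN k : lspan T (- (S u k - S u n0)) by rewrite opprB; apply: lspanB.
    apply: le_lt_trans (hND _ _ (sB m) (sN n)) _; rewrite (norm_onN hN)//; lra.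
  have sB n : lspan T (S u n - l) by apply: lspanB.
  exists l.
    rewrite TE; split=> //; apply/ler_addgt0Pl => e e0.
    have [n0 hn] := (cvg0P _).1 Nl _ e0; have {}hn := hn n0 (leqnn _).
    rewrite ger0_norm ?(norm_on_ge0 hN)// in hn.
    have -> : l = - (S u n0 - l) + S u n0 by rewrite opprB subrK.
    have sN : lspan T (- (S u n0 - l)) by rewrite opprB; apply: lspanB.
    apply: le_trans (hND _ _ sN (ST n0)) _; rewrite (norm_onN hN)//.
    have := sumN (initial X n0); have := hu _ (en_uniq X n0); rewrite -/(S u n0) -/h; lra.
  exists T, (fun n => N (S u n - l)); split=> // n.
  have [z|z] := eqVneq (N (S u n - l)) 0.
    exists 0; first by rewrite TE; split; [exact: lspan0|rewrite (norm_on0 hN)].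
    by rewrite scaler0; apply: hN0.
  have zp : 0 < N (S u n - l) by rewrite lt_neqAle eq_sym z (norm_on_ge0 hN).
  exists ((N (S u n - l))^-1%:C%C *: (S u n - l)).
    rewrite TE; split; first exact: lspanZ.
    by rewrite hNZ// normcR gtr0_norm ?invr_gt0// mulVf.
  by rewrite scalerA -rmorphM /= divff// scale1r.
have /choice[f hf] : forall u, exists y, born_cvg (S u) y.
  move=> u.
  have [phi Pphi hu] := co_disk HV u; have [T _ hT] := key phi Pphi.
  by have [y _ hy] := hT u hu; exists y.
have lf : linear f.
  move=> c u v; apply: (born_cvg_unique cY (hf _)).
  have := born_cvg_lin cY c (hf u) (hf v).
  rewrite (_ : (fun n => _) = S (c *: u + v))//; apply/funext => n.
  rewrite /S scaler_sumr -big_split; apply: eq_bigr => x _ /=.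
  by rewrite (co_linear HV) scalerDl scalerA.
have [F Ff] := linear_exists lf; exists F; split.
  move=> B /(co_born HV)[phi Pphi hB]; have [T bT hT] := key phi Pphi.
  apply: (born_sub cY bT) => _ [u Bu <-]; have [y Ty hy] := hT u (hB u Bu).
  by rewrite Ff (born_cvg_unique cY (hf u) hy).
move=> x; rewrite Ff; apply: (born_cvg_unique cY (hf _)).
have [T [N [gT bT _ _]]] := born_disk cY (born1 cY (g x)).
(* The partial sums are 0 until the code of [x] is passed and [g x] afterwards, so the errors are
   [- g x] and then 0. *)
exists T, (fun n => if (pickle x < n)%N then 0 else -1); split=> //.
  apply/cvg0P => e e0; exists (pickle x).+1 => n nx.
  by rewrite nx normr0.
move=> n; exists (g x); first exact: gT.
have -> : S (unit_vec co x) n = if x \in initial X n then g x else 0.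
  rewrite /S; under eq_bigr do rewrite co_be.
  case: ifPn => xn.
    rewrite (bigD1_seq x) ?en_uniq//= eqxx scale1r big1 ?addr0// => y /negPf ->.
    by rewrite scale0r.
  rewrite big_seq big1// => y yn; case: eqVneq => [e|_]; last by rewrite scale0r.
  by rewrite -e yn in xn.
rewrite mem_en; case: ifP => _; first by rewrite subrr scale0r.
by rewrite sub0r rmorphN1 scaleN1r.
Qed.

(** A total function with the zero map as default, so that formulas need not carry the proof of
    boundedness on the basis. *)
Definition lext (Y : bornSpace R) (g : X -> Y) : {linear V -> Y} :=
  if pselect (exists f : {linear V -> Y}, bounded_map f /\ forall x, f (unit_vec co x) = g x)
  is left e then projT1 (cid e) else \0.

Definition bounded_on_basis (Y : bornSpace R) (g : X -> Y) :=
  forall phi, Phi phi -> bornology (range (fun x => (phi x)%:C%C *: g x)).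

Lemma lextP (Y : bornSpace R) (g : X -> Y) : complete_bornology Y ->
  bounded_on_basis g ->
  bounded_map (lext g) /\ forall x, lext g (unit_vec co x) = g x.
Proof.
move=> cY hg; rewrite /lext; case: pselect => [e|[]]; last exact: lext_exists.
by case: (cid e).
Qed.

End SequenceSpaces.


(** * The model space attached to a cone *)

Section KoetheSpace.
Variables (R : realType) (X : countType) (Phi : set (X -> R)).
Local Notation C := R[i].
Hypothesis HP : cone Phi.

Definition kset : set (X -> C) := [set a | exists2 phi, Phi phi & nle phi 1 a].

Lemma kset0 : kset 0.
Proof. by exists (fun=> 0); [exact: (cone0 HP)|apply: nle0]. Qed.

Lemma kset_lin (c : C) (a b : X -> C) : kset a -> kset b -> kset (c *: a + b).
Proof.
move=> [phi Pphi ha] [psi Ppsi hb].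
have p0 := cone_ge0 HP Pphi; have q0 := cone_ge0 HP Ppsi.
have s0 x : 0 <= phi x + psi x by rewrite addr_ge0.
have r0 : 0 < normc c * 1 + 1 by rewrite ltr_wpDl// mulr1 normc_ge0.
exists (fun x => (normc c * 1 + 1) * (phi x + psi x)).
  by apply: (coneZ HP); [exact: ltW|exact: (coneD HP)].
apply/nle_rescale => //; rewrite [X in nle _ X]mulr1.
apply: (@nle_lin _ _ _ _ _ c a b _ s0) => //.
- by apply: nle_mono ha => x; rewrite p0 lerDl q0.
- by apply: nle_mono hb => x; rewrite q0 lerDr p0.
Qed.

(** Provides the tensor products and free bimodules, whose cones are assembled from those of the
    factors. *)
Definition kspace : bornSpace R :=
  @BornSpace R (subspace_of (Subspace kset0 kset_lin))
    [set S | exists2 phi, Phi phi & forall u, S u -> nle phi 1 (\val u)].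

Definition kco (u : kspace) : X -> C := \val u.

Lemma kspaceP : seqspace Phi kco.
Proof.
split=> //.
- by move=> u; have /set_mem[phi Pphi hu] := subspace_valP u; exists phi.
- move=> phi a Pphi ha.
  have ka : kset a by exists phi.
  by exists (@SubspaceOf _ _ (Subspace kset0 kset_lin) a (mem_set ka)).
Qed.

End KoetheSpace.

Section Basis.
Variables (R : realType) (X Y : countType) (Phi : set (X -> R)) (Psi : set (Y -> R)).
Variables (V W : bornSpace R) (co : V -> X -> R[i]) (co' : W -> Y -> R[i]).
Hypotheses (HV : seqspace Phi co) (HW : seqspace Psi co').

Lemma bounded_on_basisP (g : X -> W) :
  (forall phi, Phi phi -> exists2 psi, Psi psi &
     forall x, nle psi 1 (co' ((phi x)%:C%C *: g x))) ->
  bounded_on_basis Phi g.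
Proof.
move=> h phi /h[psi Ppsi hx]; apply/(co_born HW); exists psi => // _ [x _ <-] //.
Qed.

Lemma be_bounded phi : Phi phi -> bornology (range (fun x => (phi x)%:C%C *: unit_vec co x)).
Proof.
move=> Pphi; apply/(co_born HV); exists phi => // _ [x _ <-].
apply: (nle_be HV) => //; rewrite mul1r normcR ger0_norm//.
exact: cone_ge0 (ss_cone HV) _ Pphi x.
Qed.

Lemma co_eq_be u x : co u = (fun y => (y == x)%:R) -> u = unit_vec co x.
Proof. by move=> h; apply: (co_inj HV); rewrite h (co_be HV). Qed.

End Basis.

(** * Complete tensor products and quotients *)

Section Tensor.
Variables (R : realType) (X Y : countType) (Phi : set (X -> R)) (Psi : set (Y -> R)).
Local Notation C := R[i].

(** Domination by a product, rather than being one, makes this set closed under sums: phi psi + phi'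
    psi' <= (phi + phi') (psi + psi'). *)
Definition tens : set (X * Y -> R) := [set chi | (forall p, 0 <= chi p) /\
  exists phi psi, [/\ Phi phi, Psi psi & forall x y, chi (x, y) <= phi x * psi y]].

Lemma tens_cone : cone Phi -> cone Psi -> cone tens.
Proof.
move=> cX cY; split.
- split=> //; exists (fun=> 0), (fun=> 0); split; [exact: cone0|exact: cone0|].
  by move=> x y; rewrite mulr0.
- by move=> chi [].
- move=> chi chi' [h0 [phi [psi [Pp Pq h]]]] [h0' [phi' [psi' [Pp' Pq' h']]]].
  split=> [p|]; first by rewrite addr_ge0.
  exists (fun x => phi x + phi' x), (fun y => psi y + psi' y).
  split; [exact: (coneD cX)|exact: (coneD cY)|move=> x y].
  have := h x y; have := h' x y.
  have := cone_ge0 cX Pp x; have := cone_ge0 cX Pp' x.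
  have := cone_ge0 cY Pq y; have := cone_ge0 cY Pq' y; nra.
- move=> r chi r0 [h0 [phi [psi [Pp Pq h]]]]; split=> [p|]; first by rewrite mulr_ge0.
  exists (fun x => r * phi x), psi; split=> //; first exact: (coneZ cX).
  by move=> x y; rewrite -mulrA ler_wpM2l.
- move=> chi chi' [h0 [phi [psi [Pp Pq h]]]] hh; split=> [p|]; first by have /andP[] := hh p.
  by exists phi, psi; split=> // x y; apply: le_trans (h x y); have /andP[] := hh (x, y).
- move=> [x y]; split=> // ; exists (fun z => (z == x)%:R), (fun z => (z == y)%:R).
  split; [exact: (cone_delta cX)|exact: (cone_delta cY)|].
  by move=> x' y'; rewrite xpair_eqE -natrM mulnb.
Qed.

Variables (V W : bornSpace R) (coV : V -> X -> C) (coW : W -> Y -> C).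
Hypotheses (HV : seqspace Phi coV) (HW : seqspace Psi coW).
Let cX := ss_cone HV.
Let cY := ss_cone HW.

Definition tspace := kspace (tens_cone cX cY).
Let tco : tspace -> X * Y -> C := @kco _ _ _ (tens_cone cX cY).

Lemma tspaceP : seqspace tens tco.
Proof. exact: kspaceP. Qed.

Lemma nle_tensor phi psi (a : X -> C) (b : Y -> C) :
  (forall x, 0 <= phi x) -> (forall y, 0 <= psi y) -> nle phi 1 a -> nle psi 1 b ->
  nle (fun p => phi p.1 * psi p.2) 1 (fun p => a p.1 * b p.2).
Proof.
move=> p0 q0 [a0 ha] [b0 hb]; split=> [[x y]|s us] /=.
  by move/eqP; rewrite mulf_eq0 => /orP[]/eqP => [/a0|/b0] ->; rewrite (mul0r, mulr0).
pose h x := normc (a x) / phi x; pose k y := normc (b y) / psi y.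
have h0 x : 0 <= h x by rewrite divr_ge0 ?normc_ge0.
have k0 y : 0 <= k y by rewrite divr_ge0 ?normc_ge0.
(* The finite set is enlarged to the rectangle spanned by its projections, over which the sum
   factorises. *)
pose sx := undup (map fst s); pose sy := undup (map snd s).
pose s' := [seq (x, y) | x <- sx, y <- sy].
have us' : uniq s' by apply: allpairs_uniq; rewrite ?undup_uniq// => -[? ?] [? ?] _ _.
have ss' : {subset s <= s'}.
  move=> [x y] ps; apply/allpairsP; exists (x, y); split=> //=; rewrite mem_undup.
    by apply/mapP; exists (x, y).
  by apply/mapP; exists (x, y).
rewrite (eq_bigr (fun p => h p.1 * k p.2)); last first.
  by move=> p _; rewrite normcM invfM /h /k mulrACA.
apply: le_trans (sum_subset (h := fun p => h p.1 * k p.2) _ us us' ss') _.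
  by move=> p; rewrite mulr_ge0.
rewrite big_allpairs /=; under eq_bigr do rewrite -mulr_sumr.
rewrite -mulr_suml -[leRHS]mulr1; apply: ler_pM; rewrite ?sumr_ge0//.
  by apply: ha; apply: undup_uniq.
by apply: hb; apply: undup_uniq.
Qed.

Lemma tens_prod phi psi : Phi phi -> Psi psi -> tens (fun p => phi p.1 * psi p.2).
Proof.
move=> Pp Pq; split=> [p|]; last by exists phi, psi.
by apply: mulr_ge0; [exact: cone_ge0 cX _ Pp _|exact: cone_ge0 cY _ Pq _].
Qed.

Lemma tensor_exists v w : exists t : tspace, tco t = fun p => coV v p.1 * coW w p.2.
Proof.
have [phi Pp hv] := co_disk HV v; have [psi Pq hw] := co_disk HW w.
apply: (co_surj tspaceP (tens_prod Pp Pq)).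
by apply: nle_tensor; [exact: cone_ge0 cX _ Pp|exact: cone_ge0 cY _ Pq| |].
Qed.

Definition tensor v w : tspace := projT1 (cid (tensor_exists v w)).

Lemma tensorE v w : tco (tensor v w) = fun p => coV v p.1 * coW w p.2.
Proof. by rewrite /tensor; case: cid. Qed.

Lemma tensor_be x y : tensor (unit_vec coV x) (unit_vec coW y) = unit_vec tco (x, y).
Proof.
apply: (co_eq_be tspaceP); rewrite tensorE; apply/funext => -[x' y'] /=.
by rewrite (co_be HV) (co_be HW) xpair_eqE -natrM mulnb.
Qed.

Lemma tensor_bilinear : bounded_bilinear tensor.
Proof.
split=> [v c w w'|w c v v'|S T /(co_born HV)[phi Pp hS] /(co_born HW)[psi Pq hT]].
- apply: (co_inj tspaceP); apply/funext => p.
  by rewrite (co_linear tspaceP) !tensorE (co_linear HW) mulrDr mulrCA.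
- apply: (co_inj tspaceP); apply/funext => p.
  by rewrite (co_linear tspaceP) !tensorE (co_linear HV) mulrDl mulrA.
- apply/(co_born tspaceP); exists (fun p => phi p.1 * psi p.2); first exact: tens_prod.
  move=> _ [v Sv [w Tw <-]]; rewrite tensorE.
  by apply: nle_tensor; [exact: cone_ge0 cX _ Pp|exact: cone_ge0 cY _ Pq|exact: hS|exact: hT].
Qed.

Let cV := seqspace_complete HV.
Let cW := seqspace_complete HW.
Let cT := seqspace_complete tspaceP.

Lemma bilinear_eq (Z : bornSpace R) (b b' : V -> W -> Z) : complete_bornology Z ->
  bounded_bilinear b -> bounded_bilinear b' ->
  (forall x y, b (unit_vec coV x) (unit_vec coW y) = b' (unit_vec coV x) (unit_vec coW y)) ->
  forall v w, b v w = b' v w.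
Proof.
move=> cZ hb hb' h v w.
apply: (blin_eq HV cZ (f := b^~ w) (g := b'^~ w)).
- exact: (blin_l w cW cZ hb (blin_id V)).
- exact: (blin_l w cW cZ hb' (blin_id V)).
move=> x; apply: (blin_eq HW cZ (f := b _) (g := b' _)) => //.
- exact: (blin_r _ cV cZ hb (blin_id W)).
- exact: (blin_r _ cV cZ hb' (blin_id W)).
Qed.

Lemma bilinear_comp (Z Z' : bornSpace R) (b : V -> W -> Z) (f : Z -> Z') :
  bounded_bilinear b -> blin f -> bounded_bilinear (fun v w => f (b v w)).
Proof.
move=> [b1 b2 bb] [lf bf]; split=> [v c w w'|w c v v'|S T bS bT].
- by rewrite b1 lf.
- by rewrite b2 lf.
have := bf _ (bb S T bS bT); congr bornology; apply/seteqP; split=> z /=.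
  by move=> [_ [v Sv [w Tw <-]] <-]; exists v => //; exists w.
by move=> [v Sv [w Tw <-]]; exists (b v w) => //; exists v => //; exists w.
Qed.

(** The scaled unit vectors of each factor form a bounded set, and so do their images under [b].
    Passing from the product weight to the smaller [chi] only multiplies by scalars of modulus at
    most 1. *)
Lemma bilinear_bounded_on_basis (Z : bornSpace R) (b : V -> W -> Z) :
  complete_bornology Z -> bounded_bilinear b ->
  bounded_on_basis tens (fun p => b (unit_vec coV p.1) (unit_vec coW p.2)).
Proof.
move=> cZ [b1 b2 bb] chi [h0 [phi [psi [Pp Pq h]]]].
apply: (born_sub cZ (bornZ cZ 1 (bb _ _ (be_bounded HV Pp) (be_bounded HW Pq)))).
move=> _ [[x y] _ <-] /=.
have p0 := cone_ge0 cX Pp x; have q0 := cone_ge0 cY Pq y.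
have h1 := h x y; have h2 := h0 (x, y).
have nr : normc (chi (x, y) / (phi x * psi y))%:C%C <= 1.
  rewrite normcR ger0_norm ?divr_ge0 ?mulr_ge0//.
  have [z|z] := eqVneq (phi x * psi y) 0; first by rewrite z invr0 mulr0.
  by rewrite ler_pdivrMr ?mul1r// lt_neqAle eq_sym z mulr_ge0.
exists ((chi (x, y) / (phi x * psi y))%:C%C) => //.
exists (b ((phi x)%:C%C *: unit_vec coV x) ((psi y)%:C%C *: unit_vec coW y)).
  by exists ((phi x)%:C%C *: unit_vec coV x); [exists x|exists ((psi y)%:C%C *: unit_vec coW y) => //; exists y].
have b1Z v c w : b v (c *: w) = c *: b v w.
  exact: linear_scale (b1 v) c w.
have b2Z w c v : b (c *: v) w = c *: b v w.
  exact: linear_scale (b2 w) c v.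
rewrite b1Z b2Z !scalerA -!rmorphM /=; congr ((_)%:C%C *: _).
transitivity (chi (x, y) / (phi x * psi y) * (phi x * psi y)); first by ring.
have [z|z] := eqVneq (phi x * psi y) 0; last by rewrite divfK.
by rewrite z mulr0; apply/eqP; rewrite eq_le h2 /= -z.
Qed.

(** The l1-isomorphism in universal form: a bilinear map is prescribed by its values on pairs of
    unit vectors, extended by [lextP], and unique by density. *)
Lemma tensor_ctensor : is_ctensor tensor.
Proof.
split=> [||Z cZ b hb]; [exact: cT|exact: tensor_bilinear|].
have bd := bilinear_bounded_on_basis cZ hb.
have [bf fE] := lextP tspaceP cZ bd.
exists (lext tco (fun p => b (unit_vec coV p.1) (unit_vec coW p.2))); split=> //.
- move=> v w; apply: (bilinear_eq (b := fun v w => lext tco _ (tensor v w))) => //.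
    by apply: bilinear_comp; [exact: tensor_bilinear|exact: blin_lin].
  by move=> x y; rewrite tensor_be fE.
- move=> g bg gE; apply: (blin_eq tspaceP cZ); [exact: blin_lin|exact: blin_lin|].
  by move=> -[x y]; rewrite fE -tensor_be gE.
Qed.

Definition bext (Z : bornSpace R) (g : X -> Y -> Z) : V -> W -> Z :=
  fun v w => lext tco (fun p => g p.1 p.2) (tensor v w).

Lemma bextP (Z : bornSpace R) (g : X -> Y -> Z) : complete_bornology Z ->
  bounded_on_basis tens (fun p => g p.1 p.2) ->
  bounded_bilinear (bext g) /\ forall x y, bext g (unit_vec coV x) (unit_vec coW y) = g x y.
Proof.
move=> cZ hg; have [bf fE] := lextP tspaceP cZ hg; split.
  by apply: bilinear_comp; [exact: tensor_bilinear|exact: blin_lin].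
by move=> x y; rewrite /bext tensor_be fE.
Qed.

End Tensor.

Section Quotient.
Variables (R : realType) (X : countType) (Phi : set (X -> R)).
Variables (V L : bornSpace R) (co : V -> X -> R[i]).
Hypotheses (HV : seqspace Phi co) (cL : complete_bornology L).

(** If q v = 0 then v = v - s (q v), which is the limit of the same expression on partial sums of
    [v]; those lie in the span of the relations. The section also lifts bounded sets. *)
Lemma quotient_by_closure (q : {linear V -> L}) (s : {linear L -> V}) (rel : set V) :
  bounded_map q -> bounded_map s -> (forall y, q (s y) = y) ->
  (forall r, rel r -> q r = 0) ->
  (forall x, lspan rel (unit_vec co x - s (q (unit_vec co x)))) ->
  is_quotient (born_closure (lspan rel)) q.
Proof.
move=> bq bs sK qrel hrel; have cV := seqspace_complete HV; split.
- by move=> y; exists (s y).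
- move=> v; split=> [qv F clF relF|clv].
    have hv := be_cvg HV v.
    have bl : blin (fun v => v - s (q v)).
      by apply: blinB => //; [exact: blin_id|apply: blin_comp; exact: blin_lin].
    have := born_cvg_map bl.1 bl.2 hv; rewrite qv linear0 subr0; apply: clF => n.
    apply: relF; have [G GE] := linear_exists bl.1.
    rewrite -GE linear_sum; apply: lspan_sum => x; rewrite linearZ /=; apply: lspanZ.
    by rewrite GE.
  (* Conversely, the kernel of a bounded map is closed and contains the relations. *)
  apply: (clv [set v | q v = 0]).
    move=> u x qu ux; have := born_cvg_map (linearP q) bq ux.
    rewrite (_ : (fun n => q (u n)) = fun=> 0); last by apply/funext => n; apply: qu.
    move=> h; apply: (born_cvg_unique cL h).
    exists [set 0], (fun=> 0); split; [exact: born1|exact: cvg_cst|].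
    by move=> n; exists 0; rewrite ?scaler0 ?subr0.
  move=> _ [n [c [w [hw ->]]]]; rewrite /= linear_sum big1// => i _.
  by rewrite linearZ /= qrel// scaler0.
- move=> S; split=> [bS|[S' bS' ->]]; last exact: bq.
  exists (s @` S); first exact: bs.
  rewrite image_comp; apply/seteqP; split=> [y Sy|_ [y Sy <-]]; first by exists y => //=; rewrite sK.
  by rewrite /= sK.
Qed.

End Quotient.

(** * Cellular chains of the plane *)

Section Koszul.

(* In dimension 1, [true] and [false] are the horizontal and vertical edges. *)
Definition cell (n : nat) : countType :=
  match n with 0 => unit | 1 => bool | 2 => unit | _ => void end.

Definition dir (i : bool) : Z2 := if i then (1, 0) else (0, 1).

Section PathSum.
Variable V : zmodType.
Implicit Type F : int -> V.

(** The oriented sum over the unit intervals between 0 and [x], labelled by their left ends; the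
    sign for negative [x] makes [isumS] valid on all integers. *)
Definition isum (x : int) F : V := match x with
  | Posz n => \sum_(k < n) F (Posz k)
  | Negz n => - \sum_(k < n.+1) F (Negz k) end.

Lemma isumS x F : isum (x + 1) F = isum x F + F x.
Proof.
case: x => [n|[|n]].
- by rewrite -[Posz n + 1]/(Posz (n + 1)) addn1 /= big_ord_recr.
- by rewrite -[Negz 0 + 1]/(Posz 0) /= big_ord0 big_ord1 addNr.
have -> : Negz n.+1 + 1 = Negz n by lia.
by rewrite /= [in RHS]big_ord_recr /= opprD subrK.
Qed.

Lemma isum_telescope x F : isum x (fun j => F (j + 1) - F j) = F x - F 0.
Proof.
elim/int_rect: x => [|n IH|n IH].
- by rewrite /= big_ord0 subrr.
- rewrite -addn1 PoszD isumS IH; by rewrite addrC addrA subrK.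
- have := isumS (- n.+1%:Z) (fun j => F (j + 1) - F j).
  have -> : - n.+1%:Z + 1 = - n%:Z by lia.
  by rewrite IH => /eqP; rewrite -subr_eq => /eqP <-; rewrite opprB addrC addrA subrK.
Qed.

Lemma isumD x F G : isum x (fun j => F j + G j) = isum x F + isum x G.
Proof. by case: x => n /=; rewrite big_split ?opprD. Qed.

Lemma isumN x F : isum x (fun j => - F j) = - isum x F.
Proof. by case: x => n /=; rewrite sumrN. Qed.

Lemma eq_isum x F G : F =1 G -> isum x F = isum x G.
Proof. by move=> FG; case: x => n /=; under eq_bigr do rewrite FG. Qed.

End PathSum.

(* [F] labels the cells of the square tiling of the plane of dimension [n];
   [bd F] labels a cell of dimension [n + 1] by the sum of the labels of its
   boundary, and [hm] is the dual of the combing of the plane that moves first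
   horizontally and then vertically. *)
Definition bd (V : zmodType) n :
    (cell n -> Z2 -> V) -> cell n.+1 -> Z2 -> V :=
  match n with
  | 0 => fun F i x => F tt (x + dir i) - F tt x
  | 1 => fun F _ x => (F true x - F true (x + dir false))
                      + (F false (x + dir true) - F false x)
  | _ => fun F _ _ => 0
  end.

Definition hm (V : zmodType) n :
    (cell n.+1 -> Z2 -> V) -> cell n -> Z2 -> V :=
  match n with
  | 0 => fun F _ x => isum x.1 (fun j => F true (j, 0))
                      + isum x.2 (fun j => F false (x.1, j))
  | 1 => fun F i x => if i then - isum x.2 (fun j => F tt (x.1, j)) else 0
  | _ => fun F _ _ => 0
  end.

Section Identities.
Variable V : zmodType.

(** Each corner of a square occurs twice, with opposite signs; beyond dimension two the boundary is
    zero. *)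
Lemma bd_bd n (F : cell n -> Z2 -> V) i x : bd (bd F) i x = 0.
Proof.
case: n F i => [|n] F i //=; rewrite !(addrAC x (dir true)).
set a := F _ _; set b := F _ _; set c := F _ _; set d := F _ _.
have -> : c - a - (d - b) = - (a - b - (c - d)); last exact: subrr.
by rewrite !opprB addrACA [RHS]addrACA [- a - d]addrC.
Qed.

(** The differences telescope along the combing path from 0 to [x]. *)
Lemma hm_bd0 (F : cell 0 -> Z2 -> V) i x : hm (bd F) i x + F tt 0 = F tt x.
Proof.
case: x => x1 x2 /=.
rewrite (@eq_isum _ x1 _ (fun j => F tt (j + 1, 0) - F tt (j, 0))); last first.
  by move=> j; rewrite /dir; congr (F tt _ - _).
rewrite (isum_telescope x1 (fun j => F tt (j, 0))).
rewrite (@eq_isum _ x2 _ (fun j => F tt (x1, j + 1) - F tt (x1, j))); last first.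
  by move=> j; rewrite /dir; congr (F tt _ - _); congr pair; rewrite /= addr0.
rewrite (isum_telescope x2 (fun j => F tt (x1, j))).
by rewrite [X in X + _]addrC addrA subrK; apply: subrK.
Qed.

(** The path to the far end of a vertical edge is the path to its near end followed by the edge, so
    nothing is filled in. For a horizontal edge the two paths and the edge bound the column of
    squares down to the axis, and the sum over that column telescopes. *)
Lemma hm_bd n (F : cell n.+1 -> Z2 -> V) i x : hm (bd F) i x + bd (hm F) i x = F i x.
Proof.
case: n F i => [|[|n]] F i; last by case: i.
  case: x => x1 x2; case: i => /=; last first.
    by rewrite !addr0 add0r isumS opprD addrACA subrr add0r addrAC subrr add0r.
  rewrite !addr0 isumS isumD.
  have tel := isum_telescope x2 (fun j => F true (x1, j)).
  have -> : isum x2 (fun j => F true (x1, j) - F true ((x1, j) + dir false)) =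
            - isum x2 (fun j => F true (x1, j + 1) - F true (x1, j)).
    rewrite -isumN; apply: eq_isum => j; rewrite opprB /dir.
    by congr (_ - F true _); congr pair; rewrite /= addr0.
  rewrite tel.
  have -> : isum x2 (fun j => F false ((x1, j) + dir true) - F false (x1, j)) =
      isum x2 (fun j => F false (x1 + 1, j)) - isum x2 (fun j => F false (x1, j)).
    rewrite -isumN -isumD; apply: eq_isum => j; rewrite /dir.
    by congr (F false _ - _); congr pair; rewrite /= addr0.
  set a := F true (x1, x2); set b := F true (x1, 0).
  set p := isum x2 _; set q := isum x2 _; set r := isum x1 _.
  have -> : r + b + p - (r + q) = b + (p - q).
    by rewrite opprD addrACA [r + b]addrC addrK.
  by rewrite opprD opprK addrACA subrK addNr addr0.
case: x => x1 x2; case: i; rewrite /= subrr !addr0 add0r isumS opprK.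
by rewrite addrA addNr add0r.
Qed.

(** Translation invariance of the tiling is what makes the differential commute with the left
    action. *)
Lemma bd_shift n (F : cell n -> Z2 -> V) i g x :
  bd F i (g + x) = bd (fun j y => F j (g + y)) i x.
Proof. by case: n F i => [|[|n]] F i //=; rewrite !addrA. Qed.

Variable W : zmodType.
Variable f : {additive V -> W}.

Lemma raddf_isum x (F : int -> V) : f (isum x F) = isum x (f \o F).
Proof. by case: x => n /=; rewrite ?raddfN /= raddf_sum. Qed.

Lemma raddf_bd n (F : cell n -> Z2 -> V) i x : f (bd F i x) = bd (fun j y => f (F j y)) i x.
Proof. by case: n F i => [|[|n]] F i /=; rewrite ?(raddfB, raddfD, raddf0). Qed.

Lemma raddf_hm n (F : cell n.+1 -> Z2 -> V) i x : f (hm F i x) = hm (fun j y => f (F j y)) i x.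
Proof.
case: n F i => [|[|n]] F i /=; rewrite ?raddfD /= ?raddf_isum ?raddf0//.
by case: i; rewrite ?raddfN ?raddf_isum ?raddf0.
Qed.

Lemma eq_bd n (F G : cell n -> Z2 -> V) i x : (forall j y, F j y = G j y) -> bd F i x = bd G i x.
Proof. by move=> FG; congr (bd _ i x); apply/funext => j; apply/funext => y. Qed.

Lemma eq_hm n (F G : cell n.+1 -> Z2 -> V) i x : (forall j y, F j y = G j y) -> hm F i x = hm G i x.
Proof. by move=> FG; congr (hm _ i x); apply/funext => j; apply/funext => y. Qed.

End Identities.

(** * Norm estimates for the boundary and the combing, with [B M u] read as: u has norm at most M *)

Section Bounds.
Variables (R : numDomainType) (V : zmodType) (B : R -> V -> Prop).
Hypothesis B0 : B 0 0.
Hypothesis BD : forall M M' u v, B M u -> B M' v -> B (M + M') (u + v).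
Hypothesis BN : forall M u, B M u -> B M (- u).
Hypothesis B_le : forall M M' u, M <= M' -> B M u -> B M' u.

(** The constant 4 counts the edges of a square; the end points of an edge give only 2. *)
Lemma bd_bound M n (F : cell n -> Z2 -> V) i x : 0 <= M ->
  (forall j e, (ell e <= 1)%N -> B M (F j (x + e))) -> B (4 * M) (bd F i x).
Proof.
move=> M0 hF; have hx j : B M (F j x) by rewrite -[x]addr0; apply: hF.
have hd j b : B M (F j (x + dir b)) by apply: hF; case: b.
have e4 : 4 * M = (M + M) + (M + M) by ring.
case: n F i hF hx hd => [|[|n]] F i hF hx hd /=.
- apply: (@B_le (M + M)); first by rewrite e4 lerDl addr_ge0.
  by apply: BD => //; apply: BN.
- rewrite e4; apply: BD; apply: BD.
  + exact: hx.
  + exact: BN (hd _ false).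
  + exact: (hd _ true).
  + exact: BN (hx _).
- by apply: B_le B0; rewrite mulr_ge0.
Qed.

Lemma isum_bound M x (F : int -> V) :
  (forall j, (`|j| + `|x - j| <= `|x|)%N -> B M (F j)) -> B (`|x|%:R * M) (isum x F).
Proof.
have sumB n (G : nat -> V) : (forall k, (k < n)%N -> B M (G k)) -> B (n%:R * M) (\sum_(k < n) G k).
  elim: n => [|n IH] hG; first by rewrite big_ord0 mul0r.
  rewrite big_ord_recr /= mulrS addrC mulrDl mul1r.
  by apply: BD; [apply: IH => k kn; apply: hG; apply: ltnW|apply: hG].
move=> hF; case: x hF => n hF /=.
  by apply: (sumB n (fun k => F (Posz k))) => k kn; apply: hF; lia.
by apply: BN; apply: (sumB n.+1 (fun k => F (Negz k))) => k kn; apply: hF; lia.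
Qed.

(** A path or column has at most [ell x] cells, all based at points lying on geodesics from 0 to
    [x]. *)
Lemma hm_bound M n (F : cell n.+1 -> Z2 -> V) i x : 0 <= M ->
  (forall j z, (ell z + ell (x - z) <= ell x)%N -> B M (F j z)) ->
  B ((ell x)%:R * M) (hm F i x).
Proof.
move=> M0; case: x => x1 x2; case: n F i => [|[|n]] F i hF; last first.
- by apply: B_le B0; rewrite mulr_ge0.
- rewrite /=; case: i; last by apply: B_le B0; rewrite mulr_ge0.
  apply: (@B_le (`|x2|%:R * M)); first by rewrite ler_wpM2r// ler_nat leq_addl.
  by apply: BN; apply: isum_bound => j hj; apply: hF; rewrite /ell /=; lia.
rewrite /ell /= natrD mulrDl; apply: BD; apply: isum_bound => j hj; apply: hF.
  by rewrite /ell /=; lia.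
by rewrite /ell /=; lia.
Qed.

End Bounds.
End Koszul.

(** * Twisted group algebras *)

Section Bilinear.
Variables (R : realType) (V W Y : bornSpace R) (b : V -> W -> Y).
Hypothesis hb : bounded_bilinear b.

Lemma bilZl c v w : b (c *: v) w = c *: b v w.
Proof. have [_ h _] := hb; exact: linear_scale (h w) c v. Qed.

Lemma bilZr c v w : b v (c *: w) = c *: b v w.
Proof. have [h _ _] := hb; exact: linear_scale (h v) c w. Qed.

End Bilinear.

(* [gc_mul] bounds the multiplication; [gc_split] bounds the contracting
   homotopy, whose value at [x] is a sum of [ell x] terms sitting at points [z]
   on a geodesic from [0] to [x]. *)
Record good_cone (R : realType) (Phi : set (Z2 -> R)) : Prop := GoodCone {
  gc_cone : cone Phi;
  gc_ball : Phi (fun x => (ell x <= 1)%N%:R);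
  gc_mul : forall phi psi, Phi phi -> Phi psi ->
    exists2 chi, Phi chi & forall x y, phi x * psi y <= chi (x + y);
  gc_split : forall phi, Phi phi -> exists2 chi, Phi chi &
    forall x z, (ell z + ell (x - z) <= ell x)%N ->
      phi x * (ell x).+1%:R <= chi z * chi (x - z) }.

(** A common interface for the Laurent polynomials and their completions: basis and structure
    constants agree, only the cone changes. *)
Record twisted_algebra (R : realType) (c : Z2 -> Z2 -> R[i]) := TwistedAlgebra {
  tg_alg :> bornAlg R;
  tg_cone : set (Z2 -> R);
  tg_co : tg_alg -> Z2 -> R[i];
  tg_good : good_cone tg_cone;
  tg_seq : seqspace tg_cone tg_co;
  tg_bil : bounded_bilinear (@amul R tg_alg);
  tg_mul : forall x y,
    amul (unit_vec tg_co x) (unit_vec tg_co y) = c x y *: unit_vec tg_co (x + y);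
  tg_one : aone tg_alg = unit_vec tg_co 0 }.

Section Twisted.
Variables (R : realType) (c : Z2 -> Z2 -> R[i]).
Local Notation C := R[i].
Hypothesis c_cocycle : forall g h z, c g h * c (g + h) z = c g (h + z) * c h z.
Hypothesis c0l : forall z, c 0 z = 1.
Hypothesis c0r : forall z, c z 0 = 1.
Hypothesis c_norm : forall x y, normc (c x y) = 1.

Local Notation tga := (twisted_algebra c).
Implicit Types S T U W : tga.

Definition tb S (x : Z2) : S := unit_vec (tg_co (t := S)) x.

Definition cone_le S T := tg_cone S `<=` tg_cone T.

Lemma cone_le_refl S : cone_le S S. Proof. by []. Qed.

Lemma tg_complete S : complete_bornology S.
Proof. exact: seqspace_complete (tg_seq S). Qed.

Let cc S := gc_cone (tg_good S).

(* [K I S T] is the free bimodule [S (x) C[I] (x) T].  Its basis vector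
   [kb i x t] stands for [c x (t - x)]^-1 times [U^x (x) i (x) U^(t - x)], of
   total degree [t]: with this normalisation the cocycle only enters the two
   actions, and the Koszul complex is the cellular chain complex of the plane in
   the variable [x], for each [t]. *)
Definition tconeK (I : countType) S T : set (I * (Z2 * Z2) -> R) :=
  [set chi | (forall p, 0 <= chi p) /\ exists phi psi,
    [/\ tg_cone S phi, tg_cone T psi
      & forall i x t, chi (i, (x, t)) <= phi x * psi (t - x)]].

Arguments tconeK I S T : clear implicits.

Lemma tconeK_cone I S T : cone (tconeK I S T).
Proof.
have cX := cc S; have cY := cc T; split.
- split=> //; exists (fun=> 0), (fun=> 0); split; [exact: cone0|exact: cone0|].
  by move=> i x y; rewrite mulr0.
- by move=> chi [].
- move=> chi chi' [h0 [phi [psi [Pp Pq h]]]] [h0' [phi' [psi' [Pp' Pq' h']]]].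
  split=> [p|]; first by rewrite addr_ge0.
  exists (fun x => phi x + phi' x), (fun y => psi y + psi' y).
  split; [exact: (coneD cX)|exact: (coneD cY)|move=> i x t].
  have := h i x t; have := h' i x t.
  have := cone_ge0 cX Pp x; have := cone_ge0 cX Pp' x.
  have := cone_ge0 cY Pq (t - x); have := cone_ge0 cY Pq' (t - x); nra.
- move=> r chi r0 [h0 [phi [psi [Pp Pq h]]]]; split=> [p|]; first by rewrite mulr_ge0.
  exists (fun x => r * phi x), psi; split=> //; first exact: (coneZ cX).
  by move=> i x t; rewrite -mulrA ler_wpM2l.
- move=> chi chi' [h0 [phi [psi [Pp Pq h]]]] hh; split=> [p|]; first by have /andP[] := hh p.
  exists phi, psi; split=> // i x t; apply: le_trans (h i x t).
  by have /andP[] := hh (i, (x, t)).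
- move=> [i [x t]]; split=> //.
  exists (fun z => (z == x)%:R), (fun z => (z == t - x)%:R).
  split; [exact: (cone_delta cX)|exact: (cone_delta cY)|].
  move=> i' x' t'; rewrite -natrM mulnb ler_nat.
  by case: (eqVneq (i', (x', t')) (i, (x, t))) => // -[_ -> ->]; rewrite !eqxx.
Qed.

Definition K (I : countType) S T : bornSpace R := kspace (tconeK_cone I S T).
Definition Kco (I : countType) S T : K I S T -> I * (Z2 * Z2) -> C :=
  @kco _ _ _ (tconeK_cone I S T).
Definition kb (I : countType) S T (i : I) (x t : Z2) : K I S T := unit_vec (@Kco I S T) (i, (x, t)).

Lemma K_seq I S T : seqspace (tconeK I S T) (@Kco I S T).
Proof. exact: kspaceP. Qed.

Lemma K_complete I S T : complete_bornology (K I S T).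
Proof. exact: seqspace_complete (K_seq I S T). Qed.

Definition kweight (I : countType) (phi psi : Z2 -> R) (p : I * (Z2 * Z2)) : R :=
  phi p.2.1 * psi (p.2.2 - p.2.1).

Lemma tconeK_prod I S T phi psi : tg_cone S phi -> tg_cone T psi ->
  tconeK I S T (@kweight I phi psi).
Proof.
move=> Pp Pq; split=> [p|]; last by exists phi, psi.
by apply: mulr_ge0; [exact: cone_ge0 (cc S) _ Pp _|exact: cone_ge0 (cc T) _ Pq _].
Qed.

Lemma nle_kb (I : countType) S T phi psi (r : R) (d : C) i x t : tg_cone S phi -> tg_cone T psi ->
  0 <= r -> normc d = 1 -> r <= phi x * psi (t - x) ->
  nle (kweight phi psi) 1
    (Kco ((r%:C)%C *: (d *: kb S T (i : I) x t))).
Proof.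
move=> Pp Pq r0 d1 h; rewrite scalerA; apply: (nle_be (K_seq I S T)) => //.
  exact: tconeK_prod.
by rewrite normcM normcR d1 mulr1 mul1r ger0_norm.
Qed.

(** For U = S this is the left action; for S = A and U = B it is the balanced map that realises base
    change. By the cocycle identity the normalisation of [kb] leaves the coefficient [c g t],
    independent of [x]. *)
Definition lmap (I : countType) U S T : U -> K I S T -> K I U T :=
  bext (tg_seq U) (K_seq I S T) (fun g p => c g p.2.2 *: kb U T p.1 (g + p.2.1) (g + p.2.2)).

Definition rmap (I : countType) S T U : K I S T -> U -> K I S U :=
  bext (K_seq I S T) (tg_seq U) (fun p g => c p.2.2 g *: kb S U p.1 p.2.1 (p.2.2 + g)).

Section Actions.
Variable I : countType.

Lemma lmapP U S T : cone_le S U -> bounded_bilinear (@lmap I U S T) /\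
  forall g (i : I) x t, lmap (tb U g) (kb S T i x t) = c g t *: kb U T i (g + x) (g + t).
Proof.
move=> SU; have [|bl ext_unit] := bextP (tg_seq U) (K_seq I S T)
  (g := fun g p => c g p.2.2 *: kb U T p.1 (g + p.2.1) (g + p.2.2)) (K_complete I U T).
  apply: (bounded_on_basisP (K_seq I U T)).
  move=> chi [h0 [phi [chi' [Pp [h0' [phi1 [psi [Pp1 Pq h']]]] h]]]].
  have [phi2 Pp2 h2] := gc_mul (tg_good U) Pp (SU _ Pp1).
  exists (kweight phi2 psi); first exact: tconeK_prod.
  move=> [g [i [x t]]] /=; apply: nle_kb => //.
  rewrite opprD addrACA subrr add0r.
  apply: le_trans (h _ _) _.
  apply: le_trans (ler_wpM2l _ (h' i x t)) _; first exact: cone_ge0 (cc U) _ Pp _.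
  by rewrite mulrA; apply: ler_wpM2r (h2 g x); exact: cone_ge0 (cc T) _ Pq _.
by split=> // g i x t; apply: ext_unit.
Qed.

Lemma rmapP S T U : cone_le T U -> bounded_bilinear (@rmap I S T U) /\
  forall (i : I) x t g, rmap (kb S T i x t) (tb U g) = c t g *: kb S U i x (t + g).
Proof.
move=> TU; have [|bl ext_unit] := bextP (K_seq I S T) (tg_seq U)
  (g := fun p g => c p.2.2 g *: kb S U p.1 p.2.1 (p.2.2 + g)) (K_complete I S U).
  apply: (bounded_on_basisP (K_seq I S U)).
  move=> chi [h0 [chi' [psi [[h0' [phi1 [psi1 [Pp1 Pq1 h']]]] Pq h]]]].
  have [psi2 Pq2 h2] := gc_mul (tg_good U) (TU _ Pq1) Pq.
  exists (kweight phi1 psi2); first exact: tconeK_prod.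
  move=> [[i [x t]] g] /=; apply: nle_kb => //.
  rewrite addrAC; apply: le_trans (h _ _) _.
  apply: le_trans (ler_wpM2r _ (h' i x t)) _; first exact: cone_ge0 (cc U) _ Pq _.
  by rewrite -mulrA; apply: ler_wpM2l (h2 _ _); exact: cone_ge0 (cc S) _ Pp1 _.
by split=> // i x t g; apply: ext_unit.
Qed.

End Actions.

Lemma tb_eq S (Y : bornSpace R) (f g : S -> Y) : complete_bornology Y ->
  blin f -> blin g -> (forall x, f (tb S x) = g (tb S x)) -> f =1 g.
Proof. exact: blin_eq (tg_seq S) Y f g. Qed.

Lemma kb_eq (I : countType) S T (Y : bornSpace R) (f g : K I S T -> Y) : complete_bornology Y ->
  blin f -> blin g -> (forall (i : I) x t, f (kb S T i x t) = g (kb S T i x t)) -> f =1 g.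
Proof. by move=> cY bf bg h; apply: (blin_eq (K_seq I S T) cY) => // -[i [x t]]; apply: h. Qed.

Lemma tb_mul S x y : amul (tb S x) (tb S y) = c x y *: tb S (x + y).
Proof. exact: tg_mul. Qed.

Lemma tb_one S : aone S = tb S 0.
Proof. exact: tg_one. Qed.

Ltac complete := first [exact: tg_complete | exact: K_complete | assumption].

Ltac bilinear := first [assumption | exact: tg_bil |
  exact: (lmapP _ _ (@cone_le_refl _)).1 | exact: (rmapP _ _ (@cone_le_refl _)).1 |
  by apply: (lmapP _ _ _).1 | by apply: (rmapP _ _ _).1 ].

Ltac blin := first [exact: blin_id | assumption
  | apply: bilinear_blin; [complete | complete | bilinear]
  | apply: blin_l; [complete | complete | bilinear | blin]
  | apply: blin_r; [complete | complete | bilinear | blin]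
  | apply: blin_comp; [assumption | blin]].

Lemma tg_algebra S : bornological_algebra S.
Proof.
split; [exact: tg_complete|exact: tg_bil| |split].
- move=> u v w.
  apply: (tb_eq (f := fun u => amul u (amul v w)) (g := fun u => amul (amul u v) w));
    [complete|blin|blin|move=> x].
  apply: (tb_eq (f := fun v => amul _ (amul v w)) (g := fun v => amul (amul _ v) w));
    [complete|blin|blin|move=> y].
  apply: (tb_eq (f := fun w => amul _ (amul _ w)) (g := fun w => amul (amul _ _) w));
    [complete|blin|blin|move=> z].
  rewrite !tb_mul (bilZl (tg_bil S)) (bilZr (tg_bil S)) !tb_mul !scalerA addrA.
  by rewrite c_cocycle [c x _ * _]mulrC.
- move=> u; apply: (tb_eq (f := fun u => amul _ u)); [complete|blin|blin|move=> x].
  by rewrite tb_one tb_mul c0l add0r scale1r.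
- move=> u; apply: (tb_eq (f := fun u => amul u _)); [complete|blin|blin|move=> x].
  by rewrite tb_one tb_mul c0r addr0 scale1r.
Qed.


Section Laws.
Variable I : countType.

Lemma lmap_mul U S T (SU : cone_le S U) (a a' : U) (m : K I S T) :
  lmap (amul a a') m = lmap a (lmap a' m).
Proof.
have [b1 e1] := @lmapP I U S T SU; have [b2 e2] := @lmapP I U U T (@cone_le_refl U).
apply: (tb_eq (f := fun a => lmap (amul a a') m) (g := fun a => lmap a (lmap a' m)));
  [complete|blin|blin|move=> x].
apply: (tb_eq (f := fun a' => lmap (amul _ a') m) (g := fun a' => lmap _ (lmap a' m)));
  [complete|blin|blin|move=> y].
apply: (kb_eq (f := fun m => lmap _ m) (g := fun m => lmap _ (lmap _ m)));
  [complete|blin|blin|move=> i z t].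
rewrite tb_mul (bilZl b1) !e1 (bilZr b2) e2 !scalerA !addrA.
by rewrite c_cocycle [c x _ * _]mulrC.
Qed.

Lemma rmap_mul S T U (TU : cone_le T U) (m : K I S T) (a a' : U) :
  rmap m (amul a a') = rmap (rmap m a) a'.
Proof.
have [b1 e1] := @rmapP I S T U TU; have [b2 e2] := @rmapP I S U U (@cone_le_refl U).
apply: (tb_eq (f := fun a => rmap m (amul a a')) (g := fun a => rmap (rmap m a) a'));
  [complete|blin|blin|move=> x].
apply: (tb_eq (f := fun a' => rmap m (amul _ a')) (g := fun a' => rmap (rmap m _) a'));
  [complete|blin|blin|move=> y].
apply: (kb_eq (f := fun m => rmap m _) (g := fun m => rmap (rmap m _) _));
  [complete|blin|blin|move=> i z t].
rewrite tb_mul (bilZr b1) !e1 (bilZl b2) e2 !scalerA !addrA.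
by rewrite c_cocycle [c x _ * _]mulrC.
Qed.

Lemma lmap_rmap U S T W (SU : cone_le S U) (TW : cone_le T W)
    (a : U) (m : K I S T) (b : W) :
  rmap (lmap a m) b = lmap a (rmap m b).
Proof.
have [b1 e1] := @lmapP I U S T SU; have [b2 e2] := @rmapP I U T W TW.
have [b3 e3] := @rmapP I S T W TW; have [b4 e4] := @lmapP I U S W SU.
apply: (tb_eq (f := fun a => rmap (lmap a m) b) (g := fun a => lmap a (rmap m b)));
  [complete|blin|blin|move=> x].
apply: (tb_eq (f := fun b => rmap (lmap _ m) b) (g := fun b => lmap _ (rmap m b)));
  [complete|blin|blin|move=> y].
apply: (kb_eq (f := fun m => rmap (lmap _ m) _) (g := fun m => lmap _ (rmap m _)));
  [complete|blin|blin|move=> i z t].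
rewrite e1 e3 (bilZl b2) (bilZr b4) e2 e4 !scalerA addrA.
by rewrite c_cocycle [c t y * _]mulrC.
Qed.

Lemma lmap1 S T (m : K I S T) : lmap (aone S) m = m.
Proof.
have [b1 e1] := @lmapP I S S T (@cone_le_refl S).
apply: (kb_eq (f := fun m => lmap _ m)); [complete|blin|blin|move=> i x t].
by rewrite tb_one e1 c0l !add0r scale1r.
Qed.

Lemma rmap1 S T (m : K I S T) : rmap m (aone T) = m.
Proof.
have [b1 e1] := @rmapP I S T T (@cone_le_refl T).
apply: (kb_eq (f := fun m => rmap m _)); [complete|blin|blin|move=> i x t].
by rewrite tb_one e1 c0r !addr0 scale1r.
Qed.

Definition Kbim S T : bornBimod S T :=
  @BornBimod R S T (K I S T) (@lmap I S S T) (@rmap I S T T).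

Lemma Kbim_bimodule S T : bornological_bimodule (Kbim S T).
Proof.
have [b1 _] := @lmapP I S S T (@cone_le_refl S).
have [b2 _] := @rmapP I S T T (@cone_le_refl T).
split; [complete| | |].
- by split=> // [m|a a' m]; [apply: lmap1|apply: lmap_mul].
- by split=> // [m|m b b']; [apply: rmap1|apply: rmap_mul].
- by move=> a m b; apply: lmap_rmap.
Qed.

End Laws.

Lemma alg_bimodule S : bornological_bimodule (alg_bimod S).
Proof.
have [cS bS aS [l1 r1]] := tg_algebra S.
by split=> //=; split.
Qed.


(** * The Koszul complex and its contraction *)

Section Complex.

Definition dbasis n S T (p : cell n.+1 * (Z2 * Z2)) : K (cell n) S T :=
  bd (fun j y => kb S T j y p.2.2) p.1 p.2.1.

Definition sbasis n S T (p : cell n * (Z2 * Z2)) : K (cell n.+1) S T :=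
  hm (fun j y => kb S T j y p.2.2) p.1 p.2.1.

Definition dmap n S T : {linear K (cell n.+1) S T -> K (cell n) S T} :=
  lext (@Kco (cell n.+1) S T) (@dbasis n S T).

(** Linear but not a bimodule map, as combing towards 0 is not translation invariant; a resolution
    asks for no more. *)
Definition smap n S : {linear K (cell n) S S -> K (cell n.+1) S S} :=
  lext (@Kco (cell n) S S) (@sbasis n S S).

(** The multiplication map, in which the normalisation of [kb] cancels the cocycle. Keeping the
    three algebras apart allows comparison before and after each base change. *)
Definition emap U S T : {linear K (cell 0) S T -> U} :=
  lext (@Kco (cell 0) S T) (fun p => tb U p.2.2).

Definition sectmap S : {linear S -> K (cell 0) S S} :=
  lext (@tg_co _ _ S) (fun t => kb S S (tt : cell 0) 0 t).

Section NleBound.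
Variables (I : countType) (S T : tga) (w : I * (Z2 * Z2) -> R).
Hypothesis w0 : forall p, 0 <= w p.
Let B (M : R) (u : K I S T) := nle w M (Kco u).

Let B0 : B 0 0.
Proof.
rewrite /B (_ : Kco 0 = fun=> 0); first exact: nle0.
by apply/funext => p; rewrite (co0 (K_seq I S T)).
Qed.

Let BD M M' u v : B M u -> B M' v -> B (M + M') (u + v).
Proof. by move=> hu hv; apply: nleD hu hv _ => // p; rewrite (coD (K_seq I S T)). Qed.

Let BN M u : B M u -> B M (- u).
Proof.
move=> hu; rewrite /B -[M]mul1r -(normc1 R) -normcN.
by apply: nleZ hu _ => // p; rewrite -scaleN1r (coZ (K_seq I S T)).
Qed.

Let BL M M' u : M <= M' -> B M u -> B M' u.
Proof. exact: nle_le. Qed.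

Lemma nle_bd M n (F : cell n -> Z2 -> K I S T) i x : 0 <= M ->
  (forall j e, (ell e <= 1)%N -> nle w M (Kco (F j (x + e)))) ->
  nle w (4 * M) (Kco (bd F i x)).
Proof. exact: (bd_bound B0 BD BN BL). Qed.

Lemma nle_hm M n (F : cell n.+1 -> Z2 -> K I S T) i x : 0 <= M ->
  (forall j z, (ell z + ell (x - z) <= ell x)%N -> nle w M (Kco (F j z))) ->
  nle w ((ell x)%:R * M) (Kco (hm F i x)).
Proof. exact: (hm_bound B0 BD BN BL). Qed.

End NleBound.

Lemma dmapP n S T : bounded_map (dmap n S T) /\
  forall i x t, dmap n S T (kb S T i x t) = bd (fun j y => kb S T j y t) i x.
Proof.
have cS := cc S; have cT := cc T.
have [|b e] := lextP (K_seq (cell n.+1) S T) (K_complete (cell n) S T) (g := @dbasis n S T).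
  apply: (bounded_on_basisP (K_seq (cell n) S T)).
  move=> chi [h0 [phi [psi [Pp Pq h]]]].
  (* Multiplying by the indicator of the unit ball gives [phi x <= phi' (x + e)] whenever
     [ell e <= 1], which pays for moving to a neighbouring cell. *)
  have [phi' Pp' hp] := gc_mul (tg_good S) Pp (gc_ball (tg_good S)).
  have [psi' Pq' hq] := gc_mul (tg_good T) Pq (gc_ball (tg_good T)).
  have Pw := @tconeK_prod (cell n) S T phi' psi' Pp' Pq'.
  have w0 := cone_ge0 (tconeK_cone _ _ _) Pw.
  exists (fun p => 4 * kweight phi' psi' p); first exact: coneZ (tconeK_cone _ _ _) _ _ _ Pw.
  move=> [i [x t]]; apply/nle_rescale => //.
  rewrite /dbasis (raddf_bd ( *:%R _)); apply: nle_bd => // j e' e1 /=.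
  apply: (nle_be (K_seq _ _ _)) => //.
  rewrite mul1r normcR ger0_norm// (le_trans (h i x t))// /kweight /=.
  apply: ler_pM; [exact: cone_ge0 cS _ Pp _|exact: cone_ge0 cT _ Pq _| |].
    by have := hp x e'; rewrite e1 mulr1.
  have eN : (ell (- e') <= 1)%N by move: e1; rewrite /ell /=; lia.
  by have := hq (t - x) (- e'); rewrite eN mulr1 opprD addrA.
by split=> // i x t; apply: e.
Qed.

(** Two steps: [gc_split] gives phi(x) (1 + l(x)) <= phi'(z) phi'(x - z), and [gc_mul] absorbs
    phi'(x - z) psi(t - x) into psi'(t - z). *)
Lemma smapP n S : bounded_map (smap n S) /\
  forall i x t, smap n S (kb S S i x t) = hm (fun j y => kb S S j y t) i x.
Proof.
have cS := cc S.
have [|b e] := lextP (K_seq (cell n) S S) (K_complete (cell n.+1) S S) (g := @sbasis n S S).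
  apply: (bounded_on_basisP (K_seq (cell n.+1) S S)).
  move=> chi [h0 [phi [psi [Pp Pq h]]]].
  have [phi' Pp' hp] := gc_split (tg_good S) Pp.
  have [psi' Pq' hq] := gc_mul (tg_good S) Pp' Pq.
  have Pw := @tconeK_prod (cell n.+1) S S phi' psi' Pp' Pq'.
  have w0 := cone_ge0 (tconeK_cone _ _ _) Pw.
  exists (kweight phi' psi') => //.
  move=> [i [x t]]; rewrite /sbasis (raddf_hm ( *:%R _)) /=.
  (* At most [ell x] summands, each of norm at most the inverse of [ell x + 1]. *)
  apply: (@nle_le _ _ _ ((ell x)%:R * ((ell x).+1%:R)^-1)).
    by rewrite ler_pdivrMr ?mul1r ?ler_nat// ltr0n.
  apply: nle_hm => // j z hz.
  apply: (nle_be (K_seq _ _ _)) => //.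
  rewrite normcR ger0_norm// ler_pdivlMl ?ltr0n// mulrC.
  apply: (@le_trans _ _ (phi x * psi (t - x) * (ell x).+1%:R)).
    by rewrite ler_wpM2r// h.
  rewrite mulrAC; apply: (@le_trans _ _ (phi' z * phi' (x - z) * psi (t - x))).
    by apply: ler_wpM2r; [exact: cone_ge0 cS _ Pq _|exact: hp].
  rewrite -mulrA; apply: ler_wpM2l; first exact: cone_ge0 cS _ Pp' _.
  have := hq (x - z) (t - x); rewrite /= (_ : x - z + (t - x) = t - z)//.
  by rewrite addrC addrA subrK.
by split=> // i x t; apply: e.
Qed.

Lemma emapP U S T : cone_le S U -> cone_le T U -> bounded_map (emap U S T) /\
  forall i x t, emap U S T (kb S T i x t) = tb U t.
Proof.
move=> SU TU.
have [|b e] := lextP (K_seq (cell 0) S T) (tg_complete U) (g := fun p => tb U p.2.2).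
  apply: (bounded_on_basisP (tg_seq U)).
  move=> chi [h0 [phi [psi [Pp Pq h]]]].
  have [phi' Pp' hp] := gc_mul (tg_good U) (SU _ Pp) (TU _ Pq).
  exists phi' => // -[i [x t]]; apply: (nle_be (tg_seq U)) => //.
  rewrite mul1r normcR ger0_norm// (le_trans (h i x t))//.
  by have := hp x (t - x); rewrite [x + _]addrC subrK.
by split=> // i x t; apply: e.
Qed.

Lemma sectmapP S : bounded_map (sectmap S) /\
  forall t, sectmap S (tb S t) = kb S S (tt : cell 0) 0 t.
Proof.
apply: (lextP (tg_seq S) (K_complete _ S S)).
apply: (bounded_on_basisP (K_seq _ S S)) => phi Pp.
exists (kweight (fun x => (x == 0)%:R) phi).
  by apply: tconeK_prod => //; apply: cone_delta (cc S) _.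
move=> t; apply: (nle_be (K_seq _ S S)) => //.
  by apply: tconeK_prod => //; apply: cone_delta (cc S) _.
by rewrite mul1r normcR ger0_norm ?(cone_ge0 (cc S) Pp)// /kweight /= subr0 mul1r.
Qed.

Lemma dmap_blin n S T : blin (dmap n S T).
Proof. by apply: blin_lin; have [] := dmapP n S T. Qed.

Lemma smap_blin n S : blin (smap n S).
Proof. by apply: blin_lin; have [] := smapP n S. Qed.

Lemma sectmap_blin S : blin (sectmap S).
Proof. by apply: blin_lin; have [] := sectmapP S. Qed.

Lemma emap_blin U S T : cone_le S U -> cone_le T U -> blin (emap U S T).
Proof. by move=> SU TU; apply: blin_lin; have [] := emapP SU TU. Qed.

Lemma dmap_lmap n U S T (SU : cone_le S U) (a : U) (m : K (cell n.+1) S T) :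
  dmap n U T (lmap a m) = lmap a (dmap n S T m).
Proof.
have [b1 e1] := @lmapP (cell n.+1) U S T SU; have [b2 e2] := @lmapP (cell n) U S T SU.
have [_ ed1] := dmapP n U T; have [_ ed2] := dmapP n S T.
have bd1 := dmap_blin n U T; have bd2 := dmap_blin n S T.
apply: (tb_eq (f := fun a => dmap n U T (lmap a m)) (g := fun a => lmap a (dmap n S T m)));
  [complete|blin|blin|move=> g].
apply: (kb_eq (f := fun m => dmap n U T (lmap _ m)) (g := fun m => lmap _ (dmap n S T m)));
  [complete|blin|blin|move=> i x t].
have bl : blin (@lmap (cell n) U S T (tb U g)) by blin.
have [L LE] := linear_exists bl.1.
rewrite e1 linearZ /= ed1 ed2 -LE (raddf_bd L).
transitivity (bd (fun j y => c g t *: kb U T j (g + y) (g + t)) i x); last first.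
  by apply: eq_bd => j y; rewrite [RHS]LE e2.
rewrite -[RHS](raddf_bd ( *:%R (c g t)) (fun j y => kb U T j (g + y) (g + t))).
by congr (_ *: _); apply: bd_shift.
Qed.

(** The right action leaves [x] fixed and only relabels the total degree, so no translation
    enters. *)
Lemma dmap_rmap n S T U (TU : cone_le T U) (m : K (cell n.+1) S T) (a : U) :
  dmap n S U (rmap m a) = rmap (dmap n S T m) a.
Proof.
have [b1 e1] := @rmapP (cell n.+1) S T U TU; have [b2 e2] := @rmapP (cell n) S T U TU.
have [_ ed1] := dmapP n S U; have [_ ed2] := dmapP n S T.
have bd1 := dmap_blin n S U; have bd2 := dmap_blin n S T.
apply: (tb_eq (f := fun a => dmap n S U (rmap m a)) (g := fun a => rmap (dmap n S T m) a));
  [complete|blin|blin|move=> g].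
apply: (kb_eq (f := fun m => dmap n S U (rmap m _)) (g := fun m => rmap (dmap n S T m) _));
  [complete|blin|blin|move=> i x t].
have bl : blin (fun m => @rmap (cell n) S T U m (tb U g)) by blin.
have [L LE] := linear_exists bl.1.
rewrite e1 linearZ /= ed1 ed2 -LE (raddf_bd L).
transitivity (bd (fun j y => c t g *: kb S U j y (t + g)) i x).
  exact: (raddf_bd ( *:%R (c t g)) (fun j y => kb S U j y (t + g))).
by apply: eq_bd => j y; rewrite [RHS]LE e2.
Qed.

Lemma emap_lmap U S T (SU : cone_le S U) (TU : cone_le T U) (a : U) (m : K (cell 0) S T) :
  emap U U T (lmap a m) = amul a (emap U S T m).
Proof.
have [b1 e1] := @lmapP (cell 0) U S T SU.
have [_ ed1] := emapP (@cone_le_refl U) TU; have [_ ed2] := emapP SU TU.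
have bd1 := emap_blin (@cone_le_refl U) TU; have bd2 := emap_blin SU TU.
apply: (tb_eq (f := fun a => emap U U T (lmap a m)) (g := fun a => amul a _));
  [complete|blin|blin|move=> g].
apply: (kb_eq (f := fun m => emap U U T (lmap _ m)) (g := fun m => amul _ (emap U S T m)));
  [complete|blin|blin|move=> i x t].
by rewrite e1 linearZ /= ed1 ed2 tb_mul.
Qed.

Lemma emap_rmap S T U (SU : cone_le S U) (TU : cone_le T U) (m : K (cell 0) S T) (a : U) :
  emap U S U (rmap m a) = amul (emap U S T m) a.
Proof.
have [b1 e1] := @rmapP (cell 0) S T U TU.
have [_ ed1] := emapP SU (@cone_le_refl U); have [_ ed2] := emapP SU TU.
have bd1 := emap_blin SU (@cone_le_refl U); have bd2 := emap_blin SU TU.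
apply: (tb_eq (f := fun a => emap U S U (rmap m a)) (g := fun a => amul _ a));
  [complete|blin|blin|move=> g].
apply: (kb_eq (f := fun m => emap U S U (rmap m _)) (g := fun m => amul (emap U S T m) _));
  [complete|blin|blin|move=> i x t].
by rewrite e1 linearZ /= ed1 ed2 tb_mul.
Qed.

(** Proved for an arbitrary twisted algebra, so it serves both for A and for the complex over B. *)
Lemma koszul_resolution S :
  @resolution R S S (fun n => Kbim (cell n) S S) (alg_bimod S)
    (fun n => dmap n S S) (emap S S S).
Proof.
have le := @cone_le_refl S.
have [bounded_e ee] := emapP le le; have [bs es] := sectmapP S.
split.
- by split=> [|n]; [exact: alg_bimodule|exact: Kbim_bimodule].
- split; first by split=> // [a m|m a]; [exact: emap_lmap|exact: emap_rmap].
  move=> n; split=> [|a m|m a]; [by have [] := dmapP n S S|exact: dmap_lmap|exact: dmap_rmap].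
- split.
    move=> u; apply: (kb_eq (f := fun u => emap S S S (dmap 0 S S u)) (g := fun=> 0)).
    + complete.
    + by apply: blin_comp; [exact: emap_blin|exact: dmap_blin].
    + by apply: blin0; complete.
    move=> i x t; have [_ ->] := dmapP 0 S S.
    (* [emap] forgets [x], so both ends of an edge receive the same vector [tb S t]. *)
    have := raddf_bd (emap S S S) (fun j y => kb S S j y t) i x.
    by move=> ->; rewrite (eq_bd (G := fun _ _ => tb S t)) /= ?subrr.
  move=> n u; apply: (kb_eq (f := fun u => dmap n S S (dmap n.+1 S S u)) (g := fun=> 0)).
  + complete.
  + by apply: blin_comp; exact: dmap_blin.
  + by apply: blin0; complete.
  move=> i x t; have [_ ->] := dmapP n.+1 S S.
  rewrite (raddf_bd (dmap n S S)); under eq_bd do rewrite /= (dmapP n S S).2.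
  exact: bd_bd.
exists (sectmap S), (fun n => smap n S); split.
- by split=> // n; have [] := smapP n S.
- apply: (tb_eq (f := fun u => emap S S S (sectmap S u))); [complete| |exact: blin_id|].
    by apply: blin_comp; [exact: emap_blin|exact: sectmap_blin].
  by move=> x; rewrite es ee.
- apply: (kb_eq (f := fun u => dmap 0 S S (smap 0 S u) + sectmap S (emap S S S u)));
    [complete| |exact: blin_id|].
    apply: blinD; first complete.
      by apply: blin_comp; [exact: dmap_blin|exact: smap_blin].
    by apply: blin_comp; [exact: sectmap_blin|exact: emap_blin].
  move=> i x t; rewrite ee es (smapP 0 S).2 (raddf_hm (dmap 0 S S)).
  under eq_hm do rewrite /= (dmapP 0 S S).2.
  by case: i; rewrite (hm_bd0 (fun j y => kb S S j y t)).
- move=> n; apply: (kb_eq (f := fun u => dmap n.+1 S S (smap n.+1 S u) + smap n S (dmap n S S u)));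
    [complete| |exact: blin_id|].
    apply: blinD; first complete.
      by apply: blin_comp; [exact: dmap_blin|exact: smap_blin].
    by apply: blin_comp; [exact: smap_blin|exact: dmap_blin].
  move=> i x t; rewrite (smapP n.+1 S).2 (raddf_hm (dmap n.+1 S S)).
  under eq_hm do rewrite /= (dmapP n.+1 S S).2.
  rewrite (dmapP n S S).2 (raddf_bd (smap n S)).
  under [X in _ + X]eq_bd do rewrite /= (smapP n S).2.
  exact: (hm_bd (fun j y => kb S S j y t)).
Qed.

End Complex.


Lemma c_frac (w x y z : C) : x != 0 -> z != 0 -> w * x = y * z -> y / x = z^-1 * w.
Proof. by move=> x0 z0 h; apply: (mulIf x0); rewrite divfK// -mulrA h mulrCA mulVf// mulr1. Qed.

Lemma c_neq0 x y : c x y != 0.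
Proof.
by apply/eqP => z; have := c_norm x y; rewrite z normc0 => /esym/eqP; rewrite oner_eq0.
Qed.

(** * Free bimodules and base change *)

Section Projective.
Variables (I : countType) (A : tga).
Hypothesis finI : finite_set [set: I].
Hypothesis finA : forall phi, tg_cone A phi -> finite_set [set x | phi x != 0].

Lemma born_finite (V : bornSpace R) (D : set V) : complete_bornology V ->
  finite_set D -> bornology D.
Proof.
move=> cV /finite_seqP[s ->]; elim: s => [|x s IH].
  by apply: (born_sub cV (born1 cV 0)) => x.
apply: (born_sub cV (bornU cV (born1 cV x) IH)) => y /=.
by rewrite inE => /orP[/eqP->|]; [left|right].
Qed.

(** In the coordinates x and t - x the support is contained in a product of finite sets. *)
Lemma tconeK_finite chi : tconeK I A A chi -> finite_set [set p | chi p != 0].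
Proof.
move=> [h0 [phi [psi [Pp Pq h]]]].
apply: (@sub_finite_set _ _ ((fun q : I * (Z2 * Z2) => (q.1, (q.2.1, q.2.2 + q.2.1))) @`
  ([set: I] `*` ([set x | phi x != 0] `*` [set x | psi x != 0])))).
  move=> [i [x t]] /= cn; exists (i, (x, t - x)) => /=; last by rewrite subrK.
  have := h i x t; have := h0 (i, (x, t)).
  move: cn; case: eqVneq => // cn _ c0 cle; split=> //.
  have cp : 0 < phi x * psi (t - x) by apply: lt_le_trans cle; rewrite lt_neqAle eq_sym cn.
  by split; apply/eqP => z; move: cp; rewrite z (mul0r, mulr0) ltxx.
apply: finite_image; apply: finite_setX => //.
by apply: finite_setX; apply: finA.
Qed.

(** The generators 1 (x) i (x) 1 are lifted through the linear section and the lift is extended by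
    the two actions, with the inverse cocycle of the normalisation of [kb]. *)
Lemma Kbim_projective : projective (Kbim I A A).
Proof.
move=> N E Q ii p [[_ mE mQ] [_ [bp pl pr]] _ [s bs sK]] g [bg gl gr].
have [cE [bl l1 lM] [br r1 rM] lr] := mE; have [cQ [blQ _ _] [brQ _ _] _] := mQ.
have le := @cone_le_refl A.
have [bL eL] := @lmapP I A A A le; have [bR eR] := @rmapP I A A A le.
pose e i : E := s (g (kb A A i 0 0)).
pose k (q : I * (Z2 * Z2)) : E := (c q.2.1 (q.2.2 - q.2.1))^-1 *:
  lact (tb A q.2.1) (ract (e q.1) (tb A (q.2.2 - q.2.1))).
(* Only finitely many scaled images are nonzero, and finite sets are bounded in any complete
   bornology. *)
have bk : bounded_on_basis (tconeK I A A) k.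
  move=> chi /tconeK_finite fin.
  have b := bornU cE (born1 cE 0)
    (born_finite cE (finite_image (fun q => (chi q)%:C%C *: k q) fin)).
  apply: (born_sub cE b) => _ [q _ <-]; have [z|z] := eqVneq (chi q) 0.
    by left; rewrite z scale0r.
  by right; exists q.
have [h [bh hE]] := lext_exists (K_seq I A A) cE bk.
have {}hE i x t : h (kb A A i x t) = (c x (t - x))^-1 *:
  lact (tb A x) (ract (e i) (tb A (t - x))) by apply: hE.
have blh : blin h := blin_lin bh.
exists (h : {linear Kbim I A A -> E}); last first.
  apply: (kb_eq (f := fun u => p (h u)) (g := g)) => //.
  - by apply: blin_comp => //; apply: blin_lin.
  - exact: blin_lin.
  move=> i x t; rewrite hE linearZ /= pl pr /e sK.
  have -> : kb A A i x t = (c x (t - x))^-1 *: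
      lmap (tb A x) (rmap (kb A A i 0 0) (tb A (t - x))).
    rewrite eR c0l scale1r !add0r eL scalerA addr0 [x + _]addrC subrK.
    by rewrite mulVf ?c_neq0// scale1r.
  by rewrite linearZ /= -gr -gl.
split=> [//|a m|m a].
- apply: (tb_eq (f := fun a => h (lmap a m)) (g := fun a => lact a (h m))) => //.
  + by apply: blin_comp => //; blin.
  + apply: (blin_l _ cE cE bl (blin_id _)).
  move=> y; apply: (kb_eq (f := fun m => h (lmap _ m)) (g := fun m => lact _ (h m))) => //.
  + by apply: blin_comp => //; blin.
  + by apply: (blin_r _ (tg_complete A) cE bl blh).
  move=> i x t; rewrite eL linearZ /=.
  apply: etrans (congr1 ( *:%R (c y t)) (hE i (y + x) (y + t))) _.
  rewrite hE (bilZr bl) -lM tb_mul (bilZl bl) !scalerA.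
  rewrite opprD addrACA subrr add0r; congr (_ *: _).
  apply: c_frac; [exact: c_neq0|exact: c_neq0|].
  by have := c_cocycle y x (t - x); rewrite [x + (t - x)]addrC subrK.
- apply: (tb_eq (f := fun a => h (rmap m a)) (g := fun a => ract (h m) a)) => //.
  + by apply: blin_comp => //; blin.
  + exact: (bilinear_blin _ cE cE br).
  move=> y; apply: (kb_eq (f := fun m => h (rmap m _)) (g := fun m => ract (h m) _)) => //.
  + by apply: blin_comp => //; blin.
  + exact: (blin_l _ (tg_complete A) cE br blh).
  move=> i x t; rewrite eR linearZ /=.
  apply: etrans (congr1 ( *:%R (c t y)) (hE i x (t + y))) _.
  rewrite hE (bilZl br) lr -rM tb_mul (bilZr br) (bilZr bl) !scalerA.
  rewrite addrAC; congr (_ *: _); apply: c_frac; [exact: c_neq0|exact: c_neq0|].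
  have := c_cocycle x (t - x) y; rewrite [x + (t - x)]addrC subrK => cy.
  by rewrite mulrC -cy mulrC.
Qed.

End Projective.


Section BaseChange.
Variables (A B : tga) (f : A -> B).
Hypotheses (AB : cone_le A B) (bf : blin f) (fE : forall x, f (tb A x) = tb B x).

(** Balancedness over A: the relations defining the tensor product are killed. *)
Lemma lmap_hom I T (b : B) (a : A) (n : K I A T) :
  lmap (amul b (f a)) n = lmap b (lmap a n).
Proof.
have [b1 e1] := @lmapP I B A T AB; have [b2 e2] := @lmapP I A A T (@cone_le_refl A).
apply: (tb_eq (f := fun b => lmap (amul b (f a)) n) (g := fun b => lmap b (lmap a n)));
  [complete|blin|blin|move=> x].
apply: (tb_eq (f := fun a => lmap (amul _ (f a)) n) (g := fun a => lmap _ (lmap a n)));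
  [complete|blin|blin|move=> y].
apply: (kb_eq (f := fun m => lmap _ m) (g := fun m => lmap _ (lmap _ m)));
  [complete|blin|blin|move=> i z t].
rewrite fE tb_mul (bilZl b1) e2 (bilZr b1) !e1 !scalerA !addrA.
by rewrite c_cocycle [c x _ * _]mulrC.
Qed.

Lemma rmap_hom I S (m : K I S A) (a : A) (b : B) :
  rmap (rmap m a) b = rmap m (amul (f a) b).
Proof.
have [b1 e1] := @rmapP I S A B AB; have [b2 e2] := @rmapP I S A A (@cone_le_refl A).
apply: (tb_eq (f := fun a => rmap (rmap m a) b) (g := fun a => rmap m (amul (f a) b)));
  [complete|blin|blin|move=> x].
apply: (tb_eq (f := fun b => rmap (rmap m _) b) (g := fun b => rmap m (amul _ b)));
  [complete|blin|blin|move=> y].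
apply: (kb_eq (f := fun m => rmap (rmap m _) _) (g := fun m => rmap m _));
  [complete|blin|blin|move=> i z t].
rewrite fE tb_mul (bilZr b1) e2 (bilZl b1).
apply: etrans (congr1 ( *:%R _) (e1 i z (t + x) y)) _; rewrite e1 !scalerA !addrA.
by rewrite c_cocycle [c x _ * _]mulrC.
Qed.

Lemma relation_eq (V : lmodType C) (u v : V) (r w e : C) : e != 0 -> r = e^-1 * w ->
  u - r *: v = - e^-1 *: (w *: v - e *: u).
Proof.
by move=> e0 ->; rewrite scaleNr scalerBr !scalerA mulVf// scale1r opprB.
Qed.

Lemma normc_cV x y : normc (c x y)^-1 = 1.
Proof. by rewrite normcV c_norm invr1. Qed.

(** The section moves the left coefficient into B, lifting U^x (x) i (x) U^(t - x) to U^x (x) (1 (x)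
    i (x) U^(t - x)). On a basis vector it differs from the identity by a multiple of a single
    relation. *)
Lemma lmap_tensor I T :
  @is_tensor R B A T (left_bimod f) (Kbim I A T) (Kbim I B T) (@lmap I B A T).
Proof.
have [b1 e1] := @lmapP I B A T AB; have [b2 e2] := @lmapP I A A T (@cone_le_refl A).
split; last 1 first.
- by move=> m n d; apply: lmap_rmap.
- pose X := tspace (tg_seq B) (K_seq I A T).
  pose tau0 : B -> K I A T -> X := tensor (tg_seq B) (K_seq I A T).
  have tX := tspaceP (tg_seq B) (K_seq I A T).
  set tco : X -> _ := kco (HP := _) in tX.
  have ct : is_ctensor tau0 := tensor_ctensor _ _.
  have tbe g i x t : tau0 (tb B g) (kb A T i x t) = unit_vec tco (g, (i, (x, t))).
    exact: tensor_be.
  have [cX bt /(_ _ (K_complete I B T) _ b1)[q [bq qE _]]] := ct.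
  have [|s [bs sE]] := lext_exists (K_seq I B T) cX
    (g := fun p => (c p.2.1 (p.2.2 - p.2.1))^-1 *: unit_vec tco (p.2.1, (p.1, (0, p.2.2 - p.2.1)))).
    apply: (bounded_on_basisP tX) => chi [h0 [phi [psi [Pp Pq h]]]].
    (* The left coefficient remaining in A is 1, so a weight concentrated at 0 suffices there. *)
    have Pd := cone_delta (cc A) 0.
    have Pw := tens_prod (tg_seq B) (K_seq I A T) Pp (@tconeK_prod I A T _ _ Pd Pq).
    exists (fun p => phi p.1 * kweight (fun x => (x == 0)%:R) psi p.2) => //.
    move=> [i [x t]]; rewrite scalerA; apply: (nle_be tX) => //.
    rewrite mul1r normcM normc_cV mulr1 normcR ger0_norm//.
    apply: le_trans (h i x t) _.
    by rewrite /kweight /= subr0 mul1r.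
  have {}sE i x t y : t - x = y -> s (kb B T i x t) =
      (c x y)^-1 *: tau0 (tb B x) (kb A T i 0 y) by move=> <-; rewrite tbe; apply: sE.
  exists X, tau0, q; split=> //.
  apply: (quotient_by_closure tX (K_complete I B T) (s := s)) => //.
  + apply: (kb_eq (f := fun y => q (s y))); [complete| |exact: blin_id|].
      by apply: blin_comp; exact: blin_lin.
    move=> i x t; rewrite (sE _ _ _ _ erefl) linearZ /= qE e1 scalerA mulVf ?c_neq0// scale1r.
    by rewrite addr0 addrC subrK.
  + move=> _ [m [a [n ->]]]; rewrite linearB !qE; apply/eqP; rewrite subr_eq0; apply/eqP.
    exact: lmap_hom.
  + move=> [g [i [x t]]]; rewrite -tbe qE e1 linearZ /=.
    have -> : tau0 (tb B g) (kb A T i x t) - c g t *: s (kb B T i (g + x) (g + t)) =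
      - (c x (t - x))^-1 *: (tau0 (amul (tb B g) (f (tb A x))) (kb A T i 0 (t - x))
         - tau0 (tb B g) (lmap (tb A x) (kb A T i 0 (t - x)))).
      have d : g + t - (g + x) = t - x by rewrite opprD addrACA subrr add0r.
      rewrite (sE _ _ _ _ d) scalerA.
      have r : c g t / c (g + x) (t - x) = (c x (t - x))^-1 * c g x.
        apply: c_frac; [exact: c_neq0|exact: c_neq0|].
        by have := c_cocycle g x (t - x); rewrite [x + (t - x)]addrC subrK.
      apply: etrans (relation_eq _ _ (c_neq0 _ _) r) _.
      congr (_ *: (_ - _)); first by rewrite fE tb_mul (bilZl bt).
      by rewrite e2 (bilZr bt) addr0 [x + (t - x)]addrC subrK.
    by apply: lspanZ; apply: lspan_id; exists (tb B g), (tb A x), (kb A T i 0 (t - x)).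
- exact: Kbim_bimodule.
- by move=> b m n; rewrite /= lmap_mul.
Qed.

(** The mirror image: the right coefficient moves into B, leaving total degree [x] in the factor
    over A. *)
Lemma rmap_tensor I S :
  @is_tensor R S A B (Kbim I S A) (right_bimod f) (Kbim I S B) (@rmap I S A B).
Proof.
have [b1 e1] := @rmapP I S A B AB; have [b2 e2] := @rmapP I S A A (@cone_le_refl A).
split; last 1 first.
- by move=> m n d; rewrite /= rmap_mul.
- pose X := tspace (K_seq I S A) (tg_seq B).
  pose tau0 : K I S A -> B -> X := tensor (K_seq I S A) (tg_seq B).
  have tX := tspaceP (K_seq I S A) (tg_seq B).
  set tco : X -> _ := kco (HP := _) in tX.
  have ct : is_ctensor tau0 := tensor_ctensor _ _.
  have tbe g i x t : tau0 (kb S A i x t) (tb B g) = unit_vec tco ((i, (x, t)), g).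
    exact: tensor_be.
  have [cX bt /(_ _ (K_complete I S B) _ b1)[q [bq qE _]]] := ct.
  have [|s [bs sE]] := lext_exists (K_seq I S B) cX
    (g := fun p => (c p.2.1 (p.2.2 - p.2.1))^-1 *: unit_vec tco ((p.1, (p.2.1, p.2.1)), p.2.2 - p.2.1)).
    apply: (bounded_on_basisP tX) => chi [h0 [phi [psi [Pp Pq h]]]].
    have Pd := cone_delta (cc A) 0.
    have Pw := tens_prod (K_seq I S A) (tg_seq B) (@tconeK_prod I S A _ _ Pp Pd) Pq.
    exists (fun p => kweight phi (fun x => (x == 0)%:R) p.1 * psi p.2) => //.
    move=> [i [x t]]; rewrite scalerA; apply: (nle_be tX) => //.
    rewrite mul1r normcM normc_cV mulr1 normcR ger0_norm//.
    apply: le_trans (h i x t) _.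
    by rewrite /kweight /= subrr mulr1.
  have {}sE i x t y : t - x = y -> s (kb S B i x t) =
      (c x y)^-1 *: tau0 (kb S A i x x) (tb B y) by move=> <-; rewrite tbe; apply: sE.
  exists X, tau0, q; split=> //.
  apply: (quotient_by_closure tX (K_complete I S B) (s := s)) => //.
  + apply: (kb_eq (f := fun y => q (s y))); [complete| |exact: blin_id|].
      by apply: blin_comp; exact: blin_lin.
    move=> i x t; rewrite (sE _ _ _ _ erefl) linearZ /= qE e1 scalerA mulVf ?c_neq0// scale1r.
    by rewrite addrC subrK.
  + move=> _ [m [a [n ->]]]; rewrite linearB !qE; apply/eqP; rewrite subr_eq0; apply/eqP.
    exact: rmap_hom.
  + move=> [[i [x t]] g]; rewrite -tbe qE e1 linearZ /=.
    have -> : tau0 (kb S A i x t) (tb B g) - c t g *: s (kb S B i x (t + g)) =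
      - (c x (t - x))^-1 *: (tau0 (kb S A i x x) (amul (f (tb A (t - x))) (tb B g))
         - tau0 (rmap (kb S A i x x) (tb A (t - x))) (tb B g)).
      have d : t + g - x = t - x + g by rewrite addrAC.
      rewrite (sE _ _ _ _ d) scalerA.
      have r : c t g / c x (t - x + g) = (c x (t - x))^-1 * c (t - x) g.
        apply: c_frac; [exact: c_neq0|exact: c_neq0|].
        have := c_cocycle x (t - x) g; rewrite [x + (t - x)]addrC subrK => cy.
        by rewrite mulrC -cy mulrC.
      apply: etrans (relation_eq _ _ (c_neq0 _ _) r) _.
      congr (_ *: (_ - _)); first by rewrite fE tb_mul (bilZr bt).
      by rewrite e2 (bilZl bt) [x + (t - x)]addrC subrK.
    (* Moving a coefficient to the right produces the relation with the opposite sign. *)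
    apply: lspanZ; rewrite -[X in lspan _ X]opprB -scaleN1r.
    by apply: lspanZ; apply: lspan_id; exists (kb S A i x x), (tb A (t - x)), (tb B g).
- exact: Kbim_bimodule.
- by move=> b m n; rewrite /= lmap_rmap.
Qed.

Hypothesis finA : forall phi, tg_cone A phi -> finite_set [set x | phi x != 0].

Lemma cell_finite n : finite_set [set: cell n].
Proof. by case: n => [|[|[|n]]]; apply: finite_finset. Qed.

(** After both base changes the differential is given by the same formula on basis vectors, so the
    complex is the Koszul complex of B and its contraction comes from [koszul_resolution]. *)
Lemma twisted_isocohomological : isocohomological f.
Proof.
have leA := @cone_le_refl A; have leB := @cone_le_refl B.
split; [exact: tg_algebra|exact: tg_algebra| |].
  have [lf bdf] := bf; split=> // [u v|].
    apply: (bilinear_eq (tg_seq A) (tg_seq A) (tg_complete B)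
      (b := fun u v => f (amul u v)) (b' := fun u v => amul (f u) (f v))).
    - by apply: bilinear_comp => //; apply: tg_bil.
    - have [h1 h2 h3] := tg_bil B; split=> [w k x y|w k x y|D D' bD bD'].
      + by rewrite lf h1.
      + by rewrite lf h2.
      + have := h3 _ _ (bdf _ bD) (bdf _ bD'); congr bornology; apply/seteqP; split=> z /=.
          by move=> [_ [x Dx <-] [_ [y Dy <-] <-]]; exists x => //; exists y.
        by move=> [x Dx [y Dy <-]]; exists (f x); [exists x|exists (f y) => //; exists y].
    - move=> x y; rewrite -[unit_vec _ x]/(tb A x) -[unit_vec _ y]/(tb A y) tb_mul !fE tb_mul.
      by rewrite (linear_scale lf) fE.
  by rewrite !tb_one fE.
exists (fun n => Kbim (cell n) A A), (fun n => dmap n A A), (emap A A A); split.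
- exact: koszul_resolution.
- by move=> n; apply: Kbim_projective => //; apply: cell_finite.
exists (fun n => Kbim (cell n) B A), (fun n => Kbim (cell n) B B),
  (fun n => @lmap (cell n) B A A), (fun n => @rmap (cell n) B A B),
  (fun n => dmap n B B), (emap B B B); split.
- by move=> n; split; [exact: lmap_tensor|exact: rmap_tensor].
- by move=> n b x b'; rewrite dmap_rmap// dmap_lmap.
- move=> b x b'; rewrite emap_rmap// emap_lmap//; congr (amul (amul _ _) _).
  apply: (kb_eq (f := emap B A A) (g := fun x => f (emap A A A x))); [complete| | |].
  + exact: emap_blin.
  + by apply: blin_comp => //; apply: emap_blin.
  move=> i y t; rewrite (emapP AB AB).2 -fE; congr f; exact: esym ((emapP leA leA).2 i y t).
- exact: koszul_resolution.
Qed.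

End BaseChange.

End Twisted.

(** * Weights *)

Section Weights.
Variables (R : realType) (J K : Type) (om : J -> K -> nat -> R).

(** The index [j] stands for a union and [k] for an intersection of weighted spaces. The square in
    [ws_split] reflects that a geodesic cuts [x] into two pieces, each of length at most [ell x]. *)
Record weight_system : Prop := WeightSystem {
  ws_inhJ : inhabited J;
  ws_inhK : inhabited K;
  ws_ge1 : forall j k n, 1 <= om j k n;
  ws_mono : forall j k m n, (m <= n)%N -> om j k m <= om j k n;
  ws_mul : forall j1 j2, exists j, forall k, exists k1 k2,
    forall m n, om j k (m + n) <= om j1 k1 m * om j2 k2 n;
  ws_split : forall j, exists j', forall k', exists k (d : R),
    forall n, n.+1%:R * om j' k' n ^+ 2 <= d * om j k n }.

Definition wcone : set (Z2 -> R) := [set phi | (forall x, 0 <= phi x) /\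
  exists j, forall k, exists M : R, forall x, phi x * om j k (ell x) <= M].

Hypothesis WS : weight_system.

Let om_gt0 j k n : 0 < om j k n.
Proof. exact: lt_le_trans ltr01 (ws_ge1 WS j k n). Qed.

Let om_ge0 j k n : 0 <= om j k n.
Proof. exact: ltW. Qed.

Lemma ellD (x y : Z2) : (ell (x + y)%R <= ell x + ell y)%N.
Proof. by case: x y => [x1 x2] [y1 y2]; rewrite /ell /=; lia. Qed.

(** The least function dominating the prescribed values, used to produce the [chi] of a good cone;
    the supremum over an empty set is 0. *)
Definition envelope (T : Type) (P : T -> Z2 -> Prop) (tau : T -> R) (z : Z2) : R :=
  sup [set tau t | t in [set t | P t z]].

Lemma wcone_envelope (T : Type) (P : T -> Z2 -> Prop) (tau : T -> R) j :
  (forall t, 0 <= tau t) ->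
  (forall k, exists M : R, forall t z, P t z -> tau t * om j k (ell z) <= M) ->
  wcone (envelope P tau) /\ forall t z, P t z -> tau t <= envelope P tau z.
Proof.
move=> t0 h.
have ub z : has_ubound [set tau t | t in [set t | P t z]].
  have [k0] := ws_inhK WS; have [M hM] := h k0.
  exists M => _ [t Ptz <-]; apply: le_trans (hM t z Ptz).
  by rewrite ler_peMr// (ws_ge1 WS).
have le t z : P t z -> tau t <= envelope P tau z.
  by move=> Ptz; apply: ub_le_sup (ub z) _ _; exists t.
have em z : (exists t, P t z) \/ envelope P tau z = 0.
  have [[t Ptz]|nt] := pselect (exists t, P t z); first by left; exists t.
  right; rewrite /envelope (_ : [set tau t | t in _] = set0) ?sup0//.
  by apply/seteqP; split=> // y [t Ptz _]; case: nt; exists t.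
split=> //; split=> [z|].
  by have [[t Ptz]|->//] := em z; apply: le_trans (t0 t) (le t z Ptz).
exists j => k; have [M hM] := h k; exists (`|M|) => z.
have [[t Ptz]|->] := em z; last by rewrite mul0r.
rewrite -ler_pdivlMr//; apply: ge_sup; first by exists (tau t), t.
move=> _ [t' Pt'z <-]; rewrite ler_pdivlMr//; apply: le_trans (ler_norm M).
exact: hM.
Qed.

Lemma wcone_good : good_cone wcone.
Proof.
have [j0] := ws_inhJ WS.
have [k0] := ws_inhK WS.
split; first split.
- split=> //; exists j0 => k; exists 0 => x; by rewrite mul0r.
- by move=> phi [].
- move=> phi psi [p0 [j1 hp]] [q0 [j2 hq]]; split=> [x|]; first by rewrite addr_ge0.
  have [j hj] := ws_mul WS j1 j2; exists j => k; have [k1 [k2 hk]] := hj k.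
  have [M hM] := hp k1; have [N hN] := hq k2.
  (* Putting one argument of [ws_mul] equal to 0 compares the common weight with each of the two
     given ones. *)
  exists (M * om j2 k2 0 + N * om j1 k1 0) => x; rewrite mulrDl; apply: lerD.
    apply: (@le_trans _ _ (phi x * (om j1 k1 (ell x) * om j2 k2 0))).
      by rewrite ler_wpM2l// -[in leLHS](addn0 (ell x)).
    by rewrite mulrA ler_wpM2r.
  apply: (@le_trans _ _ (psi x * (om j1 k1 0 * om j2 k2 (ell x)))).
    by rewrite ler_wpM2l// -[in leLHS](add0n (ell x)).
  by rewrite mulrCA mulrC ler_wpM2r.
- move=> r phi r0 [p0 [j hp]]; split=> [x|]; first by rewrite mulr_ge0.
  exists j => k; have [M hM] := hp k; exists (r * M) => x.
  by rewrite -mulrA ler_wpM2l.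
- move=> phi psi [p0 [j hp]] h; split=> [x|]; first by have /andP[] := h x.
  exists j => k; have [M hM] := hp k; exists M => x; apply: le_trans (hM x).
  by rewrite ler_wpM2r//; have /andP[] := h x.
- move=> x; split=> //; exists j0 => k; exists (om j0 k (ell x)) => y.
  by case: eqVneq => [->|_]; rewrite ?mul1r ?mul0r.
- split=> //; exists j0 => k; exists (om j0 k 1) => y.
  case: (boolP (ell y <= 1)%N) => hy; rewrite ?mul1r ?mul0r//.
  exact: ws_mono WS _ _ _ _ hy.
- move=> phi psi [p0 [j1 hp]] [q0 [j2 hq]].
  have [j hj] := ws_mul WS j1 j2.
  have [||hc le] := @wcone_envelope (Z2 * Z2)%type (fun p z => p.1 + p.2 = z)
      (fun p => phi p.1 * psi p.2) j.
  + by move=> p; rewrite mulr_ge0.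
  + move=> k; have [k1 [k2 hk]] := hj k.
    have [M hM] := hp k1; have [N hN] := hq k2; exists (M * N) => -[x y] _ /= <-.
    apply: (@le_trans _ _ (phi x * psi y * (om j1 k1 (ell x) * om j2 k2 (ell y)))).
      rewrite ler_wpM2l ?mulr_ge0//; apply: le_trans (hk _ _).
      exact: ws_mono WS _ _ _ _ (ellD x y).
    by rewrite mulrACA; apply: ler_pM; rewrite ?mulr_ge0.
  by exists (envelope (fun p z => p.1 + p.2 = z) (fun p => phi p.1 * psi p.2)) => // x y;
    apply: (le (x, y)).
- move=> phi [p0 [j hp]]; have [j' hj] := ws_split WS j.
  (* Each piece of a geodesic receives a square root; their product recovers [phi x] times
     [ell x + 1]. *)
  have [||hc le] := @wcone_envelope Z2 (fun x z => (ell z <= ell x)%N)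
      (fun x => Num.sqrt (phi x * (ell x).+1%:R)) j'.
  + by move=> x; rewrite sqrtr_ge0.
  + move=> k'; have [k [d hk]] := hj k'; have [M hM] := hp k.
    exists (Num.sqrt (`|d| * M)) => x z zx.
    apply: (@le_trans _ _ (Num.sqrt (phi x * (ell x).+1%:R) * om j' k' (ell x))).
      by rewrite ler_wpM2l ?sqrtr_ge0// (ws_mono WS).
    rewrite -[om j' k' (ell x)](ger0_norm (om_ge0 _ _ _)) -sqrtr_sqr -sqrtrM; last first.
      by rewrite mulr_ge0.
    apply: ler_wsqrtr; rewrite -mulrA.
    apply: (@le_trans _ _ (phi x * (`|d| * om j k (ell x)))).
      rewrite ler_wpM2l//; apply: le_trans (hk _) _.
      by rewrite ler_wpM2r// ler_norm.
    by rewrite mulrCA ler_wpM2l.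
  exists (envelope (fun x z => (ell z <= ell x)%N) (fun x => Num.sqrt (phi x * (ell x).+1%:R))) => //.
  move=> x z h.
  have e : 0 <= phi x * (ell x).+1%:R by rewrite mulr_ge0.
  rewrite -[leLHS](sqr_sqrtr e) expr2; apply: ler_pM; rewrite ?sqrtr_ge0//; apply: le.
    exact: leq_trans (leq_addr _ _) h.
  exact: leq_trans (leq_addl _ _) h.
Qed.

End Weights.

Section Instances.
Variable R : realType.

(** The integer bases from 2 on are cofinal among all alpha > 1, and they make the family
    countable. *)
Definition om_exp (_ : unit) (k : nat) (n : nat) : R := k.+2%:R ^+ n.
Definition om_pol (_ : unit) (k : nat) (n : nat) : R := n.+1%:R ^+ k.
Definition om_ana (j : {a : R | 1 < a}) (_ : unit) (n : nat) : R := sval j ^+ n.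
Definition mono_weight (w : nat -> R) : Prop :=
  (forall n, 1 <= w n) /\ {homo w : m n / (m <= n)%N >-> m <= n}.
(* A function on [Z2] is bounded against every increasing weight iff it has
   finite support, so this system describes the fine bornology. *)
Definition om_all (_ : unit) (k : {w : nat -> R | mono_weight w}) (n : nat) : R := sval k n.

Lemma om_exp_ws : weight_system om_exp.
Proof.
split=> //; rewrite /om_exp.
- exact: inhabits 0%N.
- by move=> _ k n; rewrite exprn_ege1// ler1n.
- by move=> _ k m n mn; rewrite ler_weXn2l// ler1n.
- by move=> _ _; exists tt => k; exists k, k => m n; rewrite exprD.
(* The base 2 (k + 2)^2 pays for the square and, by n + 1 <= 2^n, for the linear factor; [.-2]
   undoes the shift in [om_exp]. *)
- move=> _; exists tt => k; exists (2 * k.+2 ^ 2).-2, 1 => n.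
  have -> : (2 * k.+2 ^ 2).-2.+2 = (2 * k.+2 ^ 2)%N by nia.
  rewrite mul1r natrM natrX exprMn -!exprM mulnC ler_wpM2r ?exprn_ge0//.
  by rewrite -natrX ler_nat ltn_expl.
Qed.

Lemma om_pol_ws : weight_system om_pol.
Proof.
split=> //; rewrite /om_pol.
- exact: inhabits 0%N.
- by move=> _ k n; rewrite exprn_ege1// ler1n.
- by move=> _ k m n mn; rewrite lerXn2r ?nnegrE// ler_nat.
- move=> _ _; exists tt => k; exists k, k => m n; rewrite -exprMn lerXn2r ?nnegrE//.
  by rewrite -natrM ler_nat; nia.
(* The exponent 2 k accounts for the square and one more for the linear factor. *)
- move=> _; exists tt => k; exists (k * 2).+1, 1 => n.
  by rewrite mul1r [leRHS]exprS -exprM.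
Qed.

Lemma om_ana_ws : weight_system om_ana.
Proof.
have gt0 (j : {a : R | 1 < a}) : 0 < sval j by apply: lt_trans ltr01 (svalP j).
split; rewrite /om_ana.
- by apply: inhabits; exists 2; rewrite ltr1n.
- exact: inhabits tt.
- by move=> j _ n; rewrite exprn_ege1// ltW// (svalP j).
- by move=> j _ m n mn; rewrite ler_weXn2l// ltW// (svalP j).
- move=> [a ha] [b hb]; have hm : 1 < Num.min a b by rewrite lt_min ha.
  exists (exist _ (Num.min a b) hm) => _; exists tt, tt => m n /=.
  have m0 : 0 <= Num.min a b by apply: ltW; apply: lt_trans ltr01 hm.
  rewrite exprD; apply: ler_pM; rewrite ?exprn_ge0// lerXn2r ?nnegrE//.
  + by rewrite ltW// (lt_trans ltr01).
  + by rewrite ge_min lexx.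
  + by rewrite ltW// (lt_trans ltr01).
  + by rewrite ge_min lexx orbT.
- move=> [a ha].
  have s1 (b : R) : 1 < b -> 1 < Num.sqrt b by move=> hb; rewrite -(sqrtr1 R) ltr_sqrt// (lt_trans ltr01).
  (* Of the four factors [b ^+ n] in [a ^+ n], two pay for the square and one, by Bernoulli's
     inequality, for [n + 1] up to a constant. *)
  set b := Num.sqrt (Num.sqrt a); have hb : 1 < b := s1 _ (s1 _ ha).
  have b4 : b ^+ 4 = a.
    by rewrite (exprM b 2 2) sqr_sqrtr ?sqrtr_ge0// sqr_sqrtr// ltW// (lt_trans ltr01).
  exists (exist _ b hb) => _; exists tt, (1 + (b - 1)^-1) => n /=.
  have d0 : 0 < b - 1 by rewrite subr_gt0.
  have bern : 1 + n%:R * (b - 1) <= b ^+ n.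
    elim: n => [|n IH]; first by rewrite mul0r addr0 expr0.
    rewrite exprS -natr1; have := ler_wpM2l (ltW (lt_trans ltr01 hb)) IH.
    have : 0 <= n%:R * (b - 1) ^+ 2 by rewrite mulr_ge0 ?sqr_ge0.
    by rewrite expr2; nra.
  have i0 : 0 < (b - 1)^-1 by rewrite invr_gt0.
  have step : n.+1%:R <= (1 + (b - 1)^-1) * b ^+ n.
    apply: (@le_trans _ _ ((1 + (b - 1)^-1) * (1 + n%:R * (b - 1)))); last first.
      by rewrite ler_wpM2l// addr_ge0// ltW.
    have -> : (1 + (b - 1)^-1) * (1 + n%:R * (b - 1)) =
        1 + n%:R * (b - 1) + (b - 1)^-1 + n%:R * ((b - 1)^-1 * (b - 1)) by ring.
    rewrite mulVf ?gt_eqF// -natr1.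
    have : 0 <= n%:R * (b - 1) by rewrite mulr_ge0// ltW.
    lra.
  rewrite -b4; apply: (@le_trans _ _ ((1 + (b - 1)^-1) * b ^+ n * b ^+ n ^+ 2)).
    by rewrite ler_wpM2r// exprn_ge0// exprn_ge0// ltW// (lt_trans ltr01).
  rewrite -mulrA; apply: ler_wpM2l; first by rewrite addr_ge0// ltW.
  by rewrite -!exprM -exprD; apply: ler_weXn2l; [exact: ltW|lia].
Qed.

Lemma om_all_ws : weight_system om_all.
Proof.
split=> //; rewrite /om_all.
- by apply: inhabits; exists (fun=> 1); split.
- by move=> _ [w [h1 h2]] n /=.
- by move=> _ [w [h1 h2]] m n /= /h2.
- move=> _ _; exists tt => -[w [h1 h2]].
  (* One has m + n <= 2 max(m, n), and the other factor is at least 1. *)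
  have hw : mono_weight (fun n => w n.*2).
    by split=> // m n mn; apply: h2; rewrite leq_double.
  exists (exist mono_weight _ hw), (exist mono_weight _ hw) => m n /=.
  have w0 k : 0 <= w k by apply: le_trans ler01 (h1 k).
  have [mn|nm] := leqP m n.
    apply: (@le_trans _ _ (w n.*2)); first by apply: h2; lia.
    by rewrite ler_peMl.
  apply: (@le_trans _ _ (w m.*2)); first by apply: h2; lia.
  by rewrite ler_peMr.
- move=> _; exists tt => -[w [h1 h2]].
  have w0 k : 0 <= w k by apply: le_trans ler01 (h1 k).
  have hw : mono_weight (fun n => n.+1%:R * w n ^+ 2).
    split=> [n|m n mn]; first by apply: mulr_ege1; rewrite ?ler1n ?exprn_ege1.
    by apply: ler_pM; rewrite ?exprn_ge0// ?ler_nat// lerXn2r ?nnegrE// h2.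
  by exists (exist mono_weight _ hw), 1 => n /=; rewrite mul1r.
Qed.

End Instances.

(** * The algebras of the noncommutative torus *)

Section Sums.
Variable R : realType.
Local Notation C := R[i].

Lemma esum_leP (h : Z2 -> R) (M : R) : (forall x, 0 <= h x) ->
  (\esum_(x in [set: Z2]) (h x)%:E <= M%:E)%E <-> sums_le h M.
Proof.
move=> h0; split=> [hM s us|hM].
  rewrite -lee_fin; apply: le_trans hM; apply: esum_ge.
  exists [set` s]; first by split=> //; exact: finite_seq.
  by rewrite -fsbig_seq// sumEFin.
apply: ge_ereal_sup => _ [X [finX _]] <-.
by rewrite fsbig_finite//= sumEFin lee_fin; apply: hM; exact: finmap.fset_uniq.
Qed.

Lemma esum_usup (h : Z2 -> R) (M : R) : (forall x, 0 <= h x) -> sums_le h M ->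
  (\esum_(x in [set: Z2]) (h x)%:E)%E = (usup h)%:E.
Proof.
move=> h0 hM; have ub := usup_ub hM; have := (esum_leP (usup h) h0).2 ub.
have : (0 <= \esum_(x in [set: Z2]) (h x)%:E)%E by apply: esum_ge0 => x _; rewrite lee_fin.
case E : (\esum_(x in _) _)%E => [r| |]// _; rewrite lee_fin => ru; congr (_%:E).
have hr : sums_le h r by apply/esum_leP => //; rewrite E.
by apply/eqP; rewrite eq_le ru (usup_le hr).
Qed.

(** Links the sum by positive and negative parts to limits along [initial], in which the extended
    maps are computed. *)
Lemma rsum_cvg (f : Z2 -> R) (M : R) : sums_le (fun x => `|f x|) M ->
  forall e : R, 0 < e -> exists n0, forall n, (n0 <= n)%N ->
    `|\sum_(x <- initial Z2 n) f x - rsum f| < e.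
Proof.
move=> hM e e0.
pose p x := Num.max (f x) 0; pose q x := Num.max (- f x) 0.
have p0 x : 0 <= p x by rewrite le_max lexx orbT.
have q0 x : 0 <= q x by rewrite le_max lexx orbT.
have hp : sums_le p M.
  move=> s us; apply: le_trans (ler_sum _ _) (hM s us) => x _.
  by rewrite ge_max ler_norm normr_ge0.
have hq : sums_le q M.
  move=> s us; apply: le_trans (ler_sum _ _) (hM s us) => x _.
  by rewrite ge_max -normrN ler_norm normr_ge0.
have pq x : f x = p x - q x.
  rewrite /p /q; case: (lerP 0 (f x)) => fx.
    by rewrite max_r ?oppr_le0// subr0.
  by rewrite max_l ?oppr_ge0 1?ltW// sub0r opprK.
have -> : rsum f = usup p - usup q.
  by rewrite /rsum (esum_usup p0 hp) (esum_usup q0 hq).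
have e2 : 0 < e / 2 by rewrite divr_gt0.
have [n1 h1] := usup_en p0 hp e2; have [n2 h2] := usup_en q0 hq e2.
exists (maxn n1 n2) => n; rewrite geq_max => /andP[nn1 nn2].
have := h1 n nn1; have := h2 n nn2.
have := usup_ub hp (en_uniq Z2 n); have := usup_ub hq (en_uniq Z2 n).
under [X in `|X - _|]eq_bigr do rewrite pq.
rewrite big_split sumrN /= ltr_norml; lra.
Qed.

Lemma csum_cvg (f : Z2 -> C) (M : R) : sums_le (fun x => normc (f x)) M ->
  forall e : R, 0 < e -> exists n0, forall n, (n0 <= n)%N ->
    normc (\sum_(x <- initial Z2 n) f x - csum f) < e.
Proof.
move=> hM e e0; have e2 : 0 < e / 2 by rewrite divr_gt0.
have hr : sums_le (fun x => `|complex.Re (f x)|) M.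
  by move=> s us; apply: le_trans (ler_sum _ _) (hM s us) => x _; apply: normc_Re.
have hi : sums_le (fun x => `|complex.Im (f x)|) M.
  by move=> s us; apply: le_trans (ler_sum _ _) (hM s us) => x _; apply: normc_Im.
have [n1 h1] := rsum_cvg hr e2; have [n2 h2] := rsum_cvg hi e2.
exists (maxn n1 n2) => n; rewrite geq_max => /andP[nn1 nn2].
have := h1 n nn1; have := h2 n nn2; rewrite -!raddf_sum.
set z := \sum_(x <- _) f x; rewrite /csum => hi' hr'.
set r := rsum _ in hr' *; set i := rsum _ in hi' *.
have -> : z - Complex r i = Complex (complex.Re z - r) (complex.Im z - i).
  by case: (z).
have := normc_le (complex.Re z - r) (complex.Im z - i).
by move: hi' hr' => /=; lra.
Qed.

End Sums.

(** * The product of formal series as a bounded bilinear map *)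

Section Convolution.
Variables (R : realType) (theta : R).
Local Notation C := R[i].

Definition tc (x y : Z2) : C := lambda theta ^ (- (x.2 * y.1)).

Lemma lambda_neq0 : lambda theta != 0.
Proof.
apply/eqP => e; have := normc_lambda theta 1.
by rewrite expr1z e normc0 => /eqP; rewrite eq_sym oner_eq0.
Qed.

(** The exponent is biadditive, and biadditive maps are 2-cocycles. *)
Lemma tc_cocycle g h z : tc g h * tc (g + h) z = tc g (h + z) * tc h z.
Proof.
rewrite /tc -!expfzDr ?lambda_neq0//; congr (_ ^ _) => /=; ring.
Qed.

Lemma tc0l z : tc 0 z = 1. Proof. by rewrite /tc mul0r oppr0 expr0z. Qed.
Lemma tc0r z : tc z 0 = 1. Proof. by rewrite /tc mulr0 oppr0 expr0z. Qed.
Lemma tc_norm x y : normc (tc x y) = 1. Proof. exact: normc_lambda. Qed.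

Variables (V : bornSpace R) (Phi : set (Z2 -> R)) (co : V -> Z2 -> C) (m : V -> V -> V).
Hypotheses (HV : seqspace Phi co) (HG : good_cone Phi).
Hypothesis mE : forall u v, co (m u v) = tconv theta (co u) (co v).

Lemma co_cvg (u : nat -> V) l x : born_cvg u l ->
  forall e : R, 0 < e -> exists n0, forall n, (n0 <= n)%N -> normc (co (u n) x - co l x) < e.
Proof.
move=> [T [d [/(co_born HV)[phi Pp hT] d0 hu]]] e e0.
have p0 := cone_ge0 (ss_cone HV) Pp; have q0 : 0 < phi x + 1 by rewrite ltr_wpDl.
have [n0 hn] := (cvg0P d).1 d0 _ (divr_gt0 e0 q0); exists n0 => n nn.
have [t Tt et] := hu n; rewrite -(coB HV) et (coZ HV) normcM normcR.
have := nle_coord x p0 (hT t Tt); rewrite mul1r => ht.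
apply: (@le_lt_trans _ _ (`|d n| * (phi x + 1))).
  by rewrite ler_wpM2l// (le_trans ht)// lerDl.
by rewrite -ltr_pdivlMr// hn.
Qed.

Lemma limit_unique (z : nat -> C) a b :
  (forall e : R, 0 < e -> exists n0, forall n, (n0 <= n)%N -> normc (z n - a) < e) ->
  (forall e : R, 0 < e -> exists n0, forall n, (n0 <= n)%N -> normc (z n - b) < e) -> a = b.
Proof.
move=> ha hb; apply/eqP; rewrite -subr_eq0; apply/eqP; apply: eq0_normc.
apply/eqP; rewrite eq_le normc_ge0 andbT; apply/ler_addgt0Pl => e e0; rewrite addr0.
have e2 : 0 < e / 2 by rewrite divr_gt0.
have [n1 h1] := ha _ e2; have [n2 h2] := hb _ e2.
have {}h1 := h1 (maxn n1 n2) (leq_maxl _ _); have {}h2 := h2 (maxn n1 n2) (leq_maxr _ _).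
have -> : a - b = (z (maxn n1 n2) - b) - (z (maxn n1 n2) - a).
  by rewrite opprB [RHS]addrC addrA subrK.
apply: le_trans (le_normcD _ _) _; rewrite normcN; lra.
Qed.

Lemma conv_bounded_on_basis :
  bounded_on_basis (tens Phi Phi) (fun p => tc p.1 p.2 *: unit_vec co (p.1 + p.2)).
Proof.
apply: (bounded_on_basisP HV) => chi [h0 [phi [psi [Pp Pq h]]]].
have [phi' Pp' h'] := gc_mul HG Pp Pq; exists phi' => // -[x y].
rewrite scalerA; apply: (nle_be HV) => //; rewrite normcM normcR tc_norm.
by rewrite mulr1 mul1r ger0_norm// (le_trans (h x y)).
Qed.

(** The extension from basis vectors and the coordinatewise series are both limits of the same
    partial sums, obtained by expanding [u]. *)
Lemma tconv_bext u v :
  m u v = bext HV HV (fun x y => tc x y *: unit_vec co (x + y)) u v.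
Proof.
have cV := seqspace_complete HV.
have [bm em] := bextP HV HV (g := fun x y => tc x y *: unit_vec co (x + y)) cV conv_bounded_on_basis.
set m0 := bext _ _ _ in bm em *.
(* Left multiplication by a unit vector twists and translates, so only one term in the expansion of
   [w] contributes to a coordinate. *)
have shift y w x : co (m0 (unit_vec co y) w) x = tc y (x - y) * co w (x - y).
  have bl : blin (m0 (unit_vec co y)) := bilinear_blin _ cV cV bm.
  have [L LE] := linear_exists bl.1.
  apply: (limit_unique (co_cvg x (born_cvg_map bl.1 bl.2 (be_cvg HV w)))) => e e0.
  exists (pickle (x - y)).+1 => n hn.
  rewrite -LE linear_sum (co_sum HV) (bigD1_seq (x - y)) ?en_uniq ?mem_en//=.
  rewrite linearZ /= LE em !(coZ HV) (co_be HV) /= [y + _]addrC subrK eqxx mulr1.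
  rewrite big1 ?addr0 => [|z zx].
    by rewrite [_ * tc _ _]mulrC subrr normc0.
  rewrite linearZ /= LE em !(coZ HV) (co_be HV) /= [X in (X : bool)%:R](_ : _ = false) ?mulr0//.
  by apply: contraNF zx => /eqP ->; rewrite [y + _]addrC addrK.
apply: (co_inj HV); apply/funext => x; rewrite mE /tconv.
have bl : blin (fun u => m0 u v) by apply: (blin_l v cV cV bm (blin_id V)).
have [L LE] := linear_exists bl.1.
apply/esym; apply: (limit_unique (co_cvg x (born_cvg_map bl.1 bl.2 (be_cvg HV u)))).
have [phi Pp [u0 hu]] := co_disk HV u; have [psi Pq hv] := co_disk HV v.
have [chi Pc hc] := gc_mul HG Pp Pq.
have p0 := cone_ge0 (ss_cone HV) Pp.
(* The bound [phi y * psi (x - y) <= chi x] leaves the sum of [normc (co u y) / phi y], which is at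
   most 1. *)
have hs : sums_le (fun y => normc (co u y * co v (x - y) * tc y (x - y))) (chi x).
  move=> s us; apply: (@le_trans _ _ (\sum_(y <- s) (normc (co u y) / phi y) * chi x)).
    apply: ler_sum => y _; rewrite !normcM tc_norm mulr1.
    have [py|py] := eqVneq (phi y) 0; first by rewrite u0// normc0 !mul0r.
    apply: (@le_trans _ _ (normc (co u y) / phi y * (phi y * normc (co v (x - y))))).
      by rewrite mulrA divfK.
    rewrite ler_wpM2l ?divr_ge0 ?normc_ge0//.
    apply: (@le_trans _ _ (phi y * psi (x - y))).
      rewrite ler_wpM2l// -[leRHS]mul1r.
      exact: nle_coord (cone_ge0 (ss_cone HV) Pq) hv.
    by have := hc y (x - y); rewrite [y + _]addrC subrK.
  rewrite -mulr_suml -[leRHS]mul1r ler_wpM2r ?hu//.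
  exact: cone_ge0 (ss_cone HV) _ Pc x.
move=> e e0; have [n0 hn] := csum_cvg hs e0; exists n0 => n /hn; apply: le_lt_trans.
rewrite le_eqVlt; apply/orP; left; apply/eqP; congr (normc (_ - _)).
rewrite -LE linear_sum (co_sum HV); apply: eq_bigr => y _.
by rewrite linearZ /= LE (coZ HV) shift -mulrA [tc _ _ * _]mulrC.
Qed.

Lemma tconv_bilinear : bounded_bilinear m /\
  forall x y, m (unit_vec co x) (unit_vec co y) = tc x y *: unit_vec co (x + y).
Proof.
have cV := seqspace_complete HV.
have [bm em] := bextP HV HV (g := fun x y => tc x y *: unit_vec co (x + y)) cV conv_bounded_on_basis.
have -> : m = bext HV HV (fun x y => tc x y *: unit_vec co (x + y)).
  by apply/funext => u; apply/funext => v; apply: tconv_bext.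
by [].
Qed.

End Convolution.

(** * The function algebras as unions of disks *)

Section Models.
Variable R : realType.
Local Notation C := R[i].

Lemma wnorm_leP (w : Z2 -> R) (a : Z2 -> C) (M : R) : (forall x, 0 <= w x) ->
  (wnorm w a <= M%:E)%E <-> sums_le (fun x => normc (a x) * w x) M.
Proof. by move=> w0; apply: esum_leP => x; rewrite mulr_ge0 ?normc_ge0. Qed.

Lemma wnorm_ltyP (w : Z2 -> R) (a : Z2 -> C) : (forall x, 0 <= w x) ->
  (wnorm w a < +oo)%E <-> exists M, sums_le (fun x => normc (a x) * w x) M.
Proof.
move=> w0; split=> [h|[M /wnorm_leP h]]; last exact: le_lt_trans (h w0) (ltry _).
have := wnorm_ge0 a w0; case E : (wnorm w a) h => [M| |]// _ _; exists M.
by apply/wnorm_leP => //; rewrite E.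
Qed.

Lemma nle_weight phi (w : Z2 -> R) (a : Z2 -> C) (M : R) :
  (forall x, 0 <= phi x) -> (forall x, 0 <= w x) -> nle phi 1 a ->
  (forall x, phi x * w x <= M) -> sums_le (fun x => normc (a x) * w x) M.
Proof.
move=> p0 w0 [a0 ha] hM s us.
have M0 : 0 <= M by apply: le_trans (hM 0); rewrite mulr_ge0.
apply: (@le_trans _ _ (\sum_(x <- s) normc (a x) / phi x * M)).
  apply: ler_sum => x _; have [px|px] := eqVneq (phi x) 0.
    by rewrite a0// normc0 !mul0r.
  apply: (@le_trans _ _ (normc (a x) / phi x * (phi x * w x))); first by rewrite mulrA divfK.
  by rewrite ler_wpM2l// divr_ge0 ?normc_ge0.
by rewrite -mulr_suml -[leRHS]mul1r ler_wpM2r// ha.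
Qed.

Section Intersection.
Variable om : unit -> nat -> nat -> R.
Hypothesis WS : weight_system om.
Let w k (x : Z2) := om tt k (ell x).

Let om_gt0 k n : 0 < om tt k n.
Proof. exact: lt_le_trans ltr01 (ws_ge1 WS tt k n). Qed.

(* [phi] is the inverse of the weighted sum of the weights [w k / M k];
   truncating this sum at [k = ell x] makes it finite and does not affect its
   growth in [x]. *)
Lemma common_weight (M : nat -> R) : (forall k, 0 < M k) -> exists2 phi, wcone om phi &
  forall a : Z2 -> C, (forall k, sums_le (fun x => normc (a x) * w k x) (M k)) -> nle phi 1 a.
Proof.
move=> M0.
pose g k x := 2^-1 ^+ k.+1 * (w k x / M k).
have h2 : (0 : R) < 2^-1 by rewrite invr_gt0.
have g0 k x : 0 < g k x by rewrite mulr_gt0 ?exprn_gt0// divr_gt0// om_gt0.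
pose v x := \sum_(k < (ell x).+1) g k x.
have gv k x : (k <= ell x)%N -> g k x <= v x.
  move=> kx; rewrite /v (bigD1 (inord k)) //= inordK ?ltnS// lerDl sumr_ge0// => i _.
  exact: ltW.
have v0 x : 0 < v x by apply: lt_le_trans (g0 0%N x) (gv 0%N x _).
exists (fun x => (v x)^-1).
  split=> [x|]; first by rewrite invr_ge0 ltW.
  exists tt => k; exists (2 ^+ k.+1 * M k + 2 * M 0%N * om tt k k) => x.
  have A0 : 0 <= 2 ^+ k.+1 * M k by rewrite mulr_ge0 ?exprn_ge0// ltW.
  have B0 : 0 <= 2 * M 0%N * om tt k k by rewrite mulr_ge0 ?mulr_ge0// ltW.
  (* For [k <= ell x] the k-th summand of [v] gives the bound; for the finitely many shorter [x] the
     summand 0 bounds [v] below and monotonicity gives [om tt k k]. *)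
  have [kx|xk] := leqP k (ell x).
    apply: (@le_trans _ _ (2 ^+ k.+1 * M k)); last by rewrite lerDl.
    rewrite mulrC ler_pdivrMr//.
    apply: le_trans (ler_wpM2l A0 (gv k x kx)).
    rewrite /g exprVn mulrACA mulfV ?expf_neq0// mul1r [M k * _]mulrC divfK ?gt_eqF//.
  apply: (@le_trans _ _ (2 * M 0%N * om tt k k)); last by rewrite lerDr.
  apply: ler_pM; [by rewrite invr_ge0 ltW|exact: ltW| |exact: (ws_mono WS _ _ (ltnW xk))].
  have := gv 0%N x isT; rewrite /g expr1 => h.
  have : (2 * M 0%N)^-1 <= v x.
    apply: le_trans h; rewrite invfM; apply: ler_wpM2l; first exact: ltW.
    by rewrite ler_peMl ?(ws_ge1 WS)// invr_ge0 ltW.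
  by rewrite -{2}[2 * M 0%N]invrK lef_pV2 ?posrE ?invr_gt0 ?mulr_gt0.
move=> a ha; split=> [x /eqP|s us]; first by rewrite invr_eq0 gt_eqF.
pose N := \max_(x <- s) (ell x).+1.
have vN x : x \in s -> v x <= \sum_(k < N) g k x.
  move=> xs; have xN : ((ell x).+1 <= N)%N.
    exact: (@leq_bigmax_seq _ s xpredT (fun x => (ell x).+1) x).
  rewrite /v (big_ord_widen _ (fun k => g k x) xN) [leLHS]big_mkcond.
  by apply: ler_sum => k _; case: ifP => // _; apply: ltW.
apply: (@le_trans _ _ (\sum_(x <- s) \sum_(k < N) 2^-1 ^+ k.+1 * (normc (a x) * w k x / M k))).
  rewrite big_seq [leRHS]big_seq; apply: ler_sum => x xs; rewrite invrK.
  apply: le_trans (ler_wpM2l (normc_ge0 _) (vN x xs)) _.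
  rewrite mulr_sumr; apply: ler_sum => k _.
  by rewrite /g mulrCA [normc _ * (_ / _)]mulrA.
(* After exchanging the sums, each [k] contributes at most its geometric coefficient, and these
   total less than 1. *)
rewrite exchange_big /=; apply: (@le_trans _ _ (\sum_(k < N) 2^-1 ^+ k.+1)).
  apply: ler_sum => k _; rewrite -mulr_sumr -mulr_suml -[leRHS]mulr1.
  apply: ler_wpM2l; first by rewrite exprn_ge0// ltW.
  by rewrite ler_pdivrMr// mul1r ha.
have -> : \sum_(k < N) (2^-1 : R) ^+ k.+1 = 1 - 2^-1 ^+ N.
  elim: (N) => [|n IH]; first by rewrite big_ord0 expr0 subrr.
  by rewrite big_ord_recr /= IH !exprS; field.
by rewrite gerBl exprn_ge0// ltW.
Qed.

Variables (E : Defs.subspace (Z2 -> C)) (Bn : set (set (subspace_of E))).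
Hypothesis hE : forall a, subspace_set E a <-> forall k, (wnorm (w k) a < +oo)%E.
Hypothesis hB : forall S, Bn S <-> forall k, norm_bounded (w k) S.

Let w0 k x : 0 <= w k x. Proof. exact: ltW (om_gt0 _ _). Qed.

(** A bounded set has one bound per weight; [common_weight] merges them into a single disk, and
    conversely each member of the cone bounds all weights. *)
Lemma intersection_seqspace :
  @seqspace R Z2 (wcone om) (BornSpace Bn) (fun u => \val u).
Proof.
have bound (S : set (subspace_of E)) :
    (forall k, exists M, forall u, S u -> sums_le (fun x => normc (\val u x) * w k x) M) ->
    exists2 phi, wcone om phi & forall u, S u -> nle phi 1 (\val u).
  move=> /choice[M hM].
  have [k|phi Pp hp] := @common_weight (fun k => `|M k| + 1); first by rewrite ltr_wpDl.
  exists phi => // u Su; apply: hp => k s us; apply: le_trans (hM k u Su s us) _.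
  by have := ler_norm (M k); lra.
split=> //.
- exact: gc_cone (wcone_good WS).
- move=> u; have [k|phi Pp hp] := bound [set u]; last by exists phi => //; apply: hp.
  have /set_mem/hE/(_ k)/wnorm_ltyP[//|M hM] := subspace_valP u.
  by exists M => _ ->.
- move=> phi a [p0 [[] hp]] ha.
  have Ea : subspace_set E a.
    apply/hE => k; apply/wnorm_ltyP => //; have [M hM] := hp k.
    by exists M; exact: (nle_weight p0 (w0 k) ha hM).
  by exists (sub_elt Ea).
- move=> S; split=> [/hB h|[phi [p0 [[] hp]] hS]].
    apply: bound => k; have [M hM] := h k; exists M => u /hM.
    by move/wnorm_leP; apply.
  apply/hB => k; have [M hM] := hp k; exists M => u /hS h.
  by apply/wnorm_leP => //; exact: (nle_weight p0 (w0 k) h hM).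
Qed.

End Intersection.

Lemma smooth_seqspace :
  @seqspace R Z2 (wcone (@om_pol R)) (smooth_space R) (fun u => \val u).
Proof. by apply: (intersection_seqspace (om_pol_ws R)). Qed.

Lemma hol_seqspace :
  @seqspace R Z2 (wcone (@om_exp R)) (hol_space R) (fun u => \val u).
Proof.
have gt1 k : 1 < k.+2%:R :> R by rewrite ltr1n.
have dom (al : R) : 1 < al -> exists k, forall a, (wnorm (exp_weight al) a <= wnorm (exp_weight k.+2%:R) a)%E.
  (* This index stands for the base [truncn al + 2], which exceeds [al]. *)
  move=> a1; exists (Num.truncn al) => a; apply: wnorm_mono => x.
  rewrite /exp_weight lerXn2r ?nnegrE ?(ltW (lt_trans ltr01 a1))// ltW//.
  by apply: lt_trans (truncnS_gt al) _; rewrite ltr_nat.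
apply: (intersection_seqspace (om_exp_ws R)).
- move=> a; split=> [h k|h al al1]; first exact: h.
  by have [k hk] := dom al al1; apply: le_lt_trans (hk a) (h k).
- move=> S; split=> [h k|h al al1]; first exact: h.
  have [k hk] := dom al al1; have [M hM] := h k; exists M => u Su.
  exact: le_trans (hk _) (hM u Su).
Qed.

Lemma ana_seqspace :
  @seqspace R Z2 (wcone (@om_ana R)) (ana_space R) (fun u => \val u).
Proof.
have e0 (al : R) : 1 < al -> forall x, 0 <= exp_weight al x by move=> h x; apply: exp_weight_ge0.
have bound (S : set (subspace_of (ana_sub R))) (al M : R) : 1 < al ->
    (forall u, S u -> sums_le (fun x => normc (\val u x) * exp_weight al x) M) ->
    exists2 phi, wcone (@om_ana R) phi & forall u, S u -> nle phi 1 (\val u).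
  move=> a1 hS; have M1 : 0 < `|M| + 1 by rewrite ltr_wpDl.
  have a0 : 0 < al by apply: lt_trans ltr01 a1.
  have e1 x : 0 < exp_weight al x by rewrite exprn_gt0.
  exists (fun x => (`|M| + 1) * (exp_weight al x)^-1).
    split=> [x|]; first by rewrite mulr_ge0 ?invr_ge0 ?ltW.
    exists (exist _ al a1) => k; exists (`|M| + 1) => x.
    by rewrite -mulrA mulVf ?mulr1// gt_eqF.
  move=> u /hS h; apply/nle_rescale => //; split=> [x /eqP|s us].
    by rewrite invr_eq0 gt_eqF.
  under eq_bigr do rewrite invrK.
  by apply: le_trans (h s us) _; rewrite mulr1; have := ler_norm M; lra.
split=> //.
- exact: gc_cone (wcone_good (om_ana_ws R)).
- move=> u; have /set_mem[al a1 /wnorm_ltyP[|M hM]] := subspace_valP u; first exact: e0.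
  by have [_ ->|phi Pp hp] := bound [set u] al M a1; [|exists phi => //; apply: hp].
- move=> phi a [p0 [[al a1] hp]] ha; have [M hM] := hp tt.
  have Ea : subspace_set (ana_sub R) a.
    exists al => //; apply/wnorm_ltyP; first exact: e0.
    by exists M; apply: nle_weight ha hM => //; apply: e0.
  by exists (sub_elt Ea).
- move=> S; split=> [[al a1 [M hM]]|[phi [p0 [[al a1] hp]] hS]].
    by apply: (bound S al M a1) => u /hM /wnorm_leP; apply; apply: e0.
  have [M hM] := hp tt; exists al => //; exists M => u /hS h.
  apply/wnorm_leP; first exact: e0.
  by apply: nle_weight h hM => //; apply: e0.
Qed.

End Models.

(** * The fine bornology as a sequence space *)

Section PolynomialModel.
Variable R : realType.
Local Notation C := R[i].

Lemma ball_finite n : finite_set [set x : Z2 | (ell x <= n)%N].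
Proof.
pose f (q : 'I_n.+1 * 'I_n.+1 * (bool * bool)) : Z2 :=
  (if q.2.1 then - (q.1.1 : nat)%:Z else (q.1.1 : nat)%:Z,
   if q.2.2 then - (q.1.2 : nat)%:Z else (q.1.2 : nat)%:Z).
apply: (@sub_finite_set _ _ (f @` setT)); last by apply: finite_image; apply: finite_finset.
move=> [x1 x2]; rewrite /ell /= => h.
exists (inord `|x1|, inord `|x2|, (x1 < 0, x2 < 0)) => //.
by rewrite /f /= !inordK; [congr pair; case: ifP; lia|lia|lia].
Qed.

(** It suffices to test [phi] against one increasing weight adapted to it. *)
Lemma wcone_all_finite (phi : Z2 -> R) :
  wcone (@om_all R) phi -> finite_set [set x | phi x != 0].
Proof.
move=> [p0 [[] hp]].
have /choice[s hs] : forall n, exists s : seq Z2, uniq s /\ forall x, (x \in s) = (ell x <= n)%N.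
  move=> n; have /finite_seqP[s hs] := ball_finite n; exists (undup s).
  rewrite undup_uniq; split=> // x; rewrite mem_undup.
  apply/idP/idP => h; last by have : [set` s] x by rewrite -hs.
  by have : [set y : Z2 | (ell y <= n)%N] x by rewrite hs.
pose g x := (ell x)%:R * (phi x)^-1.
have g0 x : 0 <= g x by rewrite mulr_ge0// invr_ge0.
(* On the support of [phi] this forces [phi x * w (ell x) >= ell x], so the support lies in a ball;
   off the support the inverse of 0 is 0. *)
pose w n := 1 + \sum_(x <- s n) g x.
have mw : mono_weight w.
  split=> [n|m n mn]; first by rewrite lerDl sumr_ge0.
  have [us hm] := hs m; have [us' hn] := hs n.
  rewrite lerD2l; apply: sum_subset => // x; rewrite hm hn => h; exact: leq_trans h mn.
have [M hM] := hp (exist _ w mw).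
apply: (sub_finite_set _ (ball_finite (Num.truncn M))) => x /= px.
have := hM x; rewrite /om_all /= => h.
have [us hx] := hs (ell x).
have le : (ell x)%:R <= M.
  apply: le_trans h; rewrite /w (bigD1_seq x) ?hx//= mulrDr.
  rewrite (_ : phi x * (g x + _) = (ell x)%:R + phi x * \sum_(y <- s (ell x) | y != x) g y).
    by rewrite addrA addrAC lerDr addr_ge0// mulr_ge0// sumr_ge0.
  by rewrite mulrDr /g mulrCA mulfV// mulr1.
by rewrite truncn_ge_nat// (le_trans _ le).
Qed.

Lemma finite_wcone (J K : Type) (om : J -> K -> nat -> R) (phi : Z2 -> R) :
  weight_system om -> (forall x, 0 <= phi x) -> finite_set [set x | phi x != 0] ->
  wcone om phi.
Proof.
move=> WS p0 /finite_seqP[t ht]; split=> //; have [j] := ws_inhJ WS; exists j => k.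
have t0 x : 0 <= phi x * om j k (ell x).
  by rewrite mulr_ge0// (le_trans ler01)// (ws_ge1 WS).
exists (\sum_(y <- undup t) phi y * om j k (ell y)) => x.
have [px|px] := eqVneq (phi x) 0; first by rewrite px mul0r sumr_ge0.
have xt : x \in undup t.
  by rewrite mem_undup; have : [set` t] x by rewrite -ht.
by rewrite (bigD1_seq x) ?undup_uniq//= lerDl sumr_ge0.
Qed.

(** On a finite set a coordinatewise bound costs only the number of points as an l1-bound. *)
Lemma nle_finite (a : Z2 -> C) (b : Z2 -> R) (t : seq Z2) :
  (forall x, normc (a x) <= b x) -> (forall x, b x != 0 -> x \in t) ->
  nle (fun x => (size t)%:R * b x) 1 a.
Proof.
move=> ab bt.
have b0 x : 0 <= b x by apply: le_trans (normc_ge0 _) (ab x).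
have az x : b x = 0 -> a x = 0.
  move=> bx; apply: eq0_normc; apply/eqP; rewrite eq_le normc_ge0 andbT.
  by have := ab x; rewrite bx.
split=> [x /eqP|s us].
  rewrite mulf_eq0 => /orP[|/eqP/az//]; rewrite pnatr_eq0 size_eq0 => /eqP t0.
  by apply: az; apply/eqP; apply: contraT => /bt; rewrite t0.
apply: (@le_trans _ _ (\sum_(x <- s) (size t)%:R^-1 * (x \in t)%:R)).
  apply: ler_sum => x _; have [bx|bx] := eqVneq (b x) 0.
    by rewrite az// normc0 mul0r mulr_ge0// invr_ge0.
  rewrite (bt x bx) mulr1 invfM mulrCA -[leRHS]mulr1 ler_wpM2l ?invr_ge0//.
  by rewrite ler_pdivrMr ?mul1r// lt_neqAle eq_sym bx b0.
rewrite -mulr_sumr -natr_sum.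
have -> : (\sum_(x <- s) (x \in t) = size [seq x <- s | x \in t])%N.
  by rewrite size_filter -sum1_count [RHS]big_mkcond; apply: eq_bigr => x _; case: (x \in t).
have : (size [seq x <- s | x \in t] <= size t)%N.
  by apply: uniq_leq_size; [exact: filter_uniq|move=> x; rewrite mem_filter => /andP[]].
case: (size t) => [|n] h; first by rewrite invr0 mul0r.
by rewrite ler_pdivrMl ?ltr0n// mulr1 ler_nat.
Qed.

Lemma sub_val_linear (E : Defs.subspace (Z2 -> C)) c (u v : subspace_of E) x :
  \val (c *: u + v) x = c * \val u x + \val v x.
Proof. by rewrite linearP. Qed.

Lemma sub_val_sum (E : Defs.subspace (Z2 -> C)) n (F : 'I_n -> subspace_of E) x :
  \val (\sum_i F i) x = \sum_i \val (F i) x.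
Proof. exact: (big_morph (fun u : subspace_of E => \val u x)). Qed.

Lemma poly_seqspace :
  @seqspace R Z2 (wcone (@om_all R)) (poly_space R) (fun u => \val u).
Proof.
have nle_b (S : set (subspace_of (poly_sub R))) (b : Z2 -> R) :
    finite_set [set x | b x != 0] -> (forall x, 0 <= b x) ->
    (forall u, S u -> forall x, normc (\val u x) <= b x) ->
    exists2 phi, wcone (@om_all R) phi & forall u, S u -> nle phi 1 (\val u).
  move=> fb b0 hb; have /finite_seqP[t ht] := fb.
  exists (fun x => (size t)%:R * b x); last first.
    move=> u /hb h; apply: nle_finite => // x bx.
    by have : [set` t] x by rewrite -ht.
  apply: finite_wcone; [exact: om_all_ws|by move=> x; rewrite mulr_ge0|].
  apply: (sub_finite_set _ fb) => x; apply: contra_neq => ->; by rewrite mulr0.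
split.
- exact: gc_cone (wcone_good (om_all_ws R)).
- exact: sub_val_linear.
- exact: val_inj.
- move=> u; have [|x|_ -> x|phi Pp hp] := nle_b [set u] (fun x => normc (\val u x)) => //.
  + have /set_mem := subspace_valP u; apply: sub_finite_set => x /=.
    by apply: contra_neq => ->; rewrite normc0.
  + exact: normc_ge0.
  + by exists phi => //; apply: hp.
- move=> phi a Pp [a0 _].
  have Ea : subspace_set (poly_sub R) a.
    apply: (sub_finite_set _ (wcone_all_finite Pp)) => x /=.
    by apply: contra_neq => /a0.
  by exists (sub_elt Ea).
- move=> S; split=> [[n [v [M hS]]]|[phi Pp hS]].
    pose b x := `|M| * \sum_i normc (\val (v i) x).
    have b0 x : 0 <= b x by rewrite mulr_ge0// sumr_ge0// => i _; rewrite normc_ge0.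
    apply: (nle_b S b) => //.
      apply: (@sub_finite_set _ _ (\bigcup_(i in [set: 'I_n]) [set x | \val (v i) x != 0])).
        move=> x /= bx; apply: contrapT => h; move/eqP: bx; apply.
        rewrite /b big1 ?mulr0// => i _.
        have [->|vx] := eqVneq (\val (v i) x) 0; first by rewrite normc0.
        by case: h; exists i.
      apply: bigcup_finite; first exact: finite_finset.
      by move=> i _; have /set_mem := subspace_valP (v i).
    move=> u /hS[c hc ->] x; rewrite sub_val_sum /b mulr_sumr.
    elim/big_ind2: _ => [|z r z' r' h h'|i _]; first by rewrite normc0.
      by apply: le_trans (le_normcD _ _) _; apply: lerD.
    rewrite normcM ler_wpM2r ?normc_ge0//.
    exact: le_trans (hc i) (ler_norm M).
  have p0 := Pp.1; have /finite_seqP[t0 ht0] := wcone_all_finite Pp.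
  pose t := undup t0.
  have ht x : phi x != 0 -> x \in t.
    by move=> px; rewrite mem_undup; have : [set` t0] x by rewrite -ht0.
  (* The unit vectors on the support of [phi] span the finite dimensional space, and the total mass
     of [phi] bounds every coordinate. *)
  exists (size t), (fun i => @sub_elt R (poly_sub R) _ (poly_delta R (nth 0 t i))),
    (\sum_(y <- t) phi y) => u Su.
  have nu := hS u Su; exists (fun i => \val u (nth 0 t i)) => [i|].
    apply: le_trans (nle_coord _ p0 nu) _; rewrite mul1r.
    by rewrite (bigD1_seq (nth 0 t i)) ?undup_uniq ?mem_nth//= lerDl sumr_ge0.
  apply: val_inj; apply/funext => x; rewrite sub_val_sum.
  rewrite (eq_bigr (fun i : 'I_(size t) => \val u (nth 0 t i) * (x == nth 0 t i)%:R)) //.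
  rewrite -(big_mkord xpredT (fun i => \val u (nth 0 t i) * (x == nth 0 t i)%:R)).
  rewrite -(big_nth 0 xpredT (fun y => \val u y * (x == y)%:R)).
  have [xt|xt] := boolP (x \in t).
    rewrite (bigD1_seq x) ?undup_uniq//= eqxx mulr1 big1 ?addr0// => y.
    by rewrite eq_sym => /negPf ->; rewrite mulr0.
  rewrite big_seq big1; last first.
    by move=> y yt; case: eqVneq => [xy|_]; [rewrite xy yt in xt|rewrite mulr0].
  by apply: nu.1; apply/eqP; apply: contraNT xt; apply: ht.
Qed.

End PolynomialModel.

(** * The embeddings of the Laurent polynomials *)

Section Torus.
Variables (R : realType) (theta : R).
Local Notation C := R[i].
Local Notation val_co := (fun u => \val u).

Definition torus_twisted (A : bornAlg R) (Phi : set (Z2 -> R)) (co : A -> Z2 -> C)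
    (G : good_cone Phi) (S : seqspace Phi co)
    (mE : forall u v, co (amul u v) = tconv theta (co u) (co v))
    (oneE : co (aone A) = delta R 0) : twisted_algebra (tc theta) :=
  let bm := tconv_bilinear S G mE in
  TwistedAlgebra G S bm.1 bm.2 (co_eq_be S oneE).

Definition poly_twisted := @torus_twisted (torus_poly theta) _ val_co
  (wcone_good (om_all_ws R)) (poly_seqspace R) (fun u v => erefl) erefl.

(** Finitely supported functions belong to every [wcone]; this gives both the boundedness of [f] and
    the inclusion of cones needed for base change. *)
Lemma embedding_isocohomological (J K : Type) (om : J -> K -> nat -> R) (B : bornAlg R)
    (co : B -> Z2 -> C) (f : torus_poly theta -> B) :
  weight_system om -> seqspace (wcone om) co ->
  (forall u v, co (amul u v) = tconv theta (co u) (co v)) -> co (aone B) = delta R 0 ->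
  (forall u, co (f u) = \val u) -> isocohomological f.
Proof.
move=> WS SB mE oneE fE.
have bf : blin f.
  split=> [c u v|S /(co_born (poly_seqspace R))[phi Pp hS]].
    apply: (co_inj SB); apply/funext => x; rewrite (co_linear SB) !fE.
    exact: (co_linear (poly_seqspace R) c u v x).
  apply/(co_born SB); exists phi; last by move=> _ [u Su <-]; rewrite fE; apply: hS.
  by apply: finite_wcone => //; [exact: Pp.1|exact: wcone_all_finite].
have fb x : f (unit_vec (fun u : torus_poly theta => \val u) x) = unit_vec co x.
  by apply: (co_eq_be SB); rewrite fE; exact: (co_be (poly_seqspace R) x).
pose TB := @torus_twisted B _ co (wcone_good WS) SB mE oneE.
have AB : cone_le poly_twisted TB.
  by move=> phi Pp; apply: finite_wcone => //; [exact: Pp.1|exact: wcone_all_finite].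
exact: (@twisted_isocohomological R (tc theta) (tc_cocycle theta) (tc0l theta) (tc0r theta)
  (@tc_norm R theta) poly_twisted TB f AB bf fb (@wcone_all_finite R)).
Qed.

End Torus.

Theorem theorem59 (R : realType) (theta : R) :
  [/\ isocohomological (@poly_to_hol R theta),
      isocohomological (@poly_to_ana R theta)
    & isocohomological (@poly_to_smooth R theta)].
Proof.
split.
- exact: (embedding_isocohomological (f := @poly_to_hol R theta) (om_exp_ws R)
    (hol_seqspace R) (fun u v => erefl) erefl (fun u => erefl)).
- exact: (embedding_isocohomological (f := @poly_to_ana R theta) (om_ana_ws R)
    (ana_seqspace R) (fun u v => erefl) erefl (fun u => erefl)).
- exact: (embedding_isocohomological (f := @poly_to_smooth R theta) (om_pol_ws R)
    (smooth_seqspace R) (fun u v => erefl) erefl (fun u => erefl)).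
Qed.
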